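(* Let $X \in \{A, B, C, D\}$ and let $(W,S)$ be a Coxeter system. If Properties $X$ and $X'$ hold for all irreducible factors of $(W,S)$, then Properties $X$ and $X'$ hold for $(W,S)$.
   Context: Let $(W,S)$ be a Coxeter system with length function $\ell$ and Bruhat order $\le$; let $\mathcal A=\mathbb Z[v,v^{-1}]$ and $q=v^2$. The irreducible factors of $(W,S)$ are the Coxeter systems $(\langle J\rangle,J)$ where $J\subset S$ runs over the vertex sets of the connected components of the Coxeter diagram of $(W,S)$. Hecke algebra $\mathcal H_q$: the free $\mathcal A$-module with basis $\{t_w\}_{w\in W}$ and the unique $\mathcal A$-algebra structure with $t_st_w=t_{sw}$ if $sw>w$ and $t_st_w=qt_{sw}+(q-1)t_w$ if $sw<w$ ($s\in S$, $w\in W$). Its bar operator is the ring involution with $\overline{v^n}=v^{-n}$ and $\overline{t_w}=(t_{w^{-1}})^{-1}$. The Kazhdan-Lusztig polynomials $P_{y,w}\in\mathbb Z[q]$ ($y,w\in W$) are the unique family such that $c_w=v^{-\ell(w)}\sum_{y\in W}P_{y,w}t_y$ satisfies $\overline{c_w}=c_w$; $P_{y,w}=\delta_{y,w}$ if $y\not<w$; and $\deg_q P_{y,w}\le\frac12(\ell(w)-\ell(y)-1)$ if $y<w$. Define $h_{x,y;z}\in\mathcal A$ by $c_xc_y=\sum_{z\in W}h_{x,y;z}c_z$. Hecke algebra $\mathcal H_{q^2}$: the free $\mathcal A$-module with basis $\{T_w\}_{w\in W}$, with $T_sT_w=T_{sw}$ if $sw>w$ and $T_sT_w=q^2T_{sw}+(q^2-1)T_w$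 if $sw<w$; its bar operator is the ring involution with $\overline{v^n}=v^{-n}$, $\overline{T_w}=(T_{w^{-1}})^{-1}$; and $C_w=q^{-\ell(w)}\sum_{y\in W}P_{y,w}(q^2)T_y$. Twisted theory: let $*:w\mapsto w^*$ be an automorphism of $W$ of order $\le 2$ (the identity is allowed) with $S^*=S$ (called an $S$-preserving involution), and $\mathbf I_*=\{w\in W: w^*=w^{-1}\}$. For $s\in S$, $w\in\mathbf I_*$ put $s\ltimes w=sw$ if $sw=ws^*$ and $s\ltimes w=sws^*$ otherwise. Let $\mathcal M_{q^2}$ be the free $\mathcal A$-module with basis $\{a_w\}_{w\in\mathbf I_*}$ and the unique $\mathcal H_{q^2}$-module structure such that $T_sa_w=a_{s\ltimes w}$ if $s\ltimes w=sws^*>w$; $T_sa_w=(q+1)a_{s\ltimes w}+qa_w$ if $s\ltimes w=sw>w$; $T_sa_w=(q^2-q)a_{s\ltimes w}+(q^2-q-1)a_w$ if $s\ltimes w=sw<w$; $T_sa_w=q^2a_{s\ltimes w}+(q^2-1)a_w$ if $s\ltimes w=sws^*<w$. Its bar operator is the unique $\mathbb Z$-linear involution with $\overline{a_1}=a_1$ and $\overline{hm}=\overline h\,\overline m$ for $h\in\mathcal H_{q^2}$, $m\in\mathcal M_{q^2}$. The twisted Kazhdan-Lusztig polynomials $P^\sigma_{y,w}\in\mathbb Z[q]$ ($y,w\in\mathbf I_*$) are the unique family such that $A_w=v^{-\ell(w)}\sum_{y\in\mathbf I_*}P^\sigma_{y,w}a_y$ satisfies $\overline{A_w}=A_w$;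 $P^\sigma_{y,w}=\delta_{y,w}$ if $y\not<w$; and $\deg_qP^\sigma_{y,w}\le\frac12(\ell(w)-\ell(y)-1)$ if $y<w$. Put $P^\pm_{y,w}=\frac12(P_{y,w}\pm P^\sigma_{y,w})$ for $y,w\in\mathbf I_*$. For $x\in W$, $y\in\mathbf I_*$ define $\tilde h_{x,y;z}$ ($z\in W$) and $h^\sigma_{x,y;z}$ ($z\in\mathbf I_*$) in $\mathcal A$ by $c_xc_yc_{(x^* )^{-1}}=\sum_{z\in W}\tilde h_{x,y;z}c_z$ and $C_xA_y=\sum_{z\in\mathbf I_*}h^\sigma_{x,y;z}A_z$. Put $h^\pm_{x,y;z}=\frac12(\tilde h_{x,y;z}\pm h^\sigma_{x,y;z})$ for $x\in W$, $y,z\in\mathbf I_*$. A polynomial $a_0+a_1x+\dots+a_nx^n\in\mathbb Z[x]$ is unimodal if $0\le a_0\le\dots\le a_{i-1}\le a_i\ge a_{i+1}\ge\dots\ge a_n\ge0$ for some $i$. The zero (Laurent) polynomial is considered to have degree $0$. Properties of $(W,S)$: (A) $P_{y,w}$ has nonnegative coefficients for all $y,w\in W$. (B) $P_{y,w}-P_{z,w}$ has nonnegative coefficients for all $y,z,w\in W$ with $y\le z$. (C) $h_{x,y;z}$ has nonnegative coefficients for all $x,y,z\in W$. (D) For all $x,y,z\in W$, if $h_{x,y;z}$ has degree $d$ in $v$, then $v^dh_{x,y;z}$ is a unimodal polynomial in $q=v^2$. Properties of a triple $(W,S,* )$: (A$'$) $P^+_{y,w}$ and $P^-_{y,w}$ have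 nonnegative coefficients for all $y,w\in\mathbf I_*$. (B$'$) $P^+_{y,w}-P^+_{z,w}$ and $P^-_{y,w}-P^-_{z,w}$ have nonnegative coefficients for all $y,z,w\in\mathbf I_*$ with $y\le z$. (C$'$) $h^+_{x,y;z}$ and $h^-_{x,y;z}$ have nonnegative coefficients for all $x\in W$, $y,z\in\mathbf I_*$. (D$'$) For all $x\in W$, $y,z\in\mathbf I_*$, if $h^+_{x,y;z}$ and $h^-_{x,y;z}$ have degrees $d_+$ and $d_-$ in $v$, then $v^{d_+}h^+_{x,y;z}$ and $v^{d_-}h^-_{x,y;z}$ are unimodal polynomials in $q=v^2$. Convention: ''Property $X'$ holds for $(W,S)$'' means that Property $X'$ holds for $(W,S,* )$ for every $S$-preserving involution $*$ of $W$. *)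

(* Defs.v *)
From HB Require Import structures.
From Stdlib Require Import Relation_Operators.
From mathcomp Require Import all_boot all_order all_algebra.
From mathcomp Require Import finmap boolp.
From mathcomp.multinomials Require Import monalg.

Set Implicit Arguments.
Unset Strict Implicit.
Unset Printing Implicit Defensive.

Import Order.TTheory GRing.Theory Num.Theory.

Local Open Scope ring_scope.

(** * Laurent polynomials *)

(* [laurent R] is R[v, v^-1], as the group algebra R[int]: [f@_i] is the
   coefficient of v^i in [f].  The product has to be supplied here because the
   ring structure of [{malg R[K]}] only covers monoids [K] without
   invertible elements. *)
Definition laurent (R : comNzRingType) := {malg R[int]}.

HB.instance Definition _ (R : comNzRingType) :=
  GRing.Lmodule.copy (laurent R) {malg R[int]}.

Section LaurentRing.
Variable R : comNzRingType.
Implicit Types f g : laurent R.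

Definition lmul f g : laurent R :=
  \sum_(i <- msupp f) \sum_(j <- msupp g) << f@_i * g@_j *g i + j >>.

Definition vpow (n : int) : laurent R := << 1 *g n >>.

Local Lemma lmul_wide (E F : {fset int}) f g :
  (msupp f `<=` E)%fset -> (msupp g `<=` F)%fset ->
  lmul f g = \sum_(i <- E) \sum_(j <- F) << f@_i * g@_j *g i + j >>.
Proof.
move=> fE gF; rewrite /lmul (big_fset_incl _ fE) /=.
  apply: eq_bigr => i _; apply: big_fset_incl => // j _ /mcoeff_outdom ->.
  by rewrite mulr0 monalgU0.
move=> i _ /mcoeff_outdom ->; rewrite big1 // => j _.
by rewrite mul0r monalgU0.
Qed.

Local Lemma lmulC : commutative lmul.
Proof.
move=> f g; rewrite /lmul exchange_big; apply: eq_bigr => i _ /=.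
by apply: eq_bigr => j _; rewrite mulrC addrC.
Qed.

Local Lemma lmulDl : left_distributive lmul +%R.
Proof.
move=> f g h.
rewrite (lmul_wide (msuppD_le f g) (fsubset_refl _)).
rewrite (lmul_wide (fsubsetUl _ (msupp g)) (fsubset_refl (msupp h))).
rewrite (lmul_wide (fsubsetUr (msupp f) _) (fsubset_refl (msupp h))).
rewrite -big_split /=; apply: eq_bigr => i _.
rewrite -big_split /=; apply: eq_bigr => j _.
by rewrite mcoeffD mulrDl monalgUD.
Qed.

Local Lemma lmulDr : right_distributive lmul +%R.
Proof. by move=> f g h; rewrite lmulC lmulDl !(lmulC f). Qed.

Local Lemma lmul0l : left_zero 0 lmul.
Proof. by move=> f; rewrite /lmul msupp0 big_seq_fset0. Qed.

Local Lemma lmulUU a b i j :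
  lmul << a *g i >> << b *g j >> = << a * b *g i + j >>.
Proof.
by rewrite (lmul_wide msuppU_le msuppU_le) !big_seq_fset1 !mcoeffUU.
Qed.

Local Lemma lmul_suml (I : Type) (r : seq I) (F : I -> laurent R) g :
  lmul (\sum_(i <- r) F i) g = \sum_(i <- r) lmul (F i) g.
Proof. exact: (big_morph (lmul^~ g) (fun f h => lmulDl f h g) (lmul0l g)). Qed.

Local Lemma lmul_sumr (I : Type) (r : seq I) (F : I -> laurent R) g :
  lmul g (\sum_(i <- r) F i) = \sum_(i <- r) lmul g (F i).
Proof.
by rewrite lmulC lmul_suml; apply: eq_bigr => i _; rewrite [LHS]lmulC.
Qed.

Local Lemma laurentE f : f = \sum_(i <- msupp f) (<< f@_i *g i >> : laurent R).
Proof. exact: monalgE. Qed.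

Local Lemma lmulA : associative lmul.
Proof.
move=> f g h; rewrite [f]laurentE !lmul_suml; apply: eq_bigr => i _.
rewrite [g]laurentE lmul_suml !lmul_sumr lmul_suml; apply: eq_bigr => j _.
rewrite [h]laurentE !lmul_sumr; apply: eq_bigr => k _.
by rewrite !lmulUU mulrA addrA.
Qed.

Local Lemma lmul1l : left_id (vpow 0) lmul.
Proof.
move=> f; rewrite [f in LHS]laurentE lmul_sumr [RHS]laurentE.
by apply: eq_bigr => i _; rewrite lmulUU mul1r add0r.
Qed.

Local Lemma vpow0_neq0 : vpow 0 != 0 :> laurent R.
Proof.
by apply/eqP => /malgP /(_ 0); rewrite mcoeffUU mcoeff0; apply/eqP/oner_neq0.
Qed.

HB.instance Definition _ := GRing.Zmodule_isComNzRing.Build (laurent R)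
  lmulA lmulC lmul1l lmulDl vpow0_neq0.

(* The zero Laurent polynomial has degree 0. *)
Definition has_degree f (d : int) :=
  (f = 0 /\ d = 0) \/ (f@_d != 0 /\ forall i, f@_i != 0 -> i <= d).

Definition vq : laurent R := vpow 2.

(* The value at [x] of a polynomial with integer coefficients. *)
Definition at_laurent (p : {poly int}) (x : laurent R) : laurent R :=
  (map_poly intr p).[x].

End LaurentRing.

Notation Zv := (laurent int).

Definition laurent_rat (f : Zv) : laurent rat :=
  \sum_(i <- msupp f) << (f@_i)%:~R *g i >>.

Definition laurent_nonneg (R : numDomainType) (f : laurent R) :=
  forall i, 0 <= f@_i.

Definition poly_nonneg (R : numDomainType) (p : {poly R}) :=
  forall i, 0 <= p`_i.

Definition unimodal (p : {poly int}) :=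
  exists i : nat,
    [/\ forall j, 0 <= p`_j,
        forall j, (j < i)%N -> p`_j <= p`_j.+1
      & forall j, (i <= j)%N -> p`_j >= p`_j.+1].

Definition unimodal_in_q (R : comNzRingType) (f : laurent R) :=
  exists2 p : {poly int}, f = at_laurent p (vq R) & unimodal p.

(** * Coxeter systems *)

Section Coxeter.
Variables (W : groupType) (S : W -> Prop).

Inductive generated : W -> Prop :=
| generated1 : generated 1%g
| generated_incl s : S s -> generated s
| generatedM x y : generated x -> generated y -> generated (x * y)%g
| generatedV x : generated x -> generated (x^-1)%g.

(* The last clause is the presentation of W by the generators s in S and the
   relations (s t)^m(s,t) = 1, m(s,t) being the order of s t: since the n with
   (s t)^n = 1 are the multiples of this order, no relation is imposed when the
   order is infinite, and s = t gives f(s)^2 = 1. *)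
Record coxeter_system : Prop := CoxeterSystem {
  cox_generated : forall w, generated w;
  cox_neq1 : forall s, S s -> s <> 1%g;
  cox_invol : forall s, S s -> (s * s = 1)%g;
  cox_universal : forall (G : groupType) (f : W -> G),
    (forall s t n, S s -> S t ->
       ((s * t) ^+ n = 1)%g -> ((f s * f t) ^+ n = 1)%g) ->
    exists2 g : W -> G, {morph g : x y / (x * y)%g}
                      & forall s, S s -> g s = f s }.

Definition word_for (w : W) (l : seq W) :=
  (forall s, s \in l -> S s) /\ (w = \prod_(s <- l) s)%g.

Definition word_length (w : W) (n : nat) : bool :=
  `[< exists2 l, word_for w l & size l = n >].

(* The value 0 on elements that are not products of elements of S is junk:
   there are none in a Coxeter system. *)
Definition ell (w : W) : nat :=
  if pselect (exists n, word_length w n) is left e then ex_minn e else 0%N.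

Definition reflection (t : W) :=
  exists w s, S s /\ (t = w * s * w^-1)%g.

Definition bruhat_step (u w : W) :=
  exists t, [/\ reflection t, (w = t * u)%g & (ell u < ell w)%N].

Definition bruhat_le : W -> W -> Prop := clos_refl_trans W bruhat_step.

Definition bruhat_lt (u w : W) := bruhat_le u w /\ u <> w.

(* An edge of the Coxeter diagram: the order of s t is at least 3 or infinite. *)
Definition diagram_edge (s t : W) :=
  [/\ S s, S t & forall n, (0 < n < 3)%N -> ((s * t) ^+ n <> 1)%g].

Definition diagram_component (J : W -> Prop) :=
  exists2 s, S s & forall t, J t <-> clos_refl_trans W diagram_edge s t.

Definition preserving_involution (star : W -> W) :=
  [/\ {morph star : x y / (x * y)%g}, involutive star
    & forall s, S s <-> S (star s)].

End Coxeter.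

(** The subgroup generated by [J], as a group in its own right. *)

Section GeneratedSubgroup.
Variables (W : groupType) (J : W -> Prop).

Definition gen_pred : pred W := fun w => `[< generated J w >].

Local Lemma gen_pred_closed : group_closed gen_pred.
Proof.
split; first exact/asboolP/generated1.
move=> x y /asboolP Jx /asboolP Jy; apply/asboolP.
exact: generatedM Jx (generatedV Jy).
Qed.

Definition gen_group := {w : W | gen_pred w}.

HB.instance Definition _ := [isSub of gen_group for @sval W gen_pred].
HB.instance Definition _ := [Choice of gen_group by <:].
HB.instance Definition _ :=
  SubChoice_isSubGroup.Build W gen_pred gen_group gen_pred_closed.

Definition gen_group_gens : gen_group -> Prop := fun u => J (val u).

End GeneratedSubgroup.

Arguments gen_group_gens {W} J.

(** * Kazhdan-Lusztig theory *)

(* The free module with basis [K] is [{malg Zv[K]}], with [x@_k] the coefficient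
   of [x] at [basis k]. *)
Definition basis (K : choiceType) (k : K) : {malg Zv[K]} := << 1 *g k >>.

Definition lincomb (K : choiceType) (V : lmodType Zv) (c : K -> V)
    (h : {malg Zv[K]}) : V :=
  \sum_(k <- msupp h) h@_k *: c k.

Section KazhdanLusztig.
Variables (W : groupType) (S : W -> Prop).

Local Notation H := {malg Zv[W]}.
Local Notation t := (@basis W).
Local Notation v n := (vpow int n).
Local Notation q := (vq int).
Local Notation ell := (ell S).
Local Notation "x <b y" := (bruhat_lt S x y) (at level 70).

(* Algebra structures on the free module with basis W, with unit the basis
   element 1 and with Hecke parameter [u]: [u = q] gives H_q and [u = q ^+ 2]
   gives H_{q^2}.  That t_1 is the unit follows from the other axioms unless S
   is empty. *)
Record is_hecke_algebra (u : Zv) (mul : H -> H -> H) : Prop := IsHeckeAlgebra {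
  hecke_mulA : associative mul;
  hecke_mul1l : left_id (t 1%g) mul;
  hecke_mul1r : right_id (t 1%g) mul;
  hecke_mulDl : left_distributive mul +%R;
  hecke_mulDr : right_distributive mul +%R;
  hecke_mulZl : forall a x y, mul (a *: x) y = a *: mul x y;
  hecke_mulZr : forall a x y, mul x (a *: y) = a *: mul x y;
  hecke_up : forall s w, S s -> w <b (s * w)%g ->
    mul (t s) (t w) = t (s * w)%g;
  hecke_down : forall s w, S s -> (s * w)%g <b w ->
    mul (t s) (t w) = u *: t (s * w)%g + (u - 1) *: t w }.

Record is_hecke_bar (mul : H -> H -> H) (bar : H -> H) : Prop := IsHeckeBar {
  hecke_barD : {morph bar : x y / x + y};
  hecke_barM : {morph bar : x y / mul x y};
  hecke_barK : involutive bar;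
  hecke_bar_v : forall n : int, bar (v n *: t 1%g) = v (- n) *: t 1%g;
  hecke_bar_t : forall w, mul (bar (t w)) (t w^-1%g) = t 1%g /\
                          mul (t w^-1%g) (bar (t w)) = t 1%g }.

(* A polynomial of degree d satisfies d <= (ell w - ell y - 1) / 2 iff
   2 d + ell y < ell w; [(size p).-1] is the degree, with value 0 at p = 0. *)
Definition kl_degree_bound (p : {poly int}) (y w : W) :=
  ((size p).-1.*2 + ell y < ell w)%N.

(* The Hecke algebra H_q with its bar operator, its Kazhdan-Lusztig basis and
   polynomials and the structure constants of this basis.  By the theorems of
   Iwahori and Kazhdan-Lusztig all of these exist and are uniquely determined by
   a Coxeter system (W, S), so quantifying over [kl_theory] below is the same as
   speaking of "the" P_{y,w} and h_{x,y;z}.  Since [kl_c w] is an element of the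
   free module, [kl_cE] states that it is the sum of the given terms. *)
Record kl_theory := KLTheory {
  kl_mul : H -> H -> H;
  kl_mulP : is_hecke_algebra q kl_mul;
  kl_bar : H -> H;
  kl_barP : is_hecke_bar kl_mul kl_bar;
  kl_P : W -> W -> {poly int};
  kl_c : W -> H;
  kl_cE : forall y w, (kl_c w)@_y = v (- (ell w)%:Z) * at_laurent (kl_P y w) q;
  kl_bar_c : forall w, kl_bar (kl_c w) = kl_c w;
  kl_P_nlt : forall y w, ~ (y <b w) -> kl_P y w = (y == w)%:R;
  kl_P_deg : forall y w, y <b w -> kl_degree_bound (kl_P y w) y w;
  kl_h : W -> W -> {malg Zv[W]};
  kl_hE : forall x y, kl_mul (kl_c x) (kl_c y) = lincomb kl_c (kl_h x y) }.

Section Twisted.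
Variables (star : W -> W) (K : kl_theory).

Definition twisted_invol := {w : W | star w == w^-1%g}.

HB.instance Definition _ :=
  [isSub of twisted_invol for @sval W (fun w => star w == w^-1%g)].
HB.instance Definition _ := [Choice of twisted_invol by <:].

Local Notation I := twisted_invol.
Local Notation M := {malg Zv[I]}.
Local Notation T := (@basis W).
Local Notation a := (@basis I).

Definition ltimes (s w : W) : W :=
  if (s * w == w * star s)%g then (s * w)%g else (s * w * star s)%g.

Record is_twisted_module (mul : H -> H -> H) (act : H -> M -> M) : Prop :=
    IsTwistedModule {
  tw_actM : forall x y m, act (mul x y) m = act x (act y m);
  tw_act1 : forall m, act (T 1%g) m = m;
  tw_actDl : forall x y m, act (x + y) m = act x m + act y m;
  tw_actDr : forall x m n, act x (m + n) = act x m + act x n;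
  tw_actZl : forall b x m, act (b *: x) m = b *: act x m;
  tw_actZr : forall b x m, act x (b *: m) = b *: act x m;
  tw_act_up : forall s (w w' : I), S s -> val w' = ltimes s (val w) ->
    val w' = (s * val w * star s)%g -> val w <b val w' ->
    act (T s) (a w) = a w';
  tw_act_up_comm : forall s (w w' : I), S s -> val w' = ltimes s (val w) ->
    val w' = (s * val w)%g -> val w <b val w' ->
    act (T s) (a w) = (q + 1) *: a w' + q *: a w;
  tw_act_down_comm : forall s (w w' : I), S s -> val w' = ltimes s (val w) ->
    val w' = (s * val w)%g -> val w' <b val w ->
    act (T s) (a w) = (q ^+ 2 - q) *: a w' + (q ^+ 2 - q - 1) *: a w;
  tw_act_down : forall s (w w' : I), S s -> val w' = ltimes s (val w) ->
    val w' = (s * val w * star s)%g -> val w' <b val w ->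
    act (T s) (a w) = q ^+ 2 *: a w' + (q ^+ 2 - 1) *: a w }.

Record is_twisted_bar (act : H -> M -> M) (hbar : H -> H) (bar : M -> M)
    : Prop := IsTwistedBar {
  tw_barD : {morph bar : m n / m + n};
  tw_barK : involutive bar;
  tw_bar1 : forall e : I, val e = 1%g -> bar (a e) = a e;
  tw_barM : forall x m, bar (act x m) = act (hbar x) (bar m) }.

(* H_{q^2}, the elements C_w, the module M_{q^2} with its bar operator, the
   twisted Kazhdan-Lusztig polynomials and the structure constants; by the
   theorems of Lusztig-Vogan and Lusztig all of these exist and are uniquely
   determined by (W, S, star). *)
Record twisted_theory := TwistedTheory {
  tw_mul : H -> H -> H;
  tw_mulP : is_hecke_algebra (q ^+ 2) tw_mul;
  tw_hbar : H -> H;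
  tw_hbarP : is_hecke_bar tw_mul tw_hbar;
  tw_C : W -> H;
  tw_CE : forall y w, (tw_C w)@_y =
    v (- (ell w).*2%:Z) * at_laurent (kl_P K y w) (q ^+ 2);
  tw_act : H -> M -> M;
  tw_actP : is_twisted_module tw_mul tw_act;
  tw_bar : M -> M;
  tw_barP : is_twisted_bar tw_act tw_hbar tw_bar;
  tw_P : I -> I -> {poly int};
  tw_A : I -> M;
  tw_AE : forall y w, (tw_A w)@_y =
    v (- (ell (val w))%:Z) * at_laurent (tw_P y w) q;
  tw_bar_A : forall w, tw_bar (tw_A w) = tw_A w;
  tw_P_nlt : forall y w, ~ (val y <b val w) -> tw_P y w = (y == w)%:R;
  tw_P_deg : forall y w, val y <b val w ->
    kl_degree_bound (tw_P y w) (val y) (val w);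
  tw_htilde : W -> I -> {malg Zv[W]};
  tw_htildeE : forall x y,
    kl_mul K (kl_mul K (kl_c K x) (kl_c K (val y))) (kl_c K (star x)^-1%g)
    = lincomb (kl_c K) (tw_htilde x y);
  tw_hsigma : W -> I -> {malg Zv[I]};
  tw_hsigmaE : forall x y,
    tw_act (tw_C x) (tw_A y) = lincomb tw_A (tw_hsigma x y) }.

Variable Tw : twisted_theory.

(* P^+ and P^- are [P_pm 1] and [P_pm (-1)], and likewise for h^+ and h^-.
   Because of the factor 1/2 they are given rational coefficients. *)
Definition P_pm (eps : int) (y w : I) : {poly rat} :=
  2^-1 *: map_poly intr (kl_P K (val y) (val w) + eps *: tw_P Tw y w).

Definition h_pm (eps : int) (x : W) (y z : I) : laurent rat :=
  (2^-1 : rat) *: laurent_rat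
    ((tw_htilde Tw x y)@_(val z) + (tw_hsigma Tw x y)@_z *~ eps).

End Twisted.

(** * The properties A, B, C, D and A', B', C', D' *)

Definition property_A :=
  forall (K : kl_theory) y w, poly_nonneg (kl_P K y w).

Definition property_B :=
  forall (K : kl_theory) y z w, bruhat_le S y z ->
    poly_nonneg (kl_P K y w - kl_P K z w).

Definition property_C :=
  forall (K : kl_theory) x y z, laurent_nonneg (kl_h K x y)@_z.

Definition property_D :=
  forall (K : kl_theory) x y z d, has_degree (kl_h K x y)@_z d ->
    unimodal_in_q (vpow _ d * (kl_h K x y)@_z).

Definition property_A' (star : W -> W) :=
  forall (K : kl_theory) (Tw : twisted_theory star K) y w,
    poly_nonneg (P_pm Tw 1 y w) /\ poly_nonneg (P_pm Tw (-1) y w).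

Definition property_B' (star : W -> W) :=
  forall (K : kl_theory) (Tw : twisted_theory star K) y z w,
    bruhat_le S (val y) (val z) ->
    poly_nonneg (P_pm Tw 1 y w - P_pm Tw 1 z w) /\
    poly_nonneg (P_pm Tw (-1) y w - P_pm Tw (-1) z w).

Definition property_C' (star : W -> W) :=
  forall (K : kl_theory) (Tw : twisted_theory star K) x y z,
    laurent_nonneg (h_pm Tw 1 x y z) /\ laurent_nonneg (h_pm Tw (-1) x y z).

Definition property_D' (star : W -> W) :=
  forall (K : kl_theory) (Tw : twisted_theory star K) x y z dp dm,
    has_degree (h_pm Tw 1 x y z) dp -> has_degree (h_pm Tw (-1) x y z) dm ->
    unimodal_in_q (vpow _ dp * h_pm Tw 1 x y z) /\
    unimodal_in_q (vpow _ dm * h_pm Tw (-1) x y z).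

Inductive property_name := PropA | PropB | PropC | PropD.

Definition property (X : property_name) : Prop :=
  match X with
  | PropA => property_A
  | PropB => property_B
  | PropC => property_C
  | PropD => property_D
  end.

Definition property'_star (X : property_name) (star : W -> W) : Prop :=
  match X with
  | PropA => property_A' star
  | PropB => property_B' star
  | PropC => property_C' star
  | PropD => property_D' star
  end.

Definition property' (X : property_name) : Prop :=
  forall star : W -> W, preserving_involution S star -> property'_star X star.

End KazhdanLusztig.

(* Main.v *)
From HB Require Import structures.
Require Import Defs.
From Stdlib Require Import Relation_Operators.
From mathcomp Require Import all_boot all_order all_algebra.
From mathcomp Require Import finmap boolp.
From mathcomp.multinomials Require Import monalg.
From mathcomp Require Import perm zify ring.

(** The proof reduces each property to a statement about the part of the theory
    that belongs to one factor, that is, to a set J of generators commuting with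
    all the others, and then glues.

    If W is the product of W_J and W_J', the elements c_w are the products
    c_u c_u' of the components u, u' of w, because such a product has the
    properties that characterize c_w ([kl_c_mul]).  Hence P_{y,w} and h_{x,y;z}
    are products over the two factors ([LP_split], [kl_h_split]).  If moreover
    J is stable under the involution, the same holds for A_w, P^sigma_{y,w},
    h-tilde and h^sigma ([tw_A_merge], [LPs_split], [htilde_split],
    [hsigma_split]).  Positivity and unimodality pass to such products.  For
    f^+ = (f + g)/2 and f^- = (f - g)/2 the rule is f1^+ f2^+ + f1^- f2^- for
    the plus part and f1^+ f2^- + f1^- f2^+ for the minus part of
    (f1 f2, g1 g2) ([pair_nonnegM], [pair_symuniM]).  The relevant unimodal
    Laurent polynomials are moreover symmetric under v -> v^-1 and involve
    exponents of one parity only, so that they are sums of characters of SL_2,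
    and the product of two of them is given by the Clebsch-Gordan rule
    ([symuniM]).

    The involution permutes the irreducible factors.  On a factor that it
    preserves, the hypothesis applies to the restriction of the theory
    ([kl_restrict], [twisted_restrict]).  The remaining case is a factor W_J
    exchanged with another one, W_J*.  The twisted involutions of the product
    are then the x (x^* )^-1 with x in W_J.  The map T_x |-> a_{x (x^* )^-1} from
    the algebra H_{q^2} of W_J turns left multiplication into the action of W_J
    ([theta_act1]) and, along w |-> (w^* )^-1, right multiplication into the
    action of W_J* ([theta_act2]).  It commutes with the bar operators and sends
    C_w to A_{w (w^* )^-1} ([theta_C]).  Therefore the twisted quantities of the
    product are obtained from quantities f of W_J by v -> v^2, while the
    corresponding ordinary ones are the squares f^2 ([LPs_swap], [LP_swap],
    [hsigma_swap], [htilde_swap]).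
    Properties A, B, C, D of W_J make f nonnegative or unimodal, and then
    (f^2 + f(v^2))/2 and (f^2 - f(v^2))/2 inherit this: for nonnegative f
    because the coefficients are integers ([pair_nonneg_sq]), for sums of
    characters of SL_2 because these two are built from symmetric and exterior
    squares ([pair_symuni_sq]).

    Finally, any finite set of elements of W lies in a product of finitely many
    irreducible factors ([factor_induction]). *)

Set Implicit Arguments.
Unset Strict Implicit.
Unset Printing Implicit Defensive.

Import Order.TTheory GRing.Theory Num.Theory.

Local Open Scope ring_scope.

(** * Laurent polynomials *)

Arguments lmul : simpl never.
Arguments vpow : simpl never.
Arguments vq : simpl never.
Arguments at_laurent : simpl never.

Section LaurentMonomials.
Variable R : comNzRingType.
Implicit Types f g : laurent R.

Definition lmon (a : R) (i : int) : laurent R := << a *g i >>.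

Lemma coef_lmon a i j : (lmon a i)@_j = a *+ (i == j).
Proof. exact: mcoeffU. Qed.

Lemma mulUU (a b : R) (i j : int) : lmon a i * lmon b j = lmon (a * b) (i + j).
Proof. exact: Defs.lmulUU. Qed.

Lemma vpowD i j : vpow R (i + j) = vpow R i * vpow R j.
Proof. by rewrite /vpow mulUU mulr1. Qed.

Lemma vpow0 : vpow R 0 = 1.
Proof. by []. Qed.

Lemma vpowNK i : vpow R (- i) * vpow R i = 1.
Proof. by rewrite -vpowD addNr. Qed.

Lemma vpowKN i : vpow R i * vpow R (- i) = 1.
Proof. by rewrite -vpowD subrr. Qed.

Lemma coef_vpow i j : (vpow R i)@_j = (i == j)%:R.
Proof. exact: coef_lmon. Qed.

Lemma coef_1 j : (1 : laurent R)@_j = (0 == j)%:R.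
Proof. exact: coef_vpow. Qed.

Lemma laurent_sumE f : f = \sum_(i <- msupp f) lmon f@_i i.
Proof. exact: monalgE. Qed.

Lemma laurent_ind (P : laurent R -> Prop) : P 0 ->
  (forall f g, P f -> P g -> P (f + g)) -> (forall a i, P (lmon a i)) ->
  forall f, P f.
Proof.
by move=> P0 PD PU f; rewrite [f]laurent_sumE; elim/big_ind: _.
Qed.

Lemma coefMvpow i f j : (vpow R i * f)@_j = f@_(j - i).
Proof.
elim/laurent_ind: f => [|f g IHf IHg|a k].
- by rewrite mulr0 !mcoeff0.
- by rewrite mulrDr !mcoeffD IHf IHg.
rewrite mulUU mul1r !coef_lmon; congr (_ *+ _).
by apply/eqP/eqP; lia.
Qed.

End LaurentMonomials.

Section Substitution.
Variable h : int -> Zv.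
Hypotheses (h0 : h 0 = 1) (hD : forall i j, h (i + j) = h i * h j).

(** The substitution of a unit for v: [h] lists the powers of that unit. *)
Definition lsub (f : Zv) : Zv := mmap intr h f.

Lemma lsubU a i : lsub (lmon a i) = a%:~R * h i.
Proof. exact: mmapU. Qed.

Lemma lsub_is_zmod_morphism : zmod_morphism lsub.
Proof. exact: mmap_is_additive. Qed.

Lemma lsub_is_monoid_morphism : monoid_morphism lsub.
Proof.
split=> [|f g]; first by rewrite /lsub mmapU h0 mulr1.
elim/laurent_ind: f => [|f1 f2 IH1 IH2|a i].
- by rewrite mul0r /lsub raddf0 mul0r.
- by rewrite mulrDl /lsub !raddfD /= mulrDl -IH1 -IH2.
elim/laurent_ind: g => [|g1 g2 IH1 IH2|b j].
- by rewrite mulr0 /lsub raddf0 mulr0.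
- by rewrite mulrDr /lsub !raddfD /= mulrDr -IH1 -IH2.
by rewrite mulUU !lsubU hD rmorphM /= mulrACA.
Qed.

End Substitution.

Lemma intr_laurent (a : int) : a%:~R = lmon a 0.
Proof.
have -> : a%:~R = (vpow int 0) *~ a by [].
by rewrite -(raddfMz (mkmalgU 0)) /= intz.
Qed.

Lemma intr_lmon (a b i : int) : a%:~R * lmon b i = lmon (a * b) i.
Proof. by rewrite intr_laurent mulUU add0r. Qed.

Lemma intr_vpow (a i : int) : a%:~R * vpow int i = lmon a i.
Proof. by rewrite intr_lmon mulr1. Qed.

Arguments lsub : simpl never.

(** The three substitutions that matter are v -> v^-1 (the bar involution),
    v -> v^2 (which turns H_q into H_{q^2}) and v -> -v (which detects the
    parity of exponents). *)
Definition lbar : Zv -> Zv := lsub (fun i => vpow int (- i)).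
Definition lsq : Zv -> Zv := lsub (fun i => vpow int (2 * i)).
Definition lsgn : Zv -> Zv := lsub (fun i => lmon ((-1) ^ i) i).

HB.instance Definition _ := GRing.isZmodMorphism.Build Zv Zv lbar
  (lsub_is_zmod_morphism _).
HB.instance Definition _ := GRing.isZmodMorphism.Build Zv Zv lsq
  (lsub_is_zmod_morphism _).
HB.instance Definition _ := GRing.isZmodMorphism.Build Zv Zv lsgn
  (lsub_is_zmod_morphism _).

Fact lbar_monoid : monoid_morphism lbar.
Proof.
by apply: lsub_is_monoid_morphism => // i j; rewrite opprD vpowD.
Qed.
Fact lsq_monoid : monoid_morphism lsq.
Proof.
by apply: lsub_is_monoid_morphism => // i j; rewrite mulrDr vpowD.
Qed.
Fact lsgn_monoid : monoid_morphism lsgn.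
Proof.
apply: lsub_is_monoid_morphism => // i j.
by rewrite mulUU exprzDr ?unitrN1.
Qed.

HB.instance Definition _ := GRing.isMonoidMorphism.Build Zv Zv lbar lbar_monoid.
HB.instance Definition _ := GRing.isMonoidMorphism.Build Zv Zv lsq lsq_monoid.
HB.instance Definition _ := GRing.isMonoidMorphism.Build Zv Zv lsgn lsgn_monoid.

Lemma lbarD : {morph lbar : f g / f + g}. Proof. exact: (rmorphD lbar). Qed.
Lemma lbarN : {morph lbar : f / - f}. Proof. exact: (rmorphN lbar). Qed.
Lemma lbarM : {morph lbar : f g / f * g}. Proof. exact: (rmorphM lbar). Qed.
Lemma lbar0 : lbar 0 = 0. Proof. exact: (rmorph0 lbar). Qed.
Lemma lbar1 : lbar 1 = 1. Proof. exact: (rmorph1 lbar). Qed.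
Lemma lsqD : {morph lsq : f g / f + g}. Proof. exact: (rmorphD lsq). Qed.
Lemma lsqN : {morph lsq : f / - f}. Proof. exact: (rmorphN lsq). Qed.
Lemma lsqM : {morph lsq : f g / f * g}. Proof. exact: (rmorphM lsq). Qed.
Lemma lsq0 : lsq 0 = 0. Proof. exact: (rmorph0 lsq). Qed.
Lemma lsq1 : lsq 1 = 1. Proof. exact: (rmorph1 lsq). Qed.
Lemma lsq_int (c : int) : lsq c%:~R = c%:~R.
Proof. exact: (rmorph_int lsq). Qed.

Lemma lsgnD : {morph lsgn : f g / f + g}. Proof. exact: (rmorphD lsgn). Qed.
Lemma lsgnN : {morph lsgn : f / - f}. Proof. exact: (rmorphN lsgn). Qed.
Lemma lsgnM : {morph lsgn : f g / f * g}. Proof. exact: (rmorphM lsgn). Qed.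
Lemma lsgn0 : lsgn 0 = 0. Proof. exact: (rmorph0 lsgn). Qed.
Lemma lsgn1 : lsgn 1 = 1. Proof. exact: (rmorph1 lsgn). Qed.
Lemma lsgn_int (c : int) : lsgn c%:~R = c%:~R.
Proof. exact: (rmorph_int lsgn). Qed.

Lemma coef_lbar f i : (lbar f)@_i = f@_(- i).
Proof.
elim/laurent_ind: f => [|f g IHf IHg|a k].
- by rewrite lbar0 !mcoeff0.
- by rewrite lbarD !mcoeffD IHf IHg.
rewrite /lbar lsubU intr_vpow !coef_lmon; congr (_ *+ _).
by apply/eqP/eqP; lia.
Qed.

Lemma coef_lsq f i : (lsq f)@_(2 * i) = f@_i.
Proof.
elim/laurent_ind: f => [|f g IHf IHg|a k].
- by rewrite lsq0 !mcoeff0.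
- by rewrite lsqD !mcoeffD IHf IHg.
rewrite /lsq lsubU intr_vpow !coef_lmon; congr (_ *+ _).
by apply/eqP/eqP; lia.
Qed.

Lemma signz i : (-1) ^ i = (-1) ^+ odd `|i| :> int.
Proof.
rewrite signr_odd; case: (intP i) => [|n|n] //.
Qed.

Lemma coef_lsgn f i : (lsgn f)@_i = (-1) ^ i * f@_i.
Proof.
elim/laurent_ind: f => [|f g IHf IHg|a k].
- by rewrite lsgn0 !mcoeff0 mulr0.
- by rewrite lsgnD !mcoeffD IHf IHg mulrDr.
rewrite /lsgn lsubU intr_lmon !coef_lmon mulrC.
by case: eqP => [->|] //; rewrite !mulr0.
Qed.

Section AtLaurent.
Variables (R : comNzRingType) (x : laurent R).

Lemma at_laurentD p1 p2 :
  at_laurent (p1 + p2) x = at_laurent p1 x + at_laurent p2 x.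
Proof. by rewrite /at_laurent raddfD hornerD. Qed.

Lemma at_laurentB p1 p2 :
  at_laurent (p1 - p2) x = at_laurent p1 x - at_laurent p2 x.
Proof. by rewrite /at_laurent raddfB hornerD hornerN. Qed.

Lemma at_laurentM p1 p2 :
  at_laurent (p1 * p2) x = at_laurent p1 x * at_laurent p2 x.
Proof. by rewrite /at_laurent rmorphM hornerM. Qed.

Lemma at_laurentC (c : int) : at_laurent c%:P x = c%:~R.
Proof. by rewrite /at_laurent map_polyC hornerC. Qed.

Lemma at_laurent0 : at_laurent 0 x = 0.
Proof. by rewrite -[0]polyC0 at_laurentC. Qed.

Lemma at_laurent1 : at_laurent 1 x = 1.
Proof. by rewrite -[1]polyC1 at_laurentC. Qed.

Lemma at_laurentX : at_laurent 'X x = x.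
Proof. by rewrite /at_laurent map_polyX hornerX. Qed.

End AtLaurent.

Lemma coef_intr (R : comNzRingType) (c i : int) :
  (c%:~R : laurent R)@_i = c%:~R *+ (i == 0).
Proof.
have -> : c%:~R = (vpow R 0) *~ c by [].
rewrite (raddfMz (mcoeff i)) /= coef_1 eq_sym.
by case: eqP => _ //; rewrite mul0rz.
Qed.

Lemma at_laurentMXaddC (R : comNzRingType) (p : {poly int}) (c i : int) :
  (at_laurent (p * 'X + c%:P) (vq R))@_i
  = (at_laurent p (vq R))@_(i - 2) + c%:~R *+ (i == 0).
Proof.
rewrite at_laurentD at_laurentM at_laurentX at_laurentC mcoeffD coef_intr.
by rewrite mulrC [vq R]/(vpow R 2) coefMvpow.
Qed.

Lemma coef_at_laurent0 (R : comNzRingType) (p : {poly int}) (i : int) :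
  (forall j : nat, i <> 2 * j%:Z) -> (at_laurent p (vq R))@_i = 0.
Proof.
elim/poly_ind: p i => [|p c IH] i ni; first by rewrite at_laurent0 mcoeff0.
rewrite at_laurentMXaddC IH; last by move=> j e; apply: (ni j.+1); lia.
by case: eqP => [e|]; [case: (ni 0%N); lia | rewrite addr0].
Qed.

Lemma coef_at_laurent (R : comNzRingType) (p : {poly int}) (i : nat) :
  (at_laurent p (vq R))@_(2 * i%:Z) = (p`_i)%:~R.
Proof.
elim/poly_ind: p i => [|p c IH] i; first by rewrite at_laurent0 coef0 mcoeff0.
rewrite at_laurentMXaddC coefD coefMX coefC.
case: i => [|i]; first by rewrite coef_at_laurent0 /= ?add0r //; lia.
have -> : 2 * i.+1%:Z - 2 = 2 * i%:Z by lia.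
have -> : (2 * i.+1%:Z == 0) = false by lia.
by rewrite /= IH !addr0.
Qed.

Lemma lsq_at_laurent p :
  lsq (at_laurent p (vq int)) = at_laurent p (vq int ^+ 2).
Proof.
elim/poly_ind: p => [|p c IH]; first by rewrite !at_laurent0 lsq0.
rewrite !at_laurentD !at_laurentM !at_laurentX !at_laurentC.
rewrite lsqD lsqM IH lsq_int; suff -> : lsq (vq int) = vq int ^+ 2 by [].
by rewrite [LHS]lsubU mul1r expr2 -vpowD.
Qed.

Lemma lsq_vpow i : lsq (vpow int i) = vpow int (2 * i).
Proof. by rewrite /lsq lsubU mul1r. Qed.

Lemma lbar_vpow i : lbar (vpow int i) = vpow int (- i).
Proof. by rewrite /lbar lsubU mul1r. Qed.

Lemma lsgn_at_laurent p :
  lsgn (at_laurent p (vq int)) = at_laurent p (vq int).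
Proof.
apply/malgP => i; rewrite coef_lsgn.
have [[j ->]|nj] := EM (exists j : nat, i = 2 * j%:Z).
  by rewrite signz (_ : odd _ = false) ?mul1r //; lia.
by rewrite coef_at_laurent0 ?mulr0 // => j e; apply: nj; exists j.
Qed.

Lemma laurent_nonneg_at p :
  laurent_nonneg (at_laurent p (vq int)) <-> poly_nonneg p.
Proof.
split=> [nn i|nn i].
  by rewrite -[p`_i]intz -coef_at_laurent.
have [[j ->]|nj] := EM (exists j : nat, i = 2 * j%:Z).
  by rewrite coef_at_laurent intz.
by rewrite coef_at_laurent0 // => j e; apply: nj; exists j.
Qed.

(** * Positivity *)

Lemma nonnegD (f g : Zv) :
  laurent_nonneg f -> laurent_nonneg g -> laurent_nonneg (f + g).
Proof. by move=> nf ng i; rewrite mcoeffD addr_ge0. Qed.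

Lemma nonneg_ind (P : Zv -> Prop) : P 0 ->
  (forall a i f, 0 <= a -> laurent_nonneg f -> P f -> P (lmon a i + f)) ->
  forall f, laurent_nonneg f -> P f.
Proof.
move=> P0 PD f nf; rewrite [f]laurent_sumE.
suff [] : P (\sum_(i <- msupp f) lmon f@_i i) /\
  laurent_nonneg (\sum_(i <- msupp f) lmon f@_i i) by [].
elim: (enum_fset _) => [|i r [IH1 IH2]].
  by rewrite big_nil; split=> // i; rewrite mcoeff0.
rewrite big_cons; split; first exact: PD.
by apply: nonnegD => // j; rewrite coef_lmon mulrn_wge0.
Qed.

Lemma coefMintr (a i : int) (f : Zv) : (a%:~R * f)@_i = a * f@_i.
Proof. by rewrite mulrzl (raddfMz (mcoeff i)) /= mulrzz mulrC. Qed.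

Lemma nonneg_lmonM (a i : int) (f : Zv) :
  0 <= a -> laurent_nonneg f -> laurent_nonneg (lmon a i * f).
Proof.
move=> a0 nf j; rewrite -intr_vpow -mulrA coefMintr coefMvpow.
by rewrite mulr_ge0.
Qed.

Lemma nonnegM (f g : Zv) :
  laurent_nonneg f -> laurent_nonneg g -> laurent_nonneg (f * g).
Proof.
move=> nf ng; elim/nonneg_ind: nf => [i|a i {}f a0 _ IH].
  by rewrite mul0r mcoeff0.
by rewrite mulrDl; apply: nonnegD; [exact: nonneg_lmonM | exact: IH].
Qed.

(** Positivity of P^+ and P^- (or of h^+ and h^-), cleared of the factor 1/2. *)
Definition pair_nonneg (f g : Zv) :=
  laurent_nonneg (f + g) /\ laurent_nonneg (f - g).

Lemma pair_nonnegD f1 g1 f2 g2 : pair_nonneg f1 g1 -> pair_nonneg f2 g2 ->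
  pair_nonneg (f1 + f2) (g1 + g2).
Proof.
move=> [p1 m1] [p2 m2]; split; first by rewrite addrACA; apply: nonnegD.
by rewrite opprD addrACA; apply: nonnegD.
Qed.

(** The signed product rule: the plus part of a product is
    f1^+ f2^+ + f1^- f2^-, the minus part is f1^+ f2^- + f1^- f2^+. *)
Lemma pair_nonnegM f1 g1 f2 g2 : pair_nonneg f1 g1 -> pair_nonneg f2 g2 ->
  pair_nonneg (f1 * f2) (g1 * g2).
Proof.
move=> [p1 m1] [p2 m2].
have half f : laurent_nonneg (f + f) -> laurent_nonneg f.
  by move=> n2 i; have := n2 i; rewrite mcoeffD -mulr2n pmulrn_lge0.
split; apply: half.
  have -> : f1 * f2 + g1 * g2 + (f1 * f2 + g1 * g2)
    = (f1 + g1) * (f2 + g2) + (f1 - g1) * (f2 - g2) by ring.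
  by apply: nonnegD; apply: nonnegM.
have -> : f1 * f2 - g1 * g2 + (f1 * f2 - g1 * g2)
  = (f1 + g1) * (f2 - g2) + (f1 - g1) * (f2 + g2) by ring.
by apply: nonnegD; apply: nonnegM.
Qed.

Lemma pair_nonneg0 f : laurent_nonneg f -> pair_nonneg f 0.
Proof. by move=> nf; split; rewrite ?subr0 ?addr0. Qed.

Lemma pair_nonneg1 : pair_nonneg 1 1.
Proof.
split=> i; first by rewrite mcoeffD coef_1 addr_ge0.
by rewrite subrr mcoeff0.
Qed.

(** Additively, f^2 +- f(v^2) changes by a cross term and by the value at a
    monomial a v^i, which is (a^2 +- a) v^2i; this is where integrality of the
    coefficients enters. *)
Lemma pair_nonneg_sq f : laurent_nonneg f -> pair_nonneg (f ^+ 2) (lsq f).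
Proof.
move=> nf; elim/nonneg_ind: nf => [|a i {}f a0 nf IH].
  by rewrite lsq0 expr0n; apply: pair_nonneg0 => i; rewrite mcoeff0.
have -> : (lmon a i + f) ^+ 2
  = lmon a i * lmon a i + (lmon a i * f + lmon a i * f) + f ^+ 2 by ring.
rewrite lsqD -[lsq (lmon a i)]addr0.
apply: pair_nonnegD => //; apply: pair_nonnegD; last first.
  by apply: pair_nonneg0; apply: nonnegD; apply: nonneg_lmonM.
have -> : lsq (lmon a i) = lmon a (2 * i) by rewrite /lsq lsubU intr_vpow.
rewrite mulUU (_ : i + i = 2 * i); last by lia.
by split=> j; rewrite ?mcoeffB ?mcoeffD !coef_lmon -?mulrnBl -?mulrnDl;
  apply: mulrn_wge0; nia.
Qed.

(** * Symmetric unimodal Laurent polynomials *)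

(** The quantum integer [n + 1], which is the character of the irreducible
    representation of SL_2 of dimension n + 1. *)
Definition qint (n : nat) : Zv := \sum_(j < n.+1) vpow int (n%:Z - 2 * j%:Z).

Lemma qint0 : qint 0 = 1.
Proof. by rewrite /qint big_ord1. Qed.

Lemma qintSl n :
  qint n.+1 = vpow int n.+1 + vpow int (-1) * qint n.
Proof.
rewrite /qint big_ord_recl mulr_sumr; congr (_ + _).
  by rewrite mulr0 subr0.
by apply: eq_bigr => j _; rewrite -vpowD; congr vpow; rewrite /= /bump; lia.
Qed.

Lemma qintSr n :
  qint n.+1 = vpow int 1 * qint n + vpow int (- n.+1%:Z).
Proof.
rewrite /qint big_ord_recr mulr_sumr /=; congr (_ + _).
  by apply: eq_bigr => j _; rewrite -vpowD; congr vpow; lia.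
by congr vpow; lia.
Qed.

Lemma qintSS n :
  qint n.+2 = vpow int n.+2 + vpow int (- n.+2%:Z) + qint n.
Proof.
rewrite qintSl qintSr mulrDr mulrA -!vpowD (_ : -1 + 1 = 0) // mul1r.
by rewrite (_ : -1 - n.+1%:Z = - n.+2%:Z); [ring | lia].
Qed.

Lemma coef_qint n i :
  (qint n)@_i = ((`|i| <= n)%N && (odd n == odd `|i|%N))%:R.
Proof.
elim/ltn_ind: n i => -[|[|n]] IH i.
- by rewrite qint0 coef_1; congr (nat_of_bool _)%:R; lia.
- rewrite qintSl qint0 mulr1 mcoeffD !coef_vpow -natrD; congr _%:R.
  by lia.
rewrite qintSS !mcoeffD !coef_vpow IH // -!natrD; congr _%:R.
by lia.
Qed.

Lemma qint_top n m :
  qint (n + m).+2 = vpow int n.+1 * qint m.+1 + vpow int (- m.+2%:Z) * qint n.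
Proof.
elim: n => [|n IH]; first by rewrite qintSr qint0 mulr1.
rewrite addSn qintSr IH [qint n.+1]qintSr !mulrDr !mulrA -!vpowD -addrA.
congr (vpow int _ * _ + (vpow int _ * _ + vpow int _)); lia.
Qed.

(** The Clebsch-Gordan rule, one step at a time. *)
Lemma qintM n m : qint n.+1 * qint m.+1 = qint (n + m).+2 + qint n * qint m.
Proof.
rewrite qint_top [in LHS]qintSl mulrDl -addrA; congr (_ + _).
rewrite [qint m.+1]qintSr.
have -> : vpow int (-1) * qint n * (vpow int 1 * qint m + vpow int (- m.+1%:Z))
  = qint n * ((vpow int (-1) * vpow int 1) * qint m
              + vpow int (-1) * vpow int (- m.+1%:Z)) by ring.
rewrite -!vpowD vpow0 (_ : -1 - m.+1%:Z = - m.+2%:Z); last by lia.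
by ring.
Qed.

(** The value of a character at the square of a torus element is the difference
    of the characters of the symmetric and the exterior square; for [qint n] it
    is qint (2n) - qint (2n - 2) + qint (2n - 4) - ... *)
Lemma lsq_qint n : lsq (qint n.+1) + lsq (qint n) = qint n.+1.*2.
Proof.
elim: n => [|n IH].
  rewrite qintSl qint0 mulr1 lsqD lsq1 !lsq_vpow qintSS qint0.
  by [].
rewrite qintSS 2!lsqD -addrA [_ + lsq (qint n.+1)]addrC IH !lsq_vpow.
have -> : 2 * n.+2%:Z = n.+1.*2.+2%:Z by lia.
have -> : 2 * (- n.+2%:Z) = - n.+1.*2.+2%:Z by lia.
by rewrite -qintSS.
Qed.

(** These turn out to be the symmetric Laurent polynomials with nonnegative
    coefficients, with exponents of the parity [e], that decrease away from the
    middle ([symuni_shapeP], [shape_symuni]).  As sums of characters they are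
    closed under products by the Clebsch-Gordan rule. *)
Inductive symuni (e : bool) : Zv -> Prop :=
| symuni_0 : symuni e 0
| symuni_add n f : odd n = e -> symuni e f -> symuni e (qint n + f).

Lemma symuniD e f g : symuni e f -> symuni e g -> symuni e (f + g).
Proof.
move=> sf sg; elim: sf => [|n {}f en _ IH]; first by rewrite add0r.
by rewrite -addrA; apply: symuni_add.
Qed.

Lemma symuni_qint n : symuni (odd n) (qint n).
Proof. by rewrite -[qint n]addr0; apply: symuni_add => //; apply: symuni_0. Qed.

Lemma symuni_qintMn e n k : odd n = e -> symuni e (qint n *+ k).
Proof.
move=> en; elim: k => [|k IH]; first exact: symuni_0.
by rewrite mulrS; apply: symuni_add.
Qed.

Lemma symuni_qintM n m : symuni (odd n (+) odd m) (qint n * qint m).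
Proof.
elim: n m => [|n IH] m; first by rewrite qint0 mul1r; apply: symuni_qint.
case: m => [|m]; first by rewrite qint0 mulr1 addbF; apply: symuni_qint.
rewrite qintM /= addbN addNb negbK -oddD; apply: symuni_add => /=.
  by rewrite negbK.
by rewrite oddD.
Qed.

Lemma symuniM e1 e2 f g :
  symuni e1 f -> symuni e2 g -> symuni (e1 (+) e2) (f * g).
Proof.
move=> sf sg; elim: sf => [|n {}f <- _ IH]; first by rewrite mul0r; apply: symuni_0.
rewrite mulrDl; apply: symuniD; last exact: IH.
clear IH; elim: sg => [|m {}g <- _ IHg]; first by rewrite mulr0; apply: symuni_0.
by rewrite mulrDr; apply: symuniD => //; apply: symuni_qintM.
Qed.

Definition parity (e : bool) (f : Zv) := forall i, f@_i != 0 -> odd `|i|%N = e.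

Lemma parity_lsgn (e : bool) f : lsgn f = (-1) ^+ e * f -> parity e f.
Proof.
have -> : (-1) ^+ e = ((-1) ^+ e)%:~R :> Zv by rewrite rmorphXn /= rmorphN1.
move/malgP => E i; have := E i; rewrite coef_lsgn signz coefMintr.
have [//|nz] := eqVneq (f@_i) 0.
by move=> + _ => /(mulIf nz) => {E}; case: (odd _); case: e.
Qed.

Record symuni_shape (e : bool) (f : Zv) : Prop := SymuniShape {
  shape_sym : forall i, f@_(- i) = f@_i;
  shape_par : parity e f;
  shape_ge0 : laurent_nonneg f;
  shape_dec : forall i : int, 0 <= i -> f@_(i + 2) <= f@_i }.

Lemma symuni_shapeP e f : symuni e f -> symuni_shape e f.
Proof.
elim=> [|n {}f en _ [sy pa nn de]].
  by split=> i; rewrite ?mcoeff0 // eqxx.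
split=> i; rewrite ?mcoeffD ?coef_qint.
- by rewrite sy abszN.
- have [oe _|ne] := eqVneq (odd n) (odd `|i|%N); first by rewrite -oe.
  by rewrite andbF add0r => /pa.
- by rewrite addr_ge0.
- move=> i0; apply: lerD; last exact: de.
  by rewrite ler_nat; lia.
Qed.

Lemma shape_le e f : symuni_shape e f ->
  forall (n i : nat), (i <= n)%N -> odd i = odd n -> f@_(n%:Z) <= f@_(i%:Z).
Proof.
move=> sh n i; elim/ltn_ind: n => n IH le ev.
have [->|ne] := eqVneq i n; first by [].
have n2 : (i + 2 <= n)%N by lia.
have := shape_dec sh (i := (n - 2)%N%:Z) isT.
have -> : (n - 2)%N%:Z + 2 = n%:Z by lia.
by move/le_trans; apply; apply: IH; lia.
Qed.

(** Peel off the top degree: subtract the multiple of [qint n] that kills the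
    coefficients of v^n and v^-n; symmetry and monotonicity survive. *)
Lemma shape_symuni e f : symuni_shape e f -> symuni e f.
Proof.
move=> sh.
have [n] : exists n : nat, forall i, f@_i != 0 -> (`|i| < n)%N.
  exists (\max_(i <- msupp f) `|i|%N).+1 => i; rewrite mcoeff_neq0 => fi.
  by rewrite ltnS; apply: (@leq_bigmax_seq _ _ predT (fun i : int => `|i|%N)).
elim: n f sh => [|n IH] f sh bd.
  suff -> : f = 0 by apply: symuni_0.
  apply/malgP => i; rewrite mcoeff0; apply/eqP; apply: contraT => /bd.
  by rewrite ltn0.
have [en|ne] := eqVneq (odd n) e; last first.
  apply: IH => // i fi; have := bd i fi; rewrite ltnS leq_eqVlt.
  case/orP => // /eqP ei; case/eqP: ne.
  by rewrite -(shape_par sh fi) ei.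
pose k := `|f@_(n%:Z)|%N.
have kE : f@_(n%:Z) = k%:Z by rewrite gez0_abs // (shape_ge0 sh).
pose g := f - qint n *+ k.
have gE i : g@_i =
    f@_i - k%:Z *+ ((`|i| <= n)%N && (odd n == odd `|i|%N)).
  rewrite mcoeffB mcoeffMn coef_qint; congr (_ - _).
  by case: (_ && _); rewrite ?mul0rn //; exact: natz.
have fabs i : f@_(`|i|%N%:Z) = f@_i.
  case: (lerP 0 i) => i0; first by rewrite gez0_abs.
  by rewrite ltz0_abs // (shape_sym sh).
have g0 i : 0 <= g@_i.
  rewrite gE; case: (boolP (_ && _)) => [/andP[le ev]|_]; last first.
    by rewrite subr0 (shape_ge0 sh).
  rewrite -kE subr_ge0 -[f@_i]fabs; apply: (shape_le sh) => //.
  by rewrite (eqP ev).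
have -> : f = qint n *+ k + g by rewrite addrC subrK.
apply: symuniD; first exact: symuni_qintMn.
apply: IH => [|i].
  split=> [i|i|//|i i0].
  - by rewrite !gE (shape_sym sh) abszN.
  - rewrite gE; have [->|fi _] := eqVneq (f@_i) 0; last exact: (shape_par sh).
    rewrite sub0r oppr_eq0; case: (boolP (_ && _)) => [/andP[_ /eqP <-]//|_].
    by rewrite eqxx.
  have [le|gt] := leqP `|(i + 2)%R|%N n.
    rewrite !gE; have -> : (`|(i + 2)%R| <= n)%N = (`|i| <= n)%N by lia.
    have -> : odd `|(i + 2)%R|%N = odd `|i|%N by lia.
    by rewrite lerB // (shape_dec sh).
  have -> : g@_(i + 2) = 0; last exact: g0.
  rewrite gE leqNgt gt subr0; apply/eqP; apply: contraT => /bd.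
  by rewrite ltnS leqNgt gt.
rewrite gE => gi; have : (`|i| <= n)%N.
  rewrite leqNgt; apply: contra gi => gt.
  rewrite leqNgt gt subr0; apply: contraT => /bd.
  by rewrite ltnS leqNgt gt.
rewrite leq_eqVlt => /orP[/eqP ei|//].
by move: gi; rewrite ei leqnn eqxx -fabs ei kE subrr eqxx.
Qed.

(** Because of the factor 1/2 the h^+ and h^- have rational coefficients; their
    unimodality forces the coefficients to be integers, and is then a property
    of a Laurent polynomial with integer coefficients. *)
Definition int_form (R : numDomainType) (g : laurent R) (f : Zv) :=
  forall i, g@_i = (f@_i)%:~R.

Lemma unimodal_in_q_int (R : numDomainType) (g : laurent R) d :
  unimodal_in_q (vpow R d * g) ->
  exists2 f, int_form g f & unimodal_in_q (vpow int d * f).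
Proof.
case=> p /malgP E up; exists (vpow int (- d) * at_laurent p (vq int)).
  move=> i; have := E (i + d); rewrite coefMvpow addrK => ->.
  rewrite coefMvpow opprK.
  have [[j ->]|nj] := EM (exists j : nat, i + d = 2 * j%:Z).
    by rewrite !coef_at_laurent intz.
  by rewrite !coef_at_laurent0 // => j e; apply: nj; exists j.
by exists p => //; rewrite mulrA vpowKN mul1r.
Qed.

(** By symmetry v^d f has no negative exponents, and its coefficients in q
    increase up to the middle one, whose index is d/2. *)
Lemma symuni_unimodal (R : numDomainType) e (g : laurent R) f d :
  symuni e f -> int_form g f -> has_degree g d ->
  unimodal_in_q (vpow R d * g).
Proof.
move=> /symuni_shapeP sh gf [[-> ->]|[gd gmax]].
  rewrite mulr0; exists 0; first by rewrite at_laurent0.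
  by exists 0%N; split=> j; rewrite !coef0.
have f_le i : d < i -> f@_i = 0.
  move=> di; apply/eqP; apply: contraTT di => fi; rewrite -leNgt.
  by apply: gmax; rewrite gf intr_eq0.
have fd : f@_d != 0 by move: gd; rewrite gf intr_eq0.
have d0 : 0 <= d.
  have : f@_(- d) != 0 by rewrite (shape_sym sh).
  by apply: contraR; rewrite -ltNge => d0; apply/eqP/f_le; lia.
have f_ge i : i < - d -> f@_i = 0.
  by move=> di; rewrite -(shape_sym sh); apply: f_le; lia.
pose p : {poly int} := \poly_(j < `|d|%N.+1) f@_(2 * j%:Z - d).
have pE j : p`_j = f@_(2 * j%:Z - d).
  by rewrite coef_poly; case: ltnP => // ge; rewrite f_le //; lia.
exists p.
  apply/malgP => i; rewrite coefMvpow gf.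
  have [[j ->]|nj] := EM (exists j : nat, i = 2 * j%:Z).
    by rewrite coef_at_laurent pE.
  rewrite coef_at_laurent0; last by move=> j e0; apply: nj; exists j.
  have -> : f@_(i - d) = 0; last by [].
  apply/eqP; apply: contraT => fi.
  have := shape_par sh fi; rewrite -(shape_par sh fd) => od.
  case: (lerP 0 i) => i0; first by case: nj; exists `|i|%N./2; lia.
  by move: fi; rewrite f_ge ?eqxx //; lia.
(* For odd d the two middle coefficients are equal, so d/2 may be rounded up. *)
exists (uphalf `|d|%N); split=> j; rewrite !pE.
- exact: (shape_ge0 sh).
- move=> jd; rewrite -[f@_(2 * j%:Z - d)](shape_sym sh).
  case: (lerP 0 (2 * j.+1%:Z - d)) => i0.
    have -> : - (2 * j%:Z - d) = (2 * j.+1%:Z - d) + (2 * (d - 2 * j%:Z - 1)) by lia.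
    have -> : d - 2 * j%:Z - 1 = (if odd `|d|%N then 0 else 1) by case: ifP; lia.
    case: ifP => _; first by rewrite mulr0 addr0.
    by rewrite mulr1; apply: (shape_dec sh).
  have := shape_dec sh (i := - (2 * j.+1%:Z - d)) ltac:(lia).
  rewrite (shape_sym sh (_ - d)); congr (_ <= _); congr mcoeff; lia.
- move=> dj; have := shape_dec sh (i := 2 * j%:Z - d) ltac:(lia).
  by congr (_ <= _); congr mcoeff; lia.
Qed.

Lemma homo_upto (p : nat -> int) m :
  (forall j, (j < m)%N -> p j <= p j.+1) ->
  forall j k, (j <= k)%N -> (k <= m)%N -> p j <= p k.
Proof.
move=> inc j k; elim: k => [|k IH]; first by rewrite leqn0 => /eqP ->.
rewrite leq_eqVlt => /orP[/eqP -> //|jk] km.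
by apply: le_trans (inc _ km); apply: IH => //; apply: ltnW.
Qed.

(** A unimodal sequence that is symmetric decreases away from its middle: on the
    wrong side of the peak, compare with the mirror image of the step. *)
Lemma unimodal_symuni e (f : Zv) d :
  (forall i, f@_(- i) = f@_i) -> parity e f ->
  (forall i, f@_i != 0 -> i <= d) -> unimodal_in_q (vpow int d * f) ->
  symuni e f.
Proof.
move=> sy pa fmax [p /malgP E [m [p0 inc dec]]].
have fE (j : nat) : f@_(2 * j%:Z - d) = p`_j.
  by rewrite -coefMvpow E coef_at_laurent intz.
have fP i : f@_i != 0 -> exists j : nat, i = 2 * j%:Z - d.
  move=> fi; apply: contrapT => nj; case/eqP: fi.
  have := E (i + d); rewrite coefMvpow addrK => ->.
  by rewrite coef_at_laurent0 // => j ej; apply: nj; exists j; lia.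
have f0 i : 0 <= f@_i.
  by have [->//|/fP[j ->]] := eqVneq (f@_i) 0; rewrite fE.
apply: shape_symuni; split=> // i i0.
have [->//|fi2] := eqVneq (f@_(i + 2)) 0.
have [[|j] ej] := fP _ fi2; first by have := fmax _ fi2; lia.
have -> : i = 2 * j%:Z - d by lia.
have -> : 2 * j%:Z - d + 2 = 2 * j.+1%:Z - d by lia.
rewrite fE; have le_d := fmax _ fi2.
have [mj|jm] := leqP m j; first by rewrite fE; apply: dec.
have [k ek] : exists k : nat, 2 * k%:Z - d = - (2 * j.+1%:Z - d).
  by exists `|d - j.+1%:Z|%N; lia.
rewrite -fE -sy -ek !fE; apply: (homo_upto (m := m)) => //; last by lia.
by lia.
Qed.

(** Simultaneous unimodality of h^+ and h^-, given their sum and difference;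
    the common parity keeps the sums in the product rule unimodal. *)
Definition pair_symuni (f g : Zv) := exists e a b,
  [/\ symuni e a, symuni e b, f = a + b & g = a - b].

Lemma pair_symuniM f1 g1 f2 g2 : pair_symuni f1 g1 -> pair_symuni f2 g2 ->
  pair_symuni (f1 * f2) (g1 * g2).
Proof.
move=> [e1 [a1 [b1 [sa1 sb1 -> ->]]]] [e2 [a2 [b2 [sa2 sb2 -> ->]]]].
exists (e1 (+) e2), (a1 * a2 + b1 * b2), (a1 * b2 + b1 * a2).
by split; [apply: symuniD; apply: symuniM | apply: symuniD; apply: symuniM
  | ring | ring].
Qed.

Lemma pair_symuni1 : pair_symuni 1 1.
Proof.
exists false, 1, 0; split; rewrite ?addr0 ?subr0 //; last exact: symuni_0.
by rewrite -qint0; apply: (symuni_qint 0).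
Qed.

(** The symmetric and the exterior square of an irreducible representation of
    SL_2: in passing from n to n+1 they trade places, up to the new top term. *)
Lemma pair_symuni_qint n : exists a b, [/\ symuni false a, symuni false b,
  qint n * qint n = a + b & lsq (qint n) = a - b].
Proof.
elim: n => [|n [a [b [sa sb Eq El]]]].
  exists 1, 0; split; rewrite ?qint0 ?lsq1 ?mulr1 ?addr0 ?subr0 //.
    by rewrite -qint0; apply: (symuni_qint 0).
  exact: symuni_0.
exists (qint n.+1.*2 + b), a; split=> //.
- by apply: symuni_add => //; rewrite odd_double.
- by rewrite qintM Eq addnn -doubleS [a + b]addrC addrA.
- by rewrite -lsq_qint El; ring.
Qed.

(** Decomposing f = sum of [qint n_i], the cross terms of f^2 are products of
    two characters and the diagonal terms are [pair_symuni_qint]. *)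
Lemma pair_symuni_sq e f : symuni e f -> pair_symuni (f ^+ 2) (lsq f).
Proof.
move=> sf; exists false; elim: sf => [|n {}f en sf [a [b [sa sb Ef El]]]].
  by exists 0, 0; rewrite lsq0 expr0n subr0 addr0; split; try exact: symuni_0.
have [a' [b' [sa' sb' Eq Elq]]] := pair_symuni_qint n.
exists (qint n * f + a' + a), (qint n * f + b' + b).
have sc : symuni false (qint n * f).
  by rewrite -(addbb e) -{1}en; apply: symuniM sf; apply: symuni_qint.
split; try by do 2?[apply: symuniD => //].
  have -> : (qint n + f) ^+ 2
    = qint n * qint n + (qint n * f + qint n * f) + f ^+ 2 by ring.
  by rewrite Eq Ef; ring.
by rewrite lsqD Elq El; ring.
Qed.

Lemma has_degree_exists (R : comNzRingType) (f : laurent R) :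
  exists d, has_degree f d.
Proof.
have [->|nz] := eqVneq f 0; first by exists 0; left.
have : exists n : nat, forall i, f@_i != 0 -> (`|i| <= n)%N.
  exists (\max_(i <- msupp f) `|i|%N) => i; rewrite mcoeff_neq0 => fi.
  exact: (@leq_bigmax_seq _ _ predT (fun i : int => `|i|%N)).
case=> n bd.
have ex : exists k : nat, f@_(n%:Z - k%:Z) != 0.
  apply: contrapT => no; case/eqP: nz; apply/malgP => i; rewrite mcoeff0.
  apply/eqP; apply: contraT => fi; case: no; exists `|n%:Z - i|%N.
  by have := bd i fi => le; rewrite (_ : n%:Z - _ = i) //; lia.
exists (n%:Z - (ex_minn ex)%:Z); right; case: ex_minnP => k fk kmin.
split=> // i fi; have := bd i fi => le.
have := kmin `|n%:Z - i|%N; rewrite (_ : n%:Z - `|n%:Z - i|%N%:Z = i); last by lia.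
by move/(_ fi); lia.
Qed.

(** * Free modules and triangular bases *)

Section FreeModule.
Variable K : choiceType.
Implicit Types m : {malg Zv[K]}.

Lemma coef_basis (k j : K) : (basis k)@_j = (k == j)%:R.
Proof. exact: mcoeffU. Qed.

Lemma basis_coef_neq0 (k j : K) : (basis k)@_j != 0 -> j = k.
Proof.
by move=> kj; apply/eqP; apply: contraNT kj; rewrite eq_sym coef_basis => /negbTE ->.
Qed.

Definition spanned (D : K -> Prop) m := forall k, m@_k != 0 -> D k.

Lemma spanned0 D : spanned D 0.
Proof. by move=> k; rewrite mcoeff0 eqxx. Qed.

Lemma spannedD D m1 m2 : spanned D m1 -> spanned D m2 -> spanned D (m1 + m2).
Proof.
move=> s1 s2 k; rewrite mcoeffD; have [->|/s1 //] := eqVneq (m1@_k) 0.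
by rewrite add0r => /s2.
Qed.

Lemma spannedZ D (a : Zv) m : spanned D m -> spanned D (a *: m).
Proof.
move=> sm k; rewrite mcoeffZ; have [->|/sm //] := eqVneq (m@_k) 0.
by rewrite mulr0 eqxx.
Qed.

Lemma spanned_basis (D : K -> Prop) k : D k -> spanned D (basis k).
Proof. by move=> Dk j /basis_coef_neq0 ->. Qed.

Lemma spannedT m : spanned (fun=> True) m.
Proof. by []. Qed.

Lemma monalg_basisE (a : Zv) (k : K) : << a *g k >> = a *: basis k.
Proof.
apply/malgP => j; rewrite mcoeffZ coef_basis mcoeffU.
by case: eqP => _; rewrite ?mulr1 ?mulr0.
Qed.

Lemma spanned_ind (D : K -> Prop) (P : {malg Zv[K]} -> Prop) : P 0 ->
  (forall (a : Zv) k m, D k -> spanned D m -> P m -> P (a *: basis k + m)) ->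
  forall m, spanned D m -> P m.
Proof.
move=> P0 PD m sm; rewrite [m]monalgE.
suff H (r : seq K) : (forall k, k \in r -> D k) ->
  P (\sum_(k <- r) << m@_k *g k >>) /\
  spanned D (\sum_(k <- r) << m@_k *g k >>).
  by case: (H (msupp m)) => // k; rewrite -mcoeff_neq0 => /sm.
elim: r => [_|k r IH Dr]; first by rewrite big_nil; split=> //; apply: spanned0.
have [i|] := IH; first by move=> ir; apply: Dr; rewrite inE ir orbT.
move=> IH1 IH2; rewrite big_cons monalg_basisE.
have Dk : D k by apply: Dr; rewrite inE eqxx.
split; first exact: PD.
by apply: spannedD => //; apply: spannedZ; apply: spanned_basis.
Qed.

Lemma basis_ind (P : {malg Zv[K]} -> Prop) : P 0 ->
  (forall (a : Zv) k m, P m -> P (a *: basis k + m)) -> forall m, P m.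
Proof.
by move=> P0 PD m; apply: (spanned_ind (D := fun=> True)) => // *; apply: PD.
Qed.

Section Lincomb.
Variables (V : lmodType Zv) (c : K -> V).

Lemma lincombE (E : {fset K}) m : (msupp m `<=` E)%fset ->
  lincomb c m = \sum_(k <- E) m@_k *: c k.
Proof.
move=> sE; rewrite /lincomb (big_fset_incl _ sE) // => k _ /mcoeff_outdom ->.
by rewrite scale0r.
Qed.

Lemma lincombD m1 m2 : lincomb c (m1 + m2) = lincomb c m1 + lincomb c m2.
Proof.
rewrite (lincombE (msuppD_le m1 m2)) (lincombE (fsubsetUl (msupp m1) (msupp m2))).
rewrite (lincombE (fsubsetUr (msupp m1) (msupp m2))) -big_split /=.
by apply: eq_bigr => k _; rewrite mcoeffD scalerDl.
Qed.

Lemma lincombZ (a : Zv) m : lincomb c (a *: m) = a *: lincomb c m.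
Proof.
rewrite (lincombE (msuppZ_le a m)) /lincomb scaler_sumr.
by apply: eq_bigr => k _; rewrite mcoeffZ scalerA.
Qed.

Lemma lincomb0 : lincomb c 0 = 0.
Proof. by rewrite /lincomb msupp0 big_seq_fset0. Qed.

Lemma lincombB m1 m2 : lincomb c (m1 - m2) = lincomb c m1 - lincomb c m2.
Proof. by rewrite lincombD -[- m2]scaleN1r lincombZ scaleN1r. Qed.

Lemma lincomb_basis k : lincomb c (basis k) = c k.
Proof.
by rewrite (lincombE msuppU_le) big_seq_fset1 coef_basis eqxx scale1r.
Qed.

End Lincomb.

Lemma coef_lincomb (K' : choiceType) (c : K -> {malg Zv[K']}) m j :
  (lincomb c m)@_j = \sum_(k <- msupp m) m@_k * (c k)@_j.
Proof.
rewrite /lincomb raddf_sum; apply: eq_bigr => k _; exact: mcoeffZ.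
Qed.

Lemma eq_lincomb (V : lmodType Zv) (c c' : K -> V) D m : spanned D m ->
  (forall k, D k -> c k = c' k) -> lincomb c m = lincomb c' m.
Proof.
move=> sm cc'; elim/spanned_ind: sm => [|a k {}m Dk _ IH].
  by rewrite !lincomb0.
by rewrite !lincombD !lincombZ !lincomb_basis IH cc'.
Qed.

End FreeModule.

Lemma lincomb_comp (K K' : choiceType) (V : lmodType Zv)
    (c : K' -> V) (d : K -> {malg Zv[K']}) m :
  lincomb c (lincomb d m) = lincomb (fun k => lincomb c (d k)) m.
Proof.
elim/basis_ind: m => [|a k m IH]; first by rewrite !lincomb0.
by rewrite !lincombD !lincombZ !lincomb_basis IH.
Qed.

Lemma spanned_lincomb (K K' : choiceType) (D : K -> Prop) (D' : K' -> Prop)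
    (c : K -> {malg Zv[K']}) m :
  spanned D m -> (forall k, D k -> spanned D' (c k)) -> spanned D' (lincomb c m).
Proof.
move=> sm cD; elim/spanned_ind: sm => [|a k {}m Dk _ IH].
  by rewrite lincomb0; apply: spanned0.
rewrite lincombD lincombZ lincomb_basis; apply: spannedD => //.
by apply: spannedZ; apply: cD.
Qed.

Lemma vpow_mul_eq0 n (f : Zv) : f * vpow int n = 0 -> f = 0.
Proof.
move/(congr1 (fun z => z * vpow int (- n))).
by rewrite -mulrA vpowKN mulr1 mul0r.
Qed.

(** [f] lies in v^-1 Z[v^-1]. *)
Definition negdeg (f : Zv) := forall i, f@_i != 0 -> i < 0.

Lemma negdeg0 : negdeg 0.
Proof. by move=> i; rewrite mcoeff0 eqxx. Qed.

Lemma negdegB f g : negdeg f -> negdeg g -> negdeg (f - g).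
Proof.
move=> nf ng i; rewrite mcoeffB; have [->|/nf //] := eqVneq (f@_i) 0.
by rewrite sub0r oppr_eq0 => /ng.
Qed.

Lemma negdeg_lbar f : negdeg f -> lbar f = f -> f = 0.
Proof.
move=> nf /malgP bf; apply/malgP => i; rewrite mcoeff0; apply/eqP.
apply: contraT => fi; have := nf _ fi.
have := nf (- i); rewrite -coef_lbar bf => /(_ fi).
by lia.
Qed.

Lemma negdegD f g : negdeg f -> negdeg g -> negdeg (f + g).
Proof.
move=> nf ng i; rewrite mcoeffD; have [->|/nf //] := eqVneq (f@_i) 0.
by rewrite add0r => /ng.
Qed.

Lemma negdegM f g : negdeg f -> negdeg g -> negdeg (f * g).
Proof.
move=> nf ng; rewrite [f]laurent_sumE mulr_suml big_seq.
apply: big_ind => [||i fi]; [exact: negdeg0 | exact: negdegD |].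
have i0 : i < 0 by apply: nf; rewrite mcoeff_neq0.
move=> j; rewrite -intr_vpow -mulrA coefMintr coefMvpow.
have [->|gi _] := eqVneq (g@_(j - i)) 0; first by rewrite mulr0 eqxx.
by have := ng _ gi; lia.
Qed.

Section Triangular.
Variables (K : choiceType) (len : K -> nat) (c : K -> {malg Zv[K]}).
Hypothesis c_diag : forall k, (c k)@_k = vpow int (- (len k)%:Z).
Hypothesis c_tri : forall k j, (c k)@_j != 0 -> j != k -> (len j < len k)%N.

(** At an index of maximal length in the support no other term contributes. *)
Lemma top_coef e k : (forall j, e@_j != 0 -> (len j <= len k)%N) ->
  (lincomb c e)@_k = e@_k * vpow int (- (len k)%:Z).
Proof.
move=> top; rewrite coef_lincomb.
have -> : \sum_(j <- msupp e) e@_j * (c j)@_k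
    = \sum_(j <- msupp e) (if j == k then e@_k * vpow int (- (len k)%:Z) else 0).
  rewrite [LHS]big_seq [RHS]big_seq; apply: eq_bigr => j je.
  have [->|jk] := eqVneq j k; first by rewrite c_diag.
  have [->|ck] := eqVneq ((c j)@_k) 0; first by rewrite mulr0.
  have := c_tri ck; rewrite eq_sym jk => /(_ isT).
  by rewrite ltnNge top // mcoeff_neq0.
have [ke|nke] := boolP (k \in msupp e).
  rewrite (big_fsetD1 k) //= eqxx big_seq big1 ?addr0 // => j.
  by rewrite !inE => /andP[/negbTE ->].
rewrite big_seq big1 => [|j je]; first by rewrite mcoeff_outdom // mul0r.
by case: eqP => // ejk; rewrite -ejk je in nke.
Qed.

Lemma top_exists (e : {malg Zv[K]}) : e != 0 ->
  exists2 k, e@_k != 0 & forall j, e@_j != 0 -> (len j <= len k)%N.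
Proof.
move=> nz.
have [k ke] : exists k, k \in msupp e.
  apply: contrapT => no; case/eqP: nz; apply/malgP => k; rewrite mcoeff0.
  by apply: mcoeff_outdom; apply/negP => ke; apply: no; exists k.
have [n le] : exists n, forall j, e@_j != 0 -> (len j <= n)%N.
  exists (\max_(j <- msupp e) len j)%N => j; rewrite mcoeff_neq0 => je.
  exact: (@leq_bigmax_seq _ _ predT).
elim: n => [|n IH] in le *.
  exists k; first by rewrite mcoeff_neq0.
  by move=> j /le; rewrite leqn0 => /eqP ->.
have [[j [je ej]]|no] := EM (exists j, e@_j != 0 /\ len j = n.+1).
  by exists j => // i /le; rewrite ej.
apply: IH => j je; have := le _ je; rewrite leq_eqVlt => /orP[/eqP ej|//].
by case: no; exists j.
Qed.

Lemma lincomb_eq0 e : lincomb c e = 0 -> e = 0.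
Proof.
move=> e0; apply/eqP; apply: contraT => /top_exists [k ek top].
have := top_coef top; rewrite e0 mcoeff0 => /esym /vpow_mul_eq0 z.
by rewrite z eqxx in ek.
Qed.

Lemma lincomb_inj : injective (lincomb c).
Proof.
move=> e e' E; apply/eqP; rewrite -subr_eq0; apply/eqP/lincomb_eq0.
by rewrite lincombB E subrr.
Qed.

(** Up to a power of v, [c k] differs from the basis element at k by shorter
    terms, which lie in the span by induction on the length. *)
Lemma triangular_span (D : K -> Prop) :
  (forall k j, D k -> (c k)@_j != 0 -> D j) ->
  forall m, spanned D m -> exists2 e, spanned D e & m = lincomb c e.
Proof.
move=> Dc.
have red P : (forall k, P k -> exists2 e, spanned D e & basis k = lincomb c e) ->
  forall m, spanned P m -> exists2 e, spanned D e & m = lincomb c e.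
  move=> bas m sm; elim/spanned_ind: sm => [|a k {}m Dk _ [e se ->]].
    by exists 0; [apply: spanned0 | rewrite lincomb0].
  have [e' se' ->] := bas k Dk; exists (a *: e' + e).
    by apply: spannedD => //; apply: spannedZ.
  by rewrite lincombD lincombZ.
suff H n k : (len k < n)%N -> D k ->
    exists2 e, spanned D e & basis k = lincomb c e.
  by apply: red => k; apply: (H (len k).+1).
elim: n k => [//|n IH] k; rewrite ltnS => kn Dk.
have [|m|e se E] := red (fun j => (len j < n)%N /\ D j) _
    (vpow int (len k) *: c k - basis k).
- by move=> j [jn Dj]; apply: IH.
- rewrite mcoeffB mcoeffZ coef_basis eq_sym.
  have [->|mk] := eqVneq m k; first by rewrite c_diag vpowKN subrr eqxx.
  rewrite subr0; have [->|ck _] := eqVneq ((c k)@_m) 0.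
    by rewrite mulr0 eqxx.
  split; last exact: Dc ck.
  by apply: leq_trans kn; apply: c_tri.
exists (vpow int (len k) *: basis k - e).
  apply: spannedD; first by apply: spannedZ; apply: spanned_basis.
  by rewrite -[- e]scaleN1r; apply: spannedZ.
by rewrite lincombB lincombZ lincomb_basis -E opprB addrCA subrr addr0.
Qed.

Lemma spanned_coords (D : K -> Prop) :
  (forall k j, D k -> (c k)@_j != 0 -> D j) ->
  forall e, spanned D (lincomb c e) -> spanned D e.
Proof.
by move=> Dc e /(triangular_span Dc)[e' se' /lincomb_inj ->].
Qed.

End Triangular.

HB.lock Definition mapc (K : choiceType) (rho : Zv -> Zv) (m : {malg Zv[K]}) :
    {malg Zv[K]} :=
  \sum_(k <- msupp m) rho m@_k *: basis k.

Section ChangeCoefficients.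
Variables (K : choiceType) (rho : Zv -> Zv).
Hypotheses (rhoD : {morph rho : a b / a + b}) (rho0 : rho 0 = 0).
Hypotheses (rhoM : {morph rho : a b / a * b}) (rho1 : rho 1 = 1).

Local Notation mapc := (@mapc K rho).
Implicit Types m : {malg Zv[K]}.

Lemma coef_mapc m j : (mapc m)@_j = rho m@_j.
Proof.
rewrite mapc.unlock raddf_sum /=.
under eq_bigr => k _ do rewrite mcoeffZ coef_basis.
have [jm|njm] := boolP (j \in msupp m).
  rewrite (big_fsetD1 j) //= eqxx mulr1 big_seq big1 ?addr0 // => k.
  by rewrite !inE => /andP[/negbTE -> _]; rewrite mulr0.
rewrite big_seq big1 => [|k km]; first by rewrite mcoeff_outdom // rho0.
case: eqP => [ekj|_]; last by rewrite mulr0.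
by rewrite -ekj km in njm.
Qed.

Lemma mapcD : {morph mapc : m1 m2 / m1 + m2}.
Proof.
move=> m1 m2; apply/malgP => k; rewrite [LHS]coef_mapc mcoeffD rhoD [RHS]mcoeffD.
by congr (_ + _); rewrite coef_mapc.
Qed.

Lemma mapcZ (a : Zv) (m : {malg Zv[K]}) : mapc (a *: m) = rho a *: mapc m.
Proof.
apply/malgP => k; rewrite [LHS]coef_mapc.
transitivity (rho (a * m@_k)); first by congr rho; exact: mcoeffZ.
by rewrite rhoM [RHS]mcoeffZ; congr (_ * _); rewrite coef_mapc.
Qed.

Lemma mapc0 : mapc 0 = 0.
Proof. by apply/malgP => k; rewrite [LHS]coef_mapc !mcoeff0. Qed.

Lemma mapc_basis k : mapc (basis k) = basis k.
Proof.
apply/malgP => j; rewrite [LHS]coef_mapc coef_basis.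
by case: eqP => _; [exact: rho1 | exact: rho0].
Qed.

End ChangeCoefficients.

Lemma semilin_lincomb (K K' : choiceType) (rho : Zv -> Zv)
    (F : {malg Zv[K']} -> {malg Zv[K']}) (c : K -> {malg Zv[K']}) :
  {morph rho : a b / a + b} -> {morph rho : a b / a * b} ->
  rho 0 = 0 -> rho 1 = 1 ->
  {morph F : x y / x + y} -> (forall (a : Zv) (x : {malg Zv[K']}), F (a *: x) = rho a *: F x) ->
  forall e, F (lincomb c e) = lincomb (fun k => F (c k)) (mapc rho e).
Proof.
move=> rD rM r0 r1 FD FZ e.
have F0 : F 0 = 0 by rewrite -(scale0r (0 : {malg Zv[K']})) FZ r0 !scale0r.
elim/basis_ind: e => [|a k e IH].
  by rewrite lincomb0 (mapc0 _ r0) lincomb0.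
rewrite lincombD lincombZ lincomb_basis FD.
rewrite FZ IH.
rewrite (mapcD rD r0) (mapcZ r0 rM) (mapc_basis r0 r1).
by rewrite lincombD lincombZ lincomb_basis.
Qed.

Section BarUnique.
Variables (K : choiceType) (len : K -> nat) (c : K -> {malg Zv[K]}).
Hypothesis c_diag : forall k, (c k)@_k = vpow int (- (len k)%:Z).
Hypothesis c_tri : forall k j, (c k)@_j != 0 -> j != k -> (len j < len k)%N.
Variable bar : {malg Zv[K]} -> {malg Zv[K]}.
Hypothesis barD : {morph bar : x y / x + y}.
Hypothesis barZ : forall (a : Zv) (x : {malg Zv[K]}), bar (a *: x) = lbar a *: bar x.
Hypothesis bar_c : forall k, bar (c k) = c k.

(** By uniqueness of the coordinates, since the bar operator only acts on them. *)
Lemma coords_bar e : bar (lincomb c e) = lincomb c e -> forall k, lbar e@_k = e@_k.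
Proof.
rewrite (semilin_lincomb c lbarD lbarM lbar0 lbar1 barD barZ).
rewrite (eq_lincomb (@spannedT _ _) (fun k _ => bar_c k)).
move=> /(lincomb_inj c_diag c_tri) /malgP E k.
by rewrite -[RHS]E (coef_mapc lbar0).
Qed.

(** A top coordinate of [m] in the bar-invariant basis is bar-invariant and
    lies in v^-1 Z[v^-1], hence vanishes. *)
Lemma bar_invariant_eq0 m : bar m = m ->
  (forall k, negdeg (vpow int (len k) * m@_k)) -> m = 0.
Proof.
have [e _ ->] := triangular_span c_diag c_tri (D := fun=> True)
  (fun _ _ _ _ => I) (@spannedT _ m).
move=> /coords_bar be neg; suff -> : e = 0 by exact: lincomb0.
apply/eqP; apply: contraT => /(top_exists len) [k ek top].
have := neg k; rewrite (top_coef c_diag c_tri top) mulrCA vpowKN mulr1.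
by move/negdeg_lbar => /(_ (be k)) z; rewrite z eqxx in ek.
Qed.

Hypothesis c_neg : forall k j, j != k -> negdeg (vpow int (len j) * (c k)@_j).

(** The characterization of Kazhdan-Lusztig basis elements; it serves to
    recognize the images of such elements under gluing and similar maps. *)
Lemma bar_invariant_unique m k : bar m = m -> m@_k = vpow int (- (len k)%:Z) ->
  (forall j, j != k -> negdeg (vpow int (len j) * m@_j)) -> m = c k.
Proof.
move=> bm mk neg; apply/eqP; rewrite -subr_eq0; apply/eqP.
apply: bar_invariant_eq0 => [|j].
  by rewrite -scaleN1r barD barZ lbarN lbar1 bm bar_c.
rewrite mcoeffB mulrBr; have [->|jk] := eqVneq j k.
  by rewrite mk c_diag subrr; apply: negdeg0.
by apply: negdegB; [apply: neg | apply: c_neg].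
Qed.

End BarUnique.

Definition in_image (K1 K2 : Type) (f : K1 -> K2) (k : K2) := exists k1, f k1 = k.

HB.lock Definition extend (K1 K2 : choiceType) (f : K1 -> K2) :
    {malg Zv[K1]} -> {malg Zv[K2]} :=
  lincomb (fun k => basis (f k)).

HB.lock Definition restrict (K1 K2 : choiceType) (f : K1 -> K2) :
    {malg Zv[K2]} -> {malg Zv[K1]} :=
  lincomb (fun k => if pselect (in_image f k) is left ex
                    then basis (projT1 (cid ex)) else 0).

Section Restriction.
Variables (K1 K2 : choiceType) (f : K1 -> K2).
Hypothesis f_inj : injective f.
Local Notation in_image := (in_image f).
Local Notation extend := (@extend K1 K2 f).
Local Notation restrict := (@restrict K1 K2 f).

Lemma extendD x y : extend (x + y) = extend x + extend y.
Proof. by rewrite extend.unlock lincombD. Qed.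

Lemma extendZ (a : Zv) x : extend (a *: x) = a *: extend x.
Proof. by rewrite extend.unlock lincombZ. Qed.

Lemma extend_basis k : extend (basis k) = basis (f k).
Proof. by rewrite extend.unlock lincomb_basis. Qed.

Lemma coef_extend m k : (extend m)@_(f k) = m@_k.
Proof.
rewrite extend.unlock; elim/basis_ind: m => [|a j m IH].
  by rewrite lincomb0 !mcoeff0.
rewrite lincombD lincombZ lincomb_basis !mcoeffD IH !mcoeffZ.
by rewrite !coef_basis (inj_eq f_inj).
Qed.

Lemma coef_restrict m k : (restrict m)@_k = m@_(f k).
Proof.
rewrite restrict.unlock; elim/basis_ind: m => [|a j m IH].
  by rewrite lincomb0 !mcoeff0.
rewrite lincombD lincombZ lincomb_basis !mcoeffD IH !mcoeffZ.
suff -> : (if pselect (in_image j) is left ex then basis (projT1 (cid ex))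
           else 0)@_k = (basis j)@_(f k) by [].
case: (pselect (in_image j)) => [ex|nex].
  by case: (cid ex) => k1 /= <-; rewrite !coef_basis (inj_eq f_inj).
rewrite mcoeff0 coef_basis; case: eqP => [ej|_]; last by [].
by case: nex; exists k.
Qed.

Lemma spanned_extend m : spanned in_image (extend m).
Proof.
rewrite extend.unlock; apply: spanned_lincomb (@spannedT _ _) _ => k _; apply: spanned_basis.
by exists k.
Qed.

Lemma extend_restrict m : spanned in_image m -> extend (restrict m) = m.
Proof.
move=> sm; apply/malgP => k.
have [[k1 <-]|nk] := EM (in_image k).
  by rewrite coef_extend coef_restrict.
have z m' : spanned in_image m' -> m'@_k = 0.
  by move=> s; apply/eqP; apply: contraT => /s.
by rewrite !z //; apply: spanned_extend.
Qed.

Lemma extend_inj : injective extend.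
Proof.
by move=> m m' E; apply/malgP => k; rewrite -[LHS]coef_extend E coef_extend.
Qed.

Lemma extend_lincomb (K : choiceType) (c : K -> {malg Zv[K1]}) e :
  extend (lincomb c e) = lincomb (fun k => extend (c k)) e.
Proof. by rewrite extend.unlock lincomb_comp. Qed.

Lemma lincomb_extend (V : lmodType Zv) (c : K2 -> V) e :
  lincomb c (extend e) = lincomb (fun k => c (f k)) e.
Proof.
by rewrite extend.unlock lincomb_comp; apply: eq_lincomb (@spannedT _ _) _ => k _;
  rewrite lincomb_basis.
Qed.

End Restriction.

(** * Lengths and the Bruhat order in a product of Coxeter groups *)

Section Words.
Variables (W : groupType) (S : W -> Prop).

Lemma ell_le w l : word_for S w l -> (ell S w <= size l)%N.
Proof.
move=> wl; rewrite /ell; case: pselect => // ex; case: ex_minnP => n _; apply.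
by apply/asboolP; exists l.
Qed.

Lemma ell_min w l : word_for S w l ->
  exists2 l', word_for S w l' & size l' = ell S w.
Proof.
move=> wl; rewrite /ell; case: pselect => [ex|nex]; last first.
  by case: nex; exists (size l); apply/asboolP; exists l.
by case: ex_minnP => n /asboolP.
Qed.

Lemma word_nil : word_for S 1%g [::].
Proof. by split=> //; rewrite big_nil. Qed.

Lemma word_cons s w l : S s -> word_for S w l -> word_for S (s * w)%g (s :: l).
Proof.
move=> Ss [lS ->]; split=> [t|]; last by rewrite big_cons.
by rewrite inE => /orP[/eqP ->|/lS].
Qed.

Lemma word_cat w1 l1 w2 l2 : word_for S w1 l1 -> word_for S w2 l2 ->
  word_for S (w1 * w2)%g (l1 ++ l2).
Proof.
move=> [S1 ->] [S2 ->]; split=> [t|]; last by rewrite big_cat.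
by rewrite mem_cat => /orP[/S1|/S2].
Qed.

Lemma word_inv s t l w : word_for S w (s :: l) ->
  [/\ S s, word_for S (s^-1 * w)%g l & (t \in l -> S t)].
Proof.
move=> [lS ->]; split; first by apply: lS; rewrite inE eqxx.
  split=> [u ul|]; first by apply: lS; rewrite inE ul orbT.
  by rewrite big_cons mulKg.
by move=> tl; apply: lS; rewrite inE tl orbT.
Qed.

Lemma ell1 : ell S 1%g = 0%N.
Proof. by apply/eqP; rewrite -leqn0; apply: (ell_le word_nil). Qed.

End Words.

Lemma morph_one (G H : groupType) (f : G -> H) :
  {morph f : x y / (x * y)%g} -> f 1%g = 1%g.
Proof.
by move=> fM; apply: (@mulgI _ (f 1%g)); rewrite -fM !mulg1.
Qed.

Lemma morph_inv (G H : groupType) (f : G -> H) :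
  {morph f : x y / (x * y)%g} -> {morph f : x / (x^-1)%g}.
Proof.
by move=> fM x; apply: (@mulgI _ (f x)); rewrite -fM !mulgV morph_one.
Qed.

Section Coxeter.
Variables (W : groupType) (S : W -> Prop).
Hypothesis cox : coxeter_system S.
Local Notation ell := (ell S).

Lemma genVg s : S s -> (s^-1 = s)%g.
Proof. by move=> Ss; apply: mulg1_eq; apply: (cox_invol cox). Qed.

Lemma genKg s : S s -> forall w, (s * (s * w) = w)%g.
Proof. by move=> Ss w; rewrite mulgA (cox_invol cox) // mul1g. Qed.

Lemma gengK s : S s -> forall w, (w * s * s = w)%g.
Proof. by move=> Ss w; rewrite -mulgA (cox_invol cox) // mulg1. Qed.

Lemma genX s n : S s -> (s ^+ n = if odd n then s else 1)%g.
Proof.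
move=> Ss; elim: n => [|n IH] //; rewrite expgS IH /=.
by case: (odd n) => /=; rewrite ?mulg1 ?(cox_invol cox).
Qed.

Lemma word_rev l : (forall s, s \in l -> S s) ->
  word_for S ((\prod_(s <- l) s)^-1)%g (rev l).
Proof.
move=> lS; split=> [s|]; first by rewrite mem_rev => /lS.
elim: l lS => [|s l IH] lS; first by rewrite !big_nil invg1.
rewrite rev_cons -cats1 big_cat big_seq1 big_cons /= invgM -IH.
  by rewrite (@genVg s) //; apply: (lS s); rewrite inE eqxx.
by move=> t tl; apply: lS; rewrite inE tl orbT.
Qed.

Lemma cox_word w : exists l, word_for S w l.
Proof.
elim: (cox_generated cox w) => {w} [|s Ss|x y _ [lx wx] _ [ly wy]|x _ [l [lS ->]]].
- by exists [::]; apply: word_nil.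
- by exists [:: s]; rewrite -[s in word_for _ s _]mulg1; apply: word_cons Ss (word_nil S).
- by exists (lx ++ ly); apply: word_cat.
by exists (rev l); apply: word_rev.
Qed.

Lemma ell_word w : exists2 l, word_for S w l & size l = ell w.
Proof. by have [l /ell_min] := cox_word w. Qed.

Lemma ell_s_le s w : S s -> (ell (s * w)%g <= (ell w).+1)%N.
Proof.
by move=> Ss; have [l wl <-] := ell_word w; apply: ell_le (word_cons Ss wl).
Qed.

(** The parity of the length is a group homomorphism, by the universal property
    applied to the constant map to an involution; so a generator always changes
    the length. *)
Lemma ell_odd w l : word_for S w l -> odd (size l) = odd (ell w).
Proof.
pose a : {perm bool} := tperm true false.
have aa : (a * a = 1)%g by exact: tperm2.
have an : a != 1%g.
  by apply/eqP => /permP /(_ true); rewrite tpermL perm1.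
have [|g gM gS] := @cox_universal _ _ cox {perm bool} (fun=> a).
  by move=> s t n _ _ _; rewrite aa expg1n.
have gl u k : word_for S u k -> g u = if odd (size k) then a else 1%g.
  elim: k u => [|s k IH] u wu.
    by case: wu => _ ->; rewrite big_nil (morph_one gM).
  have [Ss wk _] := word_inv 1%g wu.
  rewrite -[u](mulVKg s) gM gS // (IH _ wk) /=.
  by case: (odd _) => /=; rewrite ?mulg1.
have [l' wl' <-] := ell_word w; move=> wl.
have := gl _ _ wl; rewrite (gl _ _ wl').
by case: (odd _); case: (odd _) => // e; case/eqP: an.
Qed.

Lemma ell_sl s w : S s ->
  ell (s * w)%g = (ell w).+1 \/ ell w = (ell (s * w)%g).+1.
Proof.
move=> Ss; have [l wl lw] := ell_word w.
have := ell_odd (word_cons Ss wl); rewrite /= lw.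
have := ell_s_le w Ss; have := ell_s_le (s * w)%g Ss; rewrite genKg //.
by lia.
Qed.

Lemma ellV w : ell (w^-1)%g = ell w.
Proof.
suff le u : (ell (u^-1)%g <= ell u)%N.
  by apply/eqP; rewrite eqn_leq le -{1}[w]invgK le.
have [l wl <-] := ell_word u; rewrite -(size_rev l); apply: ell_le.
by case: wl => lS ->; exact: word_rev.
Qed.

Lemma cox_ind (P : W -> Prop) : P 1%g ->
  (forall s w, S s -> (ell w < ell (s * w)%g)%N -> P w -> P (s * w)%g) ->
  forall w, P w.
Proof.
move=> P1 PS w; have [n] := ubnP (ell w); elim: n w => // n IH w.
have [[|s l] wl lw] := ell_word w.
  by case: wl => _ ->; rewrite big_nil.
have [Ss wk _] := word_inv 1%g wl.
have lt : (ell (s^-1 * w)%g < ell w)%N.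
  by rewrite -lw /= ltnS; apply: ell_le.
move=> ln; rewrite -[w](mulVKg s); apply: PS => //; first by rewrite mulVKg.
by apply: IH; apply: leq_trans lt ln.
Qed.

Lemma morph_eq (G : groupType) (f g : W -> G) :
  {morph f : x y / (x * y)%g} -> {morph g : x y / (x * y)%g} ->
  (forall s, S s -> f s = g s) -> f =1 g.
Proof.
move=> fM gM fg w; elim/cox_ind: w => [|s w Ss _ IH].
  by rewrite (morph_one fM) (morph_one gM).
by rewrite fM gM fg // IH.
Qed.

Lemma bruhat_le_ell u w : bruhat_le S u w -> u = w \/ (ell u < ell w)%N.
Proof.
elim=> {u w} [u w [t [_ _ lt]]|u|u v w _ IH1 _ IH2]; [by right | by left |].
case: IH1 => [->//|lt1]; case: IH2 => [<-|lt2]; right=> //.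
exact: ltn_trans lt1 lt2.
Qed.

Lemma bruhat_gen s w : S s -> (ell w < ell (s * w)%g)%N -> bruhat_lt S w (s * w)%g.
Proof.
move=> Ss lt; split; last by move=> e; rewrite -e ltnn in lt.
apply: rt_step; exists s; split=> //; exists 1%g, s; split=> //.
by rewrite mul1g invg1 mulg1.
Qed.

Lemma bruhat_genr s w : S s -> (ell w < ell (w * s)%g)%N -> bruhat_le S w (w * s)%g.
Proof.
move=> Ss lt; apply: rt_step; exists (w * s * w^-1)%g; split=> //.
  by exists w, s.
by rewrite mulgVK.
Qed.

(** ** Direct factors *)

(** [J] is a set of generators commuting with all the others: a union of
    connected components of the Coxeter diagram. *)
Definition factor (J : W -> Prop) :=
  (forall s, J s -> S s) /\
  (forall s t, J s -> S t -> ~ J t -> (s * t = t * s)%g).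

Definition compl (J : W -> Prop) : W -> Prop := fun s => S s /\ ~ J s.

Lemma factor_compl J : factor J -> factor (compl J).
Proof.
move=> [JS JC]; split=> [s []//|s t [Ss nJs] St nct].
have Jt : J t by apply: contrapT => nJt; apply: nct.
by rewrite (JC t s).
Qed.

Lemma compl_compl J : factor J -> compl (compl J) = J.
Proof.
move=> [JS _]; apply/funext => s; apply/propext; split=> [[Ss n]|Js].
  by apply: contrapT => nJ; apply: n.
by split; [apply: JS | case].
Qed.

(** The map that fixes J and sends the other generators to 1 respects the
    relations: if (s t)^n = 1 with s in J and t not in J, then s^n = t^-n since
    they commute, and for odd n this would mean s = t. *)
Lemma pr_exists J : factor J -> exists p : W -> W,
  [/\ {morph p : x y / (x * y)%g}, forall s, J s -> p s = s
    & forall s, S s -> ~ J s -> p s = 1%g].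
Proof.
move=> [JS JC].
pose f s := if pselect (J s) then s else 1%g.
have half s t n : J s -> ~ J t -> S t -> ((s * t) ^+ n = 1)%g -> (s ^+ n = 1)%g.
  move=> Js nJt St; have Ss := JS s Js.
  rewrite expgMn; last by rewrite /commute JC.
  rewrite !genX //; case: (odd n) => // st1.
  have e : s = t by rewrite -[s](gengK St) st1 mul1g.
  by rewrite e in Js.
have [|p pM pS] := @cox_universal _ _ cox W f; last first.
  exists p; split=> // s => [Js|Ss nJs].
    by rewrite pS; [rewrite /f; case: (pselect (J s)) | apply: JS].
  by rewrite pS // /f; case: (pselect (J s)).
move=> s t n Ss St st1; rewrite /f.
case: (pselect (J s)) => Js; case: (pselect (J t)) => Jt; rewrite ?mulg1 ?mul1g ?expg1n //.
  exact: half st1.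
apply: (half t s) => //.
have := congr1 (fun x => x^-1)%g st1; rewrite invg1 -expVgn invgM.
by rewrite !genVg.
Qed.

(** The projection onto the subgroup generated by the factor [J] that kills the
    complementary factor; [id] is a default value. *)
Definition pr (J : W -> Prop) : W -> W :=
  if pselect (exists p : W -> W,
    [/\ {morph p : x y / (x * y)%g}, forall s, J s -> p s = s
      & forall s, S s -> ~ J s -> p s = 1%g]) is left ex
  then projT1 (cid ex) else id.

Section Projection.
Variable J : W -> Prop.
Hypothesis facJ : factor J.

Lemma pr_spec : [/\ {morph pr J : x y / (x * y)%g}, forall s, J s -> pr J s = s
      & forall s, S s -> ~ J s -> pr J s = 1%g].
Proof.
rewrite /pr; case: pselect => [ex|[]]; last exact: pr_exists.
by case: (cid ex).
Qed.

Lemma prM : {morph pr J : x y / (x * y)%g}. Proof. by case: pr_spec. Qed.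
Lemma pr_in s : J s -> pr J s = s. Proof. by case: pr_spec => _ + _; apply. Qed.
Lemma pr_out s : S s -> ~ J s -> pr J s = 1%g.
Proof. by case: pr_spec => _ _; apply. Qed.
Lemma pr1 : pr J 1%g = 1%g. Proof. exact: morph_one prM. Qed.
Lemma prV : {morph pr J : x / (x^-1)%g}. Proof. exact: morph_inv prM. Qed.

Lemma factorS s : J s -> S s. Proof. by case: facJ => + _; apply. Qed.

Lemma prK w : pr J (pr J w) = pr J w.
Proof.
apply: (morph_eq (f := fun w => pr J (pr J w))) => [x y||s Ss].
- by rewrite !prM.
- exact: prM.
have [Js|nJs] := EM (J s); first by rewrite !pr_in.
by rewrite (pr_out Ss nJs) pr1.
Qed.

End Projection.

Section Splitting.
Variable J : W -> Prop.
Hypothesis facJ : factor J.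
Local Notation p := (pr J).
Local Notation p' := (pr (compl J)).
Let facJ' := factor_compl facJ.

Lemma pr_compl_in s : J s -> p' s = 1%g.
Proof. by move=> Js; apply: (pr_out facJ' (factorS facJ Js)) => -[]. Qed.

Lemma pr_compl_out s : S s -> ~ J s -> p' s = s.
Proof. by move=> Ss nJs; apply: (pr_in facJ'). Qed.

Lemma pr_pr_compl w : p (p' w) = 1%g.
Proof.
apply: (morph_eq (f := fun w => p (p' w)) (g := fun=> 1%g)).
- by move=> x y; rewrite !(prM facJ', prM facJ).
- by move=> x y; rewrite mulg1.
move=> s Ss; have [Js|nJs] := EM (J s).
  by rewrite pr_compl_in // (pr1 facJ).
by rewrite pr_compl_out // pr_out.
Qed.

Lemma pr_compl_pr w : p' (p w) = 1%g.
Proof.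
apply: (morph_eq (f := fun w => p' (p w)) (g := fun=> 1%g)).
- by move=> x y; rewrite !(prM facJ', prM facJ).
- by move=> x y; rewrite mulg1.
move=> s Ss; have [Js|nJs] := EM (J s).
  by rewrite (pr_in facJ Js) // pr_compl_in.
by rewrite (pr_out facJ Ss nJs) // (pr1 facJ').
Qed.

Lemma pr_comm u w : (p u * p' w = p' w * p u)%g.
Proof.
elim/cox_ind: u w => [|s u Ss _ IH] w; first by rewrite (pr1 facJ) mul1g mulg1.
rewrite (prM facJ) -mulgA IH !mulgA; congr (_ * _)%g.
have [Js|nJs] := EM (J s); last by rewrite (pr_out facJ Ss nJs) // mul1g mulg1.
rewrite (pr_in facJ Js) //; elim/cox_ind: w => [|t w St _ IHw].
  by rewrite (pr1 facJ') mul1g mulg1.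
rewrite (prM facJ') mulgA -[RHS]mulgA -IHw !mulgA; congr (_ * _)%g.
have [Jt|nJt] := EM (J t); first by rewrite pr_compl_in // mul1g mulg1.
by rewrite pr_compl_out //; case: facJ => _; apply.
Qed.

Lemma pr_split w : (p w * p' w = w)%g.
Proof.
apply: (morph_eq (f := fun w => (p w * p' w)%g) (g := id)) => // [x y|s Ss].
  rewrite (prM facJ) (prM facJ') -!mulgA; congr (_ * _)%g.
  by rewrite !mulgA pr_comm.
have [Js|nJs] := EM (J s); first by rewrite (pr_in facJ Js) // pr_compl_in // mulg1.
by rewrite (pr_out facJ Ss nJs) // pr_compl_out // mul1g.
Qed.

(** Sorting the letters of a word by factor does not change its length. *)
Lemma word_split w l : word_for S w l -> exists l1 l2,
  [/\ word_for S (p w) l1, word_for S (p' w) l2 & size l = (size l1 + size l2)%N].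
Proof.
elim: l w => [|s l IH] w wl.
  case: wl => _ ->; rewrite big_nil; exists [::], [::].
  by rewrite (pr1 facJ) (pr1 facJ'); split=> //; apply: word_nil.
have [Ss /IH [l1 [l2 [w1 w2 sl]]] _] := word_inv 1%g wl.
rewrite -[w](mulVKg s) (prM facJ) (prM facJ').
have [Js|nJs] := EM (J s).
  exists (s :: l1), l2; rewrite (pr_in facJ Js) // pr_compl_in // mul1g.
  by split=> //; [apply: word_cons | rewrite /= sl].
exists l1, (s :: l2); rewrite (pr_out facJ Ss nJs) // pr_compl_out // mul1g.
by split=> //; [apply: word_cons | rewrite /= sl addnS].
Qed.

Lemma ell_split w : ell w = (ell (p w) + ell (p' w))%N.
Proof.
have [l wl lw] := ell_word w; have [l1 [l2 [w1 w2 sl]]] := word_split wl.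
apply/eqP; rewrite eqn_leq; apply/andP; split; last first.
  by rewrite -lw sl leq_add // ell_le.
have [k1 wk1 <-] := ell_word (p w); have [k2 wk2 <-] := ell_word (p' w).
by rewrite -size_cat; apply: ell_le; rewrite -{1}[w]pr_split; apply: word_cat.
Qed.

Lemma pr_compl_eq1 w : p w = w <-> p' w = 1%g.
Proof.
split=> [<-|e]; first exact: pr_compl_pr.
by rewrite -{2}[w]pr_split e mulg1.
Qed.

Lemma pr_ind (P : W -> Prop) : P 1%g ->
  (forall s w, J s -> p w = w -> (ell w < ell (s * w)%g)%N -> P w ->
     P (s * w)%g) ->
  forall w, p w = w -> P w.
Proof.
move=> P1 PS; apply: cox_ind => // s w Ss lt IH pw.
have [Js|nJs] := EM (J s).
  have e : p w = w by apply: (@mulgI _ s); rewrite -{1}(pr_in facJ Js) -prM.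
  by apply: PS => //; apply: IH.
have := ell_split w; move: pw; rewrite prM // (pr_out facJ Ss nJs) // mul1g => ->.
by lia.
Qed.

(** A reflection lies in one of the two factors, so a step in the Bruhat order
    changes one component only. *)
Lemma bruhat_pr u w : bruhat_le S u w -> bruhat_le S (p u) (p w).
Proof.
elim=> {u w} [u w [t [[x [s [Ss ->]]] -> lt]]|u|u v w _ IH1 _ IH2].
- have [Js|nJs] := EM (J s); last first.
    rewrite !(prM facJ) (prV facJ) (pr_out facJ Ss nJs) mulg1 mulgV mul1g.
    exact: rt_refl.
  apply: rt_step; exists (p (x * s * x^-1))%g; split.
  + by exists (p x), s; split=> //; rewrite !(prM facJ) (prV facJ) (pr_in facJ Js).
  + by rewrite prM.
  + move: lt; rewrite (ell_split u) (ell_split (_ * u)%g).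
    rewrite !(prM facJ') (prV facJ') (pr_compl_in Js) mulg1 mulgV mul1g.
    by rewrite ltn_add2r.
- exact: rt_refl.
- exact: rt_trans IH1 IH2.
Qed.

End Splitting.

Lemma bruhat_factor J u w : factor J ->
  bruhat_le S u w -> pr J w = w -> pr J u = u.
Proof.
move=> facJ le /(pr_compl_eq1 facJ) pw; apply/(pr_compl_eq1 facJ).
have := bruhat_pr (factor_compl facJ) le; rewrite pw.
by case/bruhat_le_ell => //; rewrite ell1.
Qed.

Lemma factorI J K : factor J -> factor K -> factor (fun s => J s /\ K s).
Proof.
move=> [JS JC] [KS KC]; split=> [s [/JS]//|s t [Js Ks] St njk].
have [Jt|nJt] := EM (J t); last exact: JC.
by apply: KC => // Kt; apply: njk.
Qed.

Lemma factorU J K : factor J -> factor K -> factor (fun s => J s \/ K s).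
Proof.
move=> [JS JC] [KS KC]; split=> [s [/JS|/KS]//|s t [Js|Ks] St njk].
  by apply: JC => // Jt; apply: njk; left.
by apply: KC => // Kt; apply: njk; right.
Qed.

Lemma pr_pr J K w : factor J -> factor K ->
  pr J (pr K w) = pr (fun s => J s /\ K s) w.
Proof.
move=> fJ fK; have fI := factorI fJ fK.
apply: (morph_eq (f := fun w => pr J (pr K w))) => [x y||s Ss].
- by rewrite (prM fK) (prM fJ).
- exact: prM.
have [Ks|nKs] := EM (K s); last first.
  by rewrite (pr_out fK Ss nKs) (pr1 fJ) (pr_out fI Ss) // => -[].
rewrite (pr_in fK Ks); have [Js|nJs] := EM (J s).
  by rewrite (pr_in fJ Js) (pr_in fI (conj Js Ks)).
by rewrite (pr_out fJ Ss nJs) (pr_out fI Ss) // => -[].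
Qed.

Lemma prU_compl J K w : factor J -> factor K -> (forall s, J s -> ~ K s) ->
  pr (fun s => J s \/ K s) w = w -> pr K (pr (compl J) w) = pr (compl J) w.
Proof.
move=> fJ fK dis <-; have fU := factorU fJ fK; have fC := factor_compl fJ.
rewrite !pr_pr //; last exact: factorI.
congr pr; apply/funext => s; apply/propext; have := dis s; have := factorS fK.
by rewrite /compl; move/(_ s); tauto.
Qed.

Lemma pr_words J (ws : seq W) : factor J ->
  (forall w, w \in ws -> exists2 l, word_for S w l & forall s, s \in l -> J s) ->
  forall w, w \in ws -> pr J w = w.
Proof.
move=> fJ H w /H [l [_ ->] lJ].
elim: l lJ => [|s l IH] lJ; first by rewrite big_nil pr1.
rewrite big_cons (prM fJ) (pr_in fJ) ?IH // => [t tl|].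
  by apply: lJ; rewrite inE tl orbT.
by apply: lJ; rewrite inE eqxx.
Qed.

Lemma gen_predP J w : factor J -> reflect (pr J w = w) (gen_pred J w).
Proof.
move=> fJ; apply: (iffP (asboolP _)).
  elim=> {w} [|s Js|x y _ ex _ ey|x _ ex].
  - exact: pr1.
  - exact: pr_in.
  - by rewrite prM // ex ey.
  - by rewrite prV // ex.
move: w; apply: (pr_ind fJ); first exact: generated1.
move=> s w Js _ _ gw; apply: generatedM gw; exact: generated_incl.
Qed.

End Coxeter.

(** ** The subgroup generated by a factor as a Coxeter group of its own *)

Section FactorGroup.
Variables (W : groupType) (S J : W -> Prop).
Hypotheses (cox : coxeter_system S) (fJ : factor S J).
Local Notation G := (gen_group J).
Local Notation SG := (@gen_group_gens W J).

Lemma val_pr (g : G) : pr S J (val g) = val g.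
Proof. by apply/(gen_predP cox); last exact: (valP g). Qed.

Lemma lift_pr w : pr S J w = w -> exists g : G, val g = w.
Proof. by move/(gen_predP cox w fJ) => gw; exists (Sub w gw); rewrite SubK. Qed.

Lemma gval1 : val (1%g : G) = 1%g.
Proof. exact: val1. Qed.

Lemma gvalM (x y : G) : val (x * y)%g = (val x * val y)%g.
Proof. exact: valM. Qed.

Lemma gvalV (x : G) : val (x^-1)%g = (val x)^-1%g.
Proof. exact: (gmulfV (val : G -> W)). Qed.

Lemma gen_word (g : G) : exists2 l, word_for SG g l & size l = ell S (val g).
Proof.
suff: forall w, pr S J w = w -> forall g : G, val g = w ->
    exists2 l, word_for SG g l & size l = ell S (val g).
  by move/(_ (val g) (val_pr g) g erefl).
move: g => _; apply: (pr_ind cox fJ) => [|s w Js pw lt IH] g eg.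
  have -> : g = 1%g by apply: val_inj; rewrite eg gval1.
  by exists [::]; [apply: word_nil | rewrite gval1 ell1].
have [g' eg'] := lift_pr pw; have [l wl sl] := IH g' eg'.
have [s' es'] : exists s' : G, val s' = s.
  by apply: lift_pr; apply: pr_in.
exists (s' :: l).
  have -> : g = (s' * g')%g by apply: val_inj; rewrite gvalM eg es' eg'.
  by apply: word_cons => //; rewrite /gen_group_gens es'.
rewrite /= sl eg eg'; have := ell_sl cox w (factorS fJ Js).
by lia.
Qed.

Lemma ell_gen (g : G) : ell SG g = ell S (val g).
Proof.
have [l wl sl] := gen_word g; apply/eqP; rewrite eqn_leq -{1}sl (ell_le wl).
have [k [kS kE] <-] := ell_min wl; rewrite -(size_map val); apply: ell_le.
split=> [s /mapP[s' /kS Js' ->]|]; first exact: (factorS fJ Js').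
rewrite kE big_map; elim: (k) => [|t r IH]; first by rewrite !big_nil gval1.
by rewrite !big_cons gvalM IH.
Qed.

Lemma bruhat_le_lift u w : bruhat_le S u w -> forall x y : G,
  val x = pr S J u -> val y = pr S J w -> bruhat_le SG x y.
Proof.
elim=> {u w} [u w [t [[z [s [Ss ->]]] -> lt]]|u|u v w _ IH1 _ IH2] x y ex ey.
- have [Js|nJs] := EM (J s); last first.
    suff -> : x = y by exact: rt_refl.
    apply: val_inj; rewrite ex ey !(prM cox fJ) (prV cox fJ).
    by rewrite (pr_out cox fJ Ss nJs) mulg1 mulgV mul1g.
  have [z' ez'] := lift_pr (prK cox fJ z).
  have [s' es'] := lift_pr (pr_in cox fJ Js).
  apply: rt_step; exists (z' * s' * z'^-1)%g; split.
  + by exists z', s'; split=> //; rewrite /gen_group_gens es'.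
  + apply: val_inj; rewrite !gvalM gvalV ez' es' ex ey.
    by rewrite !(prM cox fJ) (prV cox fJ) (pr_in cox fJ Js).
  + rewrite !ell_gen ex ey; move: lt.
    rewrite (ell_split cox fJ u) (ell_split cox fJ (_ * u)%g).
    have fJ' := factor_compl fJ.
    rewrite !(prM cox fJ') (prV cox fJ') (pr_compl_in cox fJ Js) mulg1 mulgV mul1g.
    by rewrite ltn_add2r.
- suff -> : x = y by exact: rt_refl.
  by apply: val_inj; rewrite ex ey.
have [z ez] := lift_pr (prK cox fJ v).
exact: rt_trans (IH1 x z ex ez) (IH2 z y ez ey).
Qed.

Lemma bruhat_le_gen (x y : G) :
  bruhat_le SG x y <-> bruhat_le S (val x) (val y).
Proof.
split=> [|le]; last by apply: (bruhat_le_lift le); rewrite val_pr.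
elim=> {x y} [x y [t [[z [s [Js ->]]] -> lt]]|x|x y z _ IH1 _ IH2].
- apply: rt_step; exists (val (z * s * z^-1)%g); split.
  + exists (val z), (val s); split; first exact: (factorS fJ Js).
    by rewrite !gvalM gvalV.
  + by rewrite gvalM.
  + by rewrite -!ell_gen.
- exact: rt_refl.
- exact: rt_trans IH1 IH2.
Qed.

Lemma bruhat_lt_gen (x y : G) :
  bruhat_lt SG x y <-> bruhat_lt S (val x) (val y).
Proof.
split=> -[le ne]; split; try exact/bruhat_le_gen.
  by move=> /val_inj.
by move=> e; apply: ne; rewrite e.
Qed.

End FactorGroup.

(** ** Components and diagram automorphisms *)

Section Components.
Variables (W : groupType) (S : W -> Prop) (star : W -> W).
Hypotheses (cox : coxeter_system S) (st : preserving_involution S star).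

Lemma starM : {morph star : x y / (x * y)%g}. Proof. by case: st. Qed.
Lemma starK : involutive star. Proof. by case: st. Qed.
Lemma star_S s : S (star s) <-> S s.
Proof. by case: st => _ _ h; apply: iff_sym. Qed.
Lemma star1 : star 1%g = 1%g. Proof. exact: morph_one starM. Qed.
Lemma starV : {morph star : x / (x^-1)%g}. Proof. exact: morph_inv starM. Qed.

Lemma ell_star w : ell S (star w) = ell S w.
Proof.
suff le u : (ell S (star u) <= ell S u)%N.
  by apply/eqP; rewrite eqn_leq le -{1}[w]starK le.
have [l [lS ->] <-] := ell_word cox u; rewrite -(size_map star); apply: ell_le.
split=> [s /mapP[s' /lS Ss' ->]|]; first exact/star_S.
rewrite big_map; elim: (l) => [|t r IH]; first by rewrite !big_nil star1.
by rewrite !big_cons starM IH.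
Qed.

Definition star_set (J : W -> Prop) : W -> Prop := fun s => J (star s).

Lemma factor_star J : factor S J -> factor S (star_set J).
Proof.
move=> [JS JC]; split=> [s /JS/star_S//|s t Js St nJt].
apply: (can_inj starK); rewrite !starM; apply: JC => //; exact/star_S.
Qed.

Lemma pr_star J w : factor S J -> pr S (star_set J) (star w) = star (pr S J w).
Proof.
move=> fJ; have fJ' := factor_star fJ.
apply: (morph_eq cox (f := fun w => pr S (star_set J) (star w))
  (g := fun w => star (pr S J w))) => [x y|x y|s Ss].
- by rewrite starM (prM cox fJ').
- by rewrite (prM cox fJ) starM.
have [Js|nJs] := EM (J s).
  by rewrite (pr_in cox fJ Js) (pr_in cox fJ') // /star_set starK.
rewrite (pr_out cox fJ Ss nJs) star1 (pr_out cox fJ') //; first exact/star_S.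
by rewrite /star_set starK.
Qed.

Definition comp (s : W) : W -> Prop := clos_refl_trans W (diagram_edge S) s.

Lemma diagram_edge_sym s t : diagram_edge S s t -> diagram_edge S t s.
Proof.
move=> [Ss St n3]; split=> // n /n3 ne e; apply: ne.
have := congr1 (fun x => x^-1)%g e.
by rewrite invg1 -expVgn invgM (genVg cox Ss) (genVg cox St).
Qed.

Lemma comp_sym s t : comp s t -> comp t s.
Proof.
elim=> {s t} [s t e|s|s t u _ IH1 _ IH2].
- by apply: rt_step; apply: diagram_edge_sym.
- exact: rt_refl.
- exact: rt_trans IH2 IH1.
Qed.

Lemma comp_trans s t u : comp s t -> comp t u -> comp s u.
Proof. exact: rt_trans. Qed.

Lemma comp_S s t : S s -> comp s t -> S t.
Proof.
by move=> Ss c; move: Ss; elim: c => {s t} [s t []|//|s t u _ IH1 _ IH2 /IH1].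
Qed.

Lemma noedge_comm s t : S s -> S t -> ~ diagram_edge S s t -> s <> t ->
  (s * t = t * s)%g.
Proof.
move=> Ss St ne nst; apply: contrapT => nc; apply: ne; split=> // -[|[|[|n]]] // _.
  rewrite expg1 => e; apply: nst.
  by rewrite -[s](gengK cox St) e mul1g.
rewrite expg2 => e; apply: nc.
have := mulg1_eq e; rewrite invgM (genVg cox Ss) (genVg cox St) => ->.
by [].
Qed.

Lemma edge_ncomm s t : diagram_edge S s t -> (s * t <> t * s)%g.
Proof.
move=> [Ss St /(_ 2 isT)]; rewrite expg2 => ne e; apply: ne.
by rewrite {2}e mulgA (gengK cox St) (cox_invol cox).
Qed.

Lemma factor_comp s : S s -> factor S (comp s).
Proof.
move=> Ss; split=> [t|t u ct Su ncu]; first exact: comp_S.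
apply: noedge_comm => // [|e|e]; first exact: comp_S ct.
  by apply: ncu; apply: comp_trans ct _; apply: rt_step.
by apply: ncu; rewrite -e.
Qed.

Lemma factor_comp_closed J s t : factor S J -> J s -> comp s t -> J t.
Proof.
move=> [JS JC] Js c; move: Js; elim: c => {s t} [s t e|//|s t u _ IH1 _ IH2 /IH1//].
move=> Js; apply: contrapT => nJt; apply: (edge_ncomm e); apply: JC => //.
by case: e.
Qed.

Lemma comp_star s t : comp s t -> comp (star s) (star t).
Proof.
elim=> {s t} [s t [Ss St n3]|s|s t u _ IH1 _ IH2].
- apply: rt_step; split; try exact/star_S.
  move=> n /n3 ne e; apply: ne; apply: (can_inj starK); rewrite star1 -e -starM.
  elim: n {e} => [|n IH]; first exact: star1.
  by rewrite expgS [LHS]starM IH -expgS.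
- exact: rt_refl.
- exact: rt_trans IH1 IH2.
Qed.

(** Finitely many elements of [W] involve finitely many generators.  The orbit of
    the component of each of these generators is a stable component or a pair of
    exchanged components, and the orbits are added one at a time. *)
Lemma factor_induction (Phi : (W -> Prop) -> Prop) :
  Phi (fun=> False) ->
  (forall s, S s -> star_set (comp s) = comp s -> Phi (comp s)) ->
  (forall s, S s -> (forall t, comp s t -> ~ comp s (star t)) ->
     Phi (fun t => comp s t \/ star_set (comp s) t)) ->
  (forall J K, factor S J -> factor S K -> star_set J = J -> star_set K = K ->
     (forall s, J s -> ~ K s) -> Phi J -> Phi K -> Phi (fun s => J s \/ K s)) ->
  forall ws : seq W, exists J, [/\ factor S J, star_set J = J, Phi J
    & forall w, w \in ws -> pr S J w = w].
Proof.
move=> P0 P1 P2 PU ws.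
have orbit s : S s -> exists K, [/\ factor S K, star_set K = K, Phi K, K s
    & forall t, K t -> comp s t \/ comp s (star t)].
  move=> Ss; have fs := factor_comp Ss; have fs' := factor_star fs.
  have [cs|ncs] := EM (comp s (star s)).
    have e : star_set (comp s) = comp s.
      apply/funext => t; apply/propext; rewrite /star_set; split=> c.
        by apply: (comp_trans cs); have := comp_star c; rewrite starK.
      by apply: (comp_trans cs); apply: comp_star.
    exists (comp s); split=> //; first exact: P1.
      exact: rt_refl.
    by left.
  have dis t : comp s t -> ~ comp s (star t).
    move=> c c'; apply: ncs; apply: comp_trans c' _; apply: comp_star.
    exact: comp_sym.
  exists (fun t => comp s t \/ star_set (comp s) t); split.
  - exact: factorU.
  - apply/funext => t; apply/propext; rewrite /star_set starK.
    by split=> -[]; [right | left | right | left].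
  - exact: P2.
  - by left; apply: rt_refl.
  - by move=> t.
have letters (l : seq W) : (forall s, s \in l -> S s) ->
    exists J, [/\ factor S J, star_set J = J, Phi J & forall s, s \in l -> J s].
  elim: l => [_|s l IH lS].
    exists (fun=> False); split=> //; split=> //.
  have [t tl|J [fJ sJ PJ lJ]] := IH.
    by apply: lS; rewrite inE tl orbT.
  have Ss : S s by apply: lS; rewrite inE eqxx.
  have [Js|nJs] := EM (J s).
    by exists J; split=> // t; rewrite inE => /orP[/eqP ->|/lJ].
  have [K [fK sK PK Ks Ksub]] := orbit s Ss.
  exists (fun t => J t \/ K t); split.
  - exact: factorU.
  - by rewrite -[LHS]/(fun t => star_set J t \/ star_set K t) sJ sK.
  - apply: PU => // t Jt /Ksub [c|c]; apply: nJs.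
      exact: factor_comp_closed fJ Jt (comp_sym c).
    by apply: (factor_comp_closed fJ _ (comp_sym c)); rewrite -sJ /star_set starK.
  - by move=> t; rewrite inE => /orP[/eqP ->|/lJ]; [right | left].
have [l lS lw] : exists2 l : seq W, (forall s, s \in l -> S s) &
    forall w, w \in ws -> exists2 k, word_for S w k & forall s, s \in k -> s \in l.
  elim: ws => [|w ws [l lS lw]]; first by exists [::].
  have [k wk _] := ell_word cox w; exists (k ++ l).
    by move=> s; rewrite mem_cat => /orP[/(proj1 wk)|/lS].
  move=> u; rewrite inE => /orP[/eqP ->|/lw [k' wk' sub]].
    by exists k => // s sk; rewrite mem_cat sk.
  by exists k' => // s /sub sl; rewrite mem_cat sl orbT.
have [J [fJ sJ PJ lJ]] := letters l lS; exists J; split=> //.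
apply: (pr_words cox fJ) => w /lw [k wk sub]; exists k => // s /sub.
exact: lJ.
Qed.

End Components.

(** * Linear spans *)

Section Span.
Variables (V : lmodType Zv) (K : Type) (b : K -> V).

Inductive lspan (D : K -> Prop) : V -> Prop :=
| lspan0 : lspan D 0
| lspan_add a k x : D k -> lspan D x -> lspan D (a *: b k + x).

Lemma lspanD D x y : lspan D x -> lspan D y -> lspan D (x + y).
Proof.
move=> sx sy; elim: sx => [|a k {}x Dk _ IH]; first by rewrite add0r.
by rewrite -addrA; apply: lspan_add.
Qed.

Lemma lspanZ D (a : Zv) x : lspan D x -> lspan D (a *: x).
Proof.
elim=> [|c k {}x Dk _ IH]; first by rewrite scaler0; apply: lspan0.
by rewrite scalerDr scalerA; apply: lspan_add.
Qed.

Lemma lspan_basis (D : K -> Prop) k : D k -> lspan D (b k).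
Proof.
by move=> Dk; rewrite -[b k]scale1r -[_ *: _]addr0; apply: lspan_add (lspan0 D).
Qed.

Lemma lspanS (D D' : K -> Prop) x :
  (forall k, D k -> D' k) -> lspan D x -> lspan D' x.
Proof.
move=> sub; elim=> [|a k {}x Dk _ IH]; first exact: lspan0.
by apply: lspan_add => //; apply: sub.
Qed.

End Span.

(** * Hecke algebras *)

Section Hecke.
Variables (W : groupType) (S : W -> Prop).
Hypothesis cox : coxeter_system S.
Variables (V : lmodType Zv) (t : W -> V).
Hypothesis t_gen : forall x, lspan t (fun=> True) x.
Local Notation H := V.
Local Notation ell := (ell S).
Local Notation pr := (pr S).

Definition inW (J : W -> Prop) (w : W) := pr J w = w.

Lemma inWM J x y : factor S J -> inW J x -> inW J y -> inW J (x * y)%g.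
Proof. by move=> fJ ex ey; rewrite /inW (prM cox fJ) ex ey. Qed.

Lemma inW_in J s : factor S J -> J s -> inW J s.
Proof. by move=> fJ Js; apply: (pr_in cox fJ). Qed.

Lemma inW1 J : factor S J -> inW J 1%g.
Proof. by move=> fJ; apply: (pr1 cox fJ). Qed.

Lemma inWpr J w : factor S J -> inW J (pr J w).
Proof. by move=> fJ; apply: (prK cox fJ). Qed.

Lemma inW_compl1 J x : factor S J -> inW J x -> pr (compl S J) x = 1%g.
Proof. by move=> fJ <-; apply: pr_compl_pr. Qed.

Lemma inW_compl2 J y : factor S J -> inW (compl S J) y -> pr J y = 1%g.
Proof. by move=> fJ <-; apply: pr_pr_compl. Qed.

Lemma factorT : factor S S.
Proof. by split. Qed.

Lemma inWT w : inW S w.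
Proof.
have fT := factorT.
apply: (morph_eq cox (f := pr S) (g := id)) => // [|s Ss]; first exact: prM.
exact: pr_in.
Qed.

Lemma ell_mul_le x y : (ell (x * y)%g <= ell x + ell y)%N.
Proof.
have [l wl <-] := ell_word cox x; have [k wk <-] := ell_word cox y.
by rewrite -size_cat; apply: ell_le; apply: word_cat.
Qed.

Lemma ell_sr w s : S s ->
  ell (w * s)%g = (ell w).+1 \/ ell w = (ell (w * s)%g).+1.
Proof.
move=> Ss; have := ell_sl cox (w^-1)%g Ss.
by rewrite -(ellV cox (s * _)%g) invgM invgK (genVg cox Ss) (ellV cox w).
Qed.

Lemma ell_gen1 s : S s -> ell s = 1%N.
Proof.
by move=> Ss; have := ell_sl cox 1%g Ss; rewrite mulg1 ell1 => -[].
Qed.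

(** An abstract module [V] spanned by the family [t] in the place of the free
    module: the arguments of this part are independent of its construction. *)
Record hecke_on (u : Zv) (mul : V -> V -> V) : Prop := HeckeOn {
  heckeA : associative mul;
  hecke1l : left_id (t 1%g) mul;
  hecke1r : right_id (t 1%g) mul;
  heckeDl : left_distributive mul +%R;
  heckeDr : right_distributive mul +%R;
  heckeZl : forall (a : Zv) (x y : V), mul (a *: x) y = a *: mul x y;
  heckeZr : forall (a : Zv) (x y : V), mul x (a *: y) = a *: mul x y;
  t_up : forall s w, S s -> (ell w < ell (s * w)%g)%N ->
    mul (t s) (t w) = t (s * w)%g;
  t_down : forall s w, S s -> (ell (s * w)%g < ell w)%N ->
    mul (t s) (t w) = u *: t (s * w)%g + (u - 1) *: t w }.

Record hecke_bar_on (mul : V -> V -> V) (bar : V -> V) : Prop := HeckeBarOn {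
  heckebD : {morph bar : x y / x + y};
  heckebM : {morph bar : x y / mul x y};
  heckeb_v : forall n : int, bar (vpow int n *: t 1%g) = vpow int (- n) *: t 1%g;
  heckeb_t : forall w, mul (bar (t w)) (t w^-1%g) = t 1%g }.

Section Algebra.
Variables (u u' : Zv).
Hypothesis uK : u' * u = 1.
Variable mul : H -> H -> H.
Hypothesis hecke : hecke_on u mul.

Let mulA := heckeA hecke.
Let mul1l := hecke1l hecke.
Let mul1r := hecke1r hecke.
Let mulDl := heckeDl hecke.
Let mulDr := heckeDr hecke.
Let mulZl := heckeZl hecke.
Let mulZr := heckeZr hecke.
Let t_up := t_up hecke.
Let t_down := t_down hecke.

Lemma hecke_mul0l x : mul 0 x = 0.
Proof. by rewrite -(scale0r (0 : H)) mulZl !scale0r. Qed.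

Lemma hecke_mul0r x : mul x 0 = 0.
Proof. by rewrite -(scale0r (0 : H)) mulZr !scale0r. Qed.

Lemma t_quad s : S s -> mul (t s) (t s) = u *: t 1%g + (u - 1) *: t s.
Proof.
move=> Ss; have lt : (ell (s * s)%g < ell s)%N.
  by rewrite (cox_invol cox Ss) ell1 (ell_gen1 Ss).
by rewrite (t_down Ss lt) (cox_invol cox Ss).
Qed.

Lemma tM x y : ell (x * y)%g = (ell x + ell y)%N -> mul (t x) (t y) = t (x * y)%g.
Proof.
move: x y; apply: (cox_ind cox) => [y _|s x Ss lt IH y]; first by rewrite mul1g mul1l.
move=> e0; have e : ell (s * (x * y))%g = (ell (s * x)%g + ell y)%N.
  by rewrite mulgA.
have ex : ell (s * x)%g = (ell x).+1 by have := ell_sl cox x Ss; lia.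
have le := ell_mul_le x y; have sl := ell_sl cox (x * y)%g Ss.
have exy : ell (x * y)%g = (ell x + ell y)%N by lia.
have lt2 : (ell (x * y)%g < ell (s * (x * y))%g)%N by lia.
by rewrite -(t_up Ss lt) -mulA (IH _ exy) (t_up Ss lt2) mulgA.
Qed.

Lemma t_upr s w : S s -> (ell w < ell (w * s)%g)%N ->
  mul (t w) (t s) = t (w * s)%g.
Proof.
move=> Ss lt; apply: tM; rewrite (ell_gen1 Ss) addn1.
by case: (ell_sr w Ss) => // e; rewrite e ltnNge leqnSn in lt.
Qed.

Lemma t_downr s w : S s -> (ell (w * s)%g < ell w)%N ->
  mul (t w) (t s) = u *: t (w * s)%g + (u - 1) *: t w.
Proof.
move=> Ss lt; have e : t w = mul (t (w * s)%g) (t s).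
  by rewrite (t_upr Ss) (gengK cox Ss).
by rewrite {1}e -mulA (t_quad Ss) mulDr mulZr mulZr mul1r -e.
Qed.

Hypothesis t_free : forall (a : Zv) x y, a != 0 -> a *: t x = a *: t y -> x = y.

(** The exchange condition follows from the existence of the Hecke algebra:
    t_s (t_w t_r) and (t_s t_w) t_r are equal, and they are seen to differ by
    (u - 1)(t_{wr} - t_{sw}). *)
Lemma exchange_up s w r : u != 1 -> S s -> S r ->
  ell (s * w * r)%g = ell w -> ell (s * w)%g = (ell w).+1 ->
  ell (w * r)%g = (ell w).+1 -> (s * w = w * r)%g.
Proof.
move=> u1 Ss Sr e0 e1 e2.
have := mulA (t s) (t w) (t r).
rewrite (t_upr Sr); last by rewrite e2.
rewrite (t_down Ss); last by rewrite mulgA e0 e2.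
rewrite (t_up Ss); last by rewrite e1.
rewrite (t_downr Sr); last by rewrite e0 e1.
rewrite mulgA => /addrI /t_free e; apply/esym/e.
by rewrite subr_eq0.
Qed.

Lemma exchange s w r : u != 1 -> S s -> S r ->
  ell (s * w * r)%g = ell w -> ell (s * w)%g = ell (w * r)%g -> (s * w = w * r)%g.
Proof.
move=> u1 Ss Sr e0 e1; have sl := ell_sl cox w Ss; have sr := ell_sr w Sr.
have [up|dn] := ltnP (ell w) (ell (s * w)%g); first by apply: exchange_up => //; lia.
have : (s * (s * w) = s * w * r)%g.
  apply: exchange_up => //; rewrite ?(genKg cox Ss) //; lia.
by rewrite (genKg cox Ss) => e; rewrite [in RHS]e (gengK cox Sr).
Qed.

Section Induction.
Variables (J : W -> Prop) (Q : H -> Prop).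
Hypothesis fJ : factor S J.

Lemma hecke_ind : Q 0 ->
  (forall (a : Zv) (x y : H), Q x -> Q y -> Q (a *: x + y)) ->
  (forall x y, Q x -> Q y -> Q (mul x y)) -> Q (t 1%g) ->
  (forall s, J s -> Q (t s)) -> forall h, lspan t (inW J) h -> Q h.
Proof.
move=> Q0 QD QM Q1 QS h; elim=> [//|a w m Jw _ Qm].
apply: QD Qm; move: w Jw; apply: (pr_ind cox fJ) => [//|s w Js _ lt Qw].
by rewrite -(t_up (factorS fJ Js) lt); apply: QM Qw; apply: QS.
Qed.

End Induction.

Lemma hecke_ind_all (Q : H -> Prop) :
  Q 0 -> (forall (a : Zv) (x y : H), Q x -> Q y -> Q (a *: x + y)) ->
  (forall x y, Q x -> Q y -> Q (mul x y)) -> Q (t 1%g) ->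
  (forall s, S s -> Q (t s)) -> forall h, Q h.
Proof.
move=> Q0 QD QM Q1 QS h; apply: (hecke_ind factorT Q0 QD QM Q1 QS).
by apply: lspanS (t_gen h) => w _; apply: inWT.
Qed.

Lemma spanned_tM J s w : factor S J -> J s -> inW J w ->
  lspan t (inW J) (mul (t s) (t w)).
Proof.
move=> fJ Js Jw; have Ss := factorS fJ Js; have Jsw := inWM fJ (inW_in fJ Js) Jw.
case: (ell_sl cox w Ss) => e.
  by rewrite (t_up Ss) ?e; [apply: lspan_basis | exact: ltnSn].
rewrite (t_down Ss) ?e; last exact: ltnSn.
by apply: lspanD; apply: lspanZ; apply: lspan_basis.
Qed.

Lemma spanned_mul J x y : factor S J ->
  lspan t (inW J) x -> lspan t (inW J) y -> lspan t (inW J) (mul x y).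
Proof.
move=> fJ sx; move: x sx y; apply: (hecke_ind fJ).
- by move=> y _; rewrite hecke_mul0l; apply: lspan0.
- move=> a x y IHx IHy z sz; rewrite mulDl mulZl; apply: lspanD; last exact: IHy.
  by apply: lspanZ; apply: IHx.
- by move=> x y IHx IHy z sz; rewrite -mulA; apply: IHx; apply: IHy.
- by move=> y; rewrite mul1l.
move=> s Js y; elim=> [|a w y' Jw _ IH].
  by rewrite hecke_mul0r; apply: lspan0.
rewrite mulDr mulZr; apply: lspanD IH; apply: lspanZ.
exact: spanned_tM.
Qed.

Lemma mul_compl J x y : factor S J -> inW J x -> inW (compl S J) y ->
  mul (t x) (t y) = t (x * y)%g.
Proof.
move=> fJ ex ey; apply: tM; rewrite (ell_split cox fJ (x * y)%g).
rewrite (prM cox fJ) (prM cox (factor_compl fJ)) ex ey.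
by rewrite (inW_compl1 fJ ex) (inW_compl2 fJ ey) mulg1 mul1g.
Qed.

(** ** The bar involution *)

Section Bar.
Variable bar : H -> H.
Hypothesis hbar : hecke_bar_on mul bar.
Let barD := heckebD hbar.
Let barM := heckebM hbar.

Lemma hecke_bar0 : bar 0 = 0.
Proof. by apply: (@addrI _ (bar 0)); rewrite -barD !addr0. Qed.

Lemma hecke_barN x : bar (- x) = - bar x.
Proof. by apply/eqP; rewrite -subr_eq0 opprK -barD addNr hecke_bar0. Qed.

Lemma hecke_bar1 : bar (t 1%g) = t 1%g.
Proof. by have := heckeb_v hbar 0; rewrite oppr0 scale1r. Qed.

(** The bar operator is given on the multiples v^n t_1 of the unit, and all
    scalars are obtained from these by addition. *)
Lemma hecke_barZ (a : Zv) (x : H) : bar (a *: x) = lbar a *: bar x.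
Proof.
suff H1 (b : Zv) : bar (b *: t 1%g) = lbar b *: t 1%g.
  by rewrite -{1}[x]mul1l -mulZl barM H1 mulZl mul1l.
elim/laurent_ind: b => [|b c IHb IHc|c i].
- by rewrite lbar0 !scale0r hecke_bar0.
- by rewrite scalerDl barD IHb IHc lbarD scalerDl.
have nat n : bar (lmon n%:Z i *: t 1%g) = lbar (lmon n%:Z i) *: t 1%g.
  elim: n => [|n IH].
    have -> : lmon 0%:Z i = 0 by exact: monalgU0.
    by rewrite lbar0 !scale0r hecke_bar0.
  have -> : lmon n.+1%:Z i = vpow int i + lmon n%:Z i by exact: (monalgUD i 1 n%:Z).
  by rewrite scalerDl barD IH lbarD scalerDl (heckeb_v hbar) lbar_vpow.
case: (intP c) => [|n|n]; [exact: nat | exact: nat |].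
have -> : lmon (- n.+1%:Z) i = - lmon n.+1%:Z i by exact: monalgUN.
by rewrite scaleNr hecke_barN lbarN scaleNr nat.
Qed.

Lemma hecke_bar_lin (a : Zv) (x y : H) : bar (a *: x + y) = lbar a *: bar x + bar y.
Proof. by rewrite barD hecke_barZ. Qed.

(** The inverse of t_s is determined by the quadratic relation. *)
Lemma bar_gen s : S s -> bar (t s) = u' *: t s + (u' - 1) *: t 1%g.
Proof.
move=> Ss; have := heckeb_t hbar s; rewrite (genVg cox Ss) => e.
pose X := u' *: t s + (u' - 1) *: t 1%g.
have eX : mul (t s) X = t 1%g.
  rewrite /X mulDr !mulZr (t_quad Ss) mul1r scalerDr !scalerA uK scale1r.
  rewrite -addrA -scalerDl mulrBr uK mulr1.
  have -> : 1 - u' + (u' - 1) = 0 by ring.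
  by rewrite scale0r addr0.
by rewrite -[RHS]/X -[LHS]mul1r -{1}eX mulA e mul1l.
Qed.

Lemma spanned_bar J x : factor S J -> lspan t (inW J) x -> lspan t (inW J) (bar x).
Proof.
move=> fJ; apply: (hecke_ind (Q := fun x => lspan t (inW J) (bar x)) fJ).
- by rewrite hecke_bar0; apply: lspan0.
- move=> a {}x y sx sy; rewrite hecke_bar_lin; apply: lspanD sy.
  exact: lspanZ.
- by move=> {}x y sx sy; rewrite barM; apply: spanned_mul.
- by rewrite hecke_bar1; apply: lspan_basis; apply: inW1.
move=> s Js; rewrite (bar_gen (factorS fJ Js)).
by apply: lspanD; apply: lspanZ; apply: lspan_basis;
  [apply: inW_in | apply: inW1].
Qed.

End Bar.

End Algebra.

(** ** Change of the Hecke parameter *)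

Section ChangeParameter.
Variables (rho : Zv -> Zv) (u u' : Zv).
Hypotheses (rhoD : {morph rho : a b / a + b}) (rho0 : rho 0 = 0).
Hypotheses (rhoM : {morph rho : a b / a * b}) (rho1 : rho 1 = 1).
Hypothesis rhoN : {morph rho : a / - a}.
Hypothesis uK : u' * u = 1.
Variables mul mul' : H -> H -> H.
Hypothesis hecke : hecke_on u mul.
Hypothesis hecke' : hecke_on (rho u) mul'.
Variable phi : V -> V.
Hypothesis phi_lin : forall (a : Zv) (x y : V),
  phi (a *: x + y) = rho a *: phi x + phi y.
Hypothesis phi_t : forall w, phi (t w) = t w.

Lemma phi0 : phi 0 = 0.
Proof.
have := phi_lin 1 0 0; rewrite scaler0 addr0 rho1 scale1r => e.
by apply: (@addrI _ (phi 0)); rewrite -e addr0.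
Qed.

Lemma phiZ (a : Zv) (x : V) : phi (a *: x) = rho a *: phi x.
Proof. by rewrite -[_ *: x]addr0 phi_lin phi0 addr0. Qed.

Lemma phiD (x y : V) : phi (x + y) = phi x + phi y.
Proof. by rewrite -{1}[x]scale1r phi_lin rho1 scale1r. Qed.

(** It suffices to compare left multiplications by the t_s, whose coefficients
    are polynomials in the parameter. *)
Lemma mapc_mul x y : phi (mul x y) = mul' (phi x) (phi y).
Proof.
move: x y; apply: (hecke_ind_all hecke).
- by move=> y; rewrite (hecke_mul0l hecke) phi0 (hecke_mul0l hecke').
- move=> a x y IHx IHy z; rewrite (heckeDl hecke) (heckeZl hecke).
  rewrite !phiD !phiZ IHx IHy.
  by rewrite (heckeDl hecke') (heckeZl hecke').
- by move=> x y IHx IHy z; rewrite -(heckeA hecke) !IHx IHy (heckeA hecke').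
- by move=> y; rewrite (hecke1l hecke) phi_t (hecke1l hecke').
move=> s Ss y; rewrite phi_t.
elim: (t_gen y) => [|a w {}y _ _ IH].
  by rewrite (hecke_mul0r hecke) phi0 (hecke_mul0r hecke').
rewrite (heckeDr hecke) (heckeZr hecke) !phiD.
rewrite !phiZ (heckeDr hecke') (heckeZr hecke') IH.
congr (_ *: _ + _); rewrite phi_t.
case: (ell_sl cox w Ss) => e.
  have lt : (ell w < ell (s * w)%g)%N by rewrite e.
  by rewrite (t_up hecke Ss lt) (t_up hecke' Ss lt) phi_t.
have lt : (ell (s * w)%g < ell w)%N by rewrite e.
rewrite (t_down hecke Ss lt) (t_down hecke' Ss lt).
by rewrite phiD !phiZ !phi_t rhoD rhoN rho1.
Qed.

Variables bar bar' : H -> H.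
Hypothesis hbar : hecke_bar_on mul bar.
Hypothesis hbar' : hecke_bar_on mul' bar'.
Hypothesis rho_lbar : forall a, rho (lbar a) = lbar (rho a).

Lemma mapc_bar x : phi (bar x) = bar' (phi x).
Proof.
have uK' : rho u' * rho u = 1 by rewrite -rhoM uK.
move: x; apply: (hecke_ind_all hecke).
- by rewrite phi0 (hecke_bar0 hbar) (hecke_bar0 hbar') phi0.
- move=> a x y IHx IHy; rewrite (hecke_bar_lin hecke hbar).
  rewrite !phiD !phiZ (hecke_bar_lin hecke' hbar').
  by rewrite IHx IHy rho_lbar.
- move=> x y IHx IHy; rewrite (heckebM hbar) !mapc_mul IHx IHy.
  by rewrite (heckebM hbar').
- by rewrite (hecke_bar1 hbar) phi_t (hecke_bar1 hbar').
move=> s Ss; rewrite (bar_gen uK hecke hbar Ss) phi_t.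
rewrite (bar_gen uK' hecke' hbar' Ss) phiD !phiZ.
by rewrite !phi_t rhoD rhoN rho1.
Qed.

End ChangeParameter.

(** ** The anti-automorphism t_w -> t_{star w^-1} *)

Section AntiAutomorphism.
Variables (star : W -> W) (st : preserving_involution S star).
Variables (u u' : Zv).
Hypothesis uK : u' * u = 1.
Variable mul : H -> H -> H.
Hypothesis hecke : hecke_on u mul.

Variable anti : V -> V.
Hypothesis anti_lin : forall (a : Zv) (x y : V),
  anti (a *: x + y) = a *: anti x + anti y.
Hypothesis anti_basis : forall w, anti (t w) = t (star w)^-1%g.

Lemma anti0 : anti 0 = 0.
Proof.
by have := anti_lin (-1) 0 0; rewrite scaler0 addr0 scaleN1r addNr.
Qed.

Lemma antiZ (a : Zv) (x : H) : anti (a *: x) = a *: anti x.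
Proof. by rewrite -[_ *: x]addr0 anti_lin anti0 addr0. Qed.

Lemma star_invK : involutive (fun w => (star w)^-1%g).
Proof. by move=> w; rewrite (starV st) invgK (starK st). Qed.

Lemma ell_star_inv w : ell (star w)^-1%g = ell w.
Proof. by rewrite (ellV cox) (ell_star cox st). Qed.

(** Left multiplication by t_s on t_w and right multiplication by the image of
    t_s on the image of t_w are given by the same formulas. *)
Lemma anti_mul x y : anti (mul x y) = mul (anti y) (anti x).
Proof.
move: x y; apply: (hecke_ind_all hecke).
- by move=> y; rewrite (hecke_mul0l hecke) anti0 (hecke_mul0r hecke).
- move=> a x y IHx IHy z; rewrite (heckeDl hecke) (heckeZl hecke).
  by rewrite !anti_lin IHx IHy (heckeDr hecke) (heckeZr hecke).
- by move=> x y IHx IHy z; rewrite -(heckeA hecke) !IHx !IHy (heckeA hecke).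
- move=> y; rewrite (hecke1l hecke) anti_basis (star1 st) invg1.
  by rewrite (hecke1r hecke).
move=> s Ss y; elim: (t_gen y) => [|a w {}y _ _ IH].
  by rewrite (hecke_mul0r hecke) anti0 (hecke_mul0l hecke).
rewrite (heckeDr hecke) (heckeZr hecke) !anti_lin IH.
rewrite (heckeDl hecke) (heckeZl hecke).
congr (_ *: _ + _); rewrite !anti_basis.
have Ss' : S (star s) by apply/(star_S st).
have sw : ((star w)^-1 * star s = (star (s * w))^-1)%g.
  by rewrite (starM st) invgM (genVg cox Ss').
rewrite (genVg cox Ss'); case: (ell_sl cox w Ss) => e.
  have lt : (ell w < ell (s * w)%g)%N by rewrite e.
  have lt' : (ell (star w)^-1 < ell ((star w)^-1 * star s))%N.
    by rewrite sw !ell_star_inv.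
  by rewrite (t_up hecke Ss lt) (t_upr hecke Ss' lt') sw anti_basis.
have lt : (ell (s * w)%g < ell w)%N by rewrite e.
have lt' : (ell ((star w)^-1 * star s) < ell (star w)^-1)%N.
  by rewrite sw !ell_star_inv.
rewrite (t_down hecke Ss lt) (t_downr hecke Ss' lt') sw.
by rewrite anti_lin anti_basis antiZ anti_basis.
Qed.

Variable bar : H -> H.
Hypothesis hbar : hecke_bar_on mul bar.

Lemma anti_bar x : anti (bar x) = bar (anti x).
Proof.
move: x; apply: (hecke_ind_all hecke).
- by rewrite (hecke_bar0 hbar) anti0 (hecke_bar0 hbar).
- move=> a x y IHx IHy; rewrite (hecke_bar_lin hecke hbar) !anti_lin.
  by rewrite (hecke_bar_lin hecke hbar) IHx IHy.
- move=> x y IHx IHy; rewrite (heckebM hbar) !anti_mul IHx IHy.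
  by rewrite (heckebM hbar).
- rewrite (hecke_bar1 hbar) anti_basis (star1 st) invg1.
  by rewrite (hecke_bar1 hbar).
move=> s Ss; have Ss' : S (star s) by apply/(star_S st).
rewrite anti_basis (genVg cox Ss') (bar_gen uK hecke hbar Ss).
rewrite (bar_gen uK hecke hbar Ss') anti_lin anti_basis antiZ anti_basis.
by rewrite (genVg cox Ss') (star1 st) invg1.
Qed.

End AntiAutomorphism.

End Hecke.

Section HeckeFactors.
Variables (W : groupType) (S J : W -> Prop).
Hypotheses (cox : coxeter_system S) (fJ : factor S J).
Variables (V : lmodType Zv) (t : W -> V) (u : Zv) (mul : V -> V -> V).
Hypothesis hecke : hecke_on S t u mul.
Local Notation pr := (pr S).
Local Notation spanJ := (lspan t (inW S J)).
Local Notation spanJ' := (lspan t (inW S (compl S J))).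

Lemma bilin_ind (P : V -> V -> Prop) :
  (forall y, P 0 y) -> (forall x, P x 0) ->
  (forall (a : Zv) x1 x y, P x1 y -> P x y -> P (a *: x1 + x) y) ->
  (forall (a : Zv) x y1 y, P x y1 -> P x y -> P x (a *: y1 + y)) ->
  (forall w w', inW S J w -> inW S (compl S J) w' -> P (t w) (t w')) ->
  forall x y, spanJ x -> spanJ' y -> P x y.
Proof.
move=> P0l P0r Pl Pr Pt x y sx sy; elim: sx => [|a w {}x Jw _ IHx]; first exact: P0l.
apply: Pl IHx; elim: sy => [|b w' {}y Jw' _ IHy]; first exact: P0r.
by apply: Pr IHy; apply: Pt.
Qed.

Lemma heckeZZ (a b : Zv) (x y : V) : mul (a *: x) (b *: y) = (a * b) *: mul x y.
Proof. by rewrite (heckeZl hecke) (heckeZr hecke) scalerA. Qed.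

Lemma span_comm x y : spanJ x -> spanJ' y -> mul x y = mul y x.
Proof.
move: x y; apply: bilin_ind.
- by move=> y; rewrite (hecke_mul0l hecke) (hecke_mul0r hecke).
- by move=> x; rewrite (hecke_mul0l hecke) (hecke_mul0r hecke).
- move=> a x1 x y e1 e2.
  by rewrite (heckeDl hecke) (heckeZl hecke) (heckeDr hecke) (heckeZr hecke) e1 e2.
- move=> a x y1 y e1 e2.
  by rewrite (heckeDl hecke) (heckeZl hecke) (heckeDr hecke) (heckeZr hecke) e1 e2.
move=> w w' Jw Jw'; rewrite (mul_compl cox hecke fJ Jw Jw').
have Jw2 : inW S (compl S (compl S J)) w by rewrite compl_compl.
rewrite (mul_compl cox hecke (factor_compl fJ) Jw' Jw2).
by rewrite -Jw -Jw' (pr_comm cox fJ).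
Qed.

Lemma mulACA_compl x x' y y' : spanJ y -> spanJ' x' ->
  mul (mul x x') (mul y y') = mul (mul x y) (mul x' y').
Proof.
move=> sy sx'; rewrite -!(heckeA hecke) !(heckeA hecke x') !(heckeA hecke y).
by rewrite (span_comm sy sx').
Qed.

Lemma coef_mul_compl (co : V -> W -> Zv) :
  (forall (a : Zv) x y w, co (a *: x + y) w = a * co x w + co y w) ->
  (forall w w', co (t w) w' = (w == w')%:R) ->
  forall x y, spanJ x -> spanJ' y ->
  forall w, co (mul x y) w = co x (pr J w) * co y (pr (compl S J) w).
Proof.
move=> coL cot.
have co0 w : co 0 w = 0.
  by have := coL (-1) 0 0 w; rewrite scaler0 addr0 mulN1r addNr.
apply: bilin_ind.
- by move=> y w; rewrite (hecke_mul0l hecke) !co0 mul0r.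
- by move=> x w; rewrite (hecke_mul0r hecke) !co0 mulr0.
- move=> a x1 x y e1 e2 w.
  by rewrite (heckeDl hecke) (heckeZl hecke) !coL e1 e2 mulrDl mulrA.
- move=> a x y1 y e1 e2 w.
  by rewrite (heckeDr hecke) (heckeZr hecke) !coL e1 e2 mulrDr mulrCA.
move=> w1 w2 J1 J2 w; rewrite (mul_compl cox hecke fJ J1 J2) !cot -natrM mulnb.
congr ((nat_of_bool _)%:R); apply/eqP/andP => [<-|[/eqP -> /eqP ->]].
  rewrite (prM cox fJ) (prM cox (factor_compl fJ)) J1 J2.
  by rewrite (inW_compl1 cox fJ J1) (inW_compl2 cox fJ J2) mulg1 mul1g !eqxx.
exact: pr_split.
Qed.

Lemma lin_mul_compl (L : V -> V) (c : W -> V) :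
  (forall (a : Zv) x y, L (a *: x + y) = a *: L x + L y) ->
  (forall w, L (t w) = c w) ->
  (forall w w', inW S J w -> inW S (compl S J) w' ->
     c (w * w')%g = mul (c w) (c w')) ->
  forall x y, spanJ x -> spanJ' y -> L (mul x y) = mul (L x) (L y).
Proof.
move=> LL Lt cM.
have L0 : L 0 = 0.
  by have := LL (-1) 0 0; rewrite scaler0 addr0 scaleN1r addNr.
apply: bilin_ind.
- by move=> y; rewrite (hecke_mul0l hecke) !L0 (hecke_mul0l hecke).
- by move=> x; rewrite (hecke_mul0r hecke) !L0 (hecke_mul0r hecke).
- move=> a x1 x y e1 e2.
  by rewrite (heckeDl hecke) (heckeZl hecke) !LL e1 e2 (heckeDl hecke) (heckeZl hecke).
- move=> a x y1 y e1 e2.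
  by rewrite (heckeDr hecke) (heckeZr hecke) !LL e1 e2 (heckeDr hecke) (heckeZr hecke).
by move=> w w' J1 J2; rewrite (mul_compl cox hecke fJ J1 J2) !Lt cM.
Qed.

End HeckeFactors.

(** * The Kazhdan-Lusztig basis *)

Lemma lspan_spanned (K : choiceType) (D : K -> Prop) (m : {malg Zv[K]}) :
  lspan (@basis K) D m -> spanned D m.
Proof.
intro sm; induction sm as [|a k x Dk _ IH]; first exact (@spanned0 K D).
have Z := @spannedD K D _ _ (@spannedZ K D a _ (spanned_basis Dk)) IH.
exact_no_check Z.
Qed.

Lemma spanned_lspan (K : choiceType) (D : K -> Prop) (m : {malg Zv[K]}) :
   spanned D m -> lspan (@basis K) D m.
Proof.
move=> sm; elim/spanned_ind: sm => [|a k {}m Dk _ IH].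
  exact: (lspan0 (@basis K) D).
exact (@lspan_add _ _ (@basis K) D a k m Dk IH).
Qed.

Lemma basis_gen (K : choiceType) (m : {malg Zv[K]}) :
  lspan (@basis K) (fun=> True) m.
Proof. exact: spanned_lspan (@spannedT K m). Qed.

Lemma basis_free (K : choiceType) (a : Zv) (x y : K) :
  a != 0 -> a *: basis x = a *: basis y -> x = y.
Proof.
move=> a0 E; have [//|ne] := eqVneq x y.
have := congr1 (mcoeff x) E; rewrite [LHS]mcoeffZ [RHS]mcoeffZ.
rewrite [X in X = _](_ : _ = a); last by rewrite coef_basis eqxx mulr1.
rewrite [X in _ = X](_ : _ = 0) => [e|]; first by rewrite e eqxx in a0.
by rewrite coef_basis eq_sym (negbTE ne) mulr0.
Qed.

Lemma coef_lin (K : choiceType) (a : Zv) (x y : {malg Zv[K]}) k :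
  (a *: x + y)@_k = a * x@_k + y@_k.
Proof. by rewrite mcoeffD mcoeffZ. Qed.

Lemma lincomb_lin (K : choiceType) (V : lmodType Zv) (c : K -> V) (a : Zv)
  (x y : {malg Zv[K]}) :
  lincomb c (a *: x + y) = a *: lincomb c x + lincomb c y.
Proof. by rewrite lincombD lincombZ. Qed.

Section Bridge.
Variables (W : groupType) (S : W -> Prop).
Hypothesis cox : coxeter_system S.

Lemma hecke_malg u mul : is_hecke_algebra S u mul -> hecke_on S (@basis W) u mul.
Proof.
move=> h; split.
- exact: hecke_mulA h.
- exact: hecke_mul1l h.
- exact: hecke_mul1r h.
- exact: hecke_mulDl h.
- exact: hecke_mulDr h.
- exact: hecke_mulZl h.
- exact: hecke_mulZr h.
- by move=> s w Ss lt; apply: (hecke_up h Ss); apply: bruhat_gen.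
move=> s w Ss lt; apply: (hecke_down h Ss).
by rewrite -{2}[w](genKg cox Ss); apply: bruhat_gen => //; rewrite (genKg cox Ss).
Qed.

Lemma hecke_bar_malg mul bar :
  is_hecke_bar mul bar -> hecke_bar_on (@basis W) mul bar.
Proof.
move=> h; split.
- exact: hecke_barD h.
- exact: hecke_barM h.
- exact: hecke_bar_v h.
by move=> w; case: (hecke_bar_t h w).
Qed.

End Bridge.

(** ** Degree and parity of exponents *)

Lemma vpow_cancel i (a b : Zv) : vpow int i * a = vpow int i * b -> a = b.
Proof.
by move/(congr1 ( *%R (vpow int (- i)))); rewrite !mulrA vpowNK !mul1r.
Qed.

(** The degree bound on P_{y,w} says that the coefficient of c_w at y becomes an
    element of v^-1 Z[v^-1] when multiplied by v^(ell y). *)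
Lemma negdeg_kl (p : {poly int}) (ly lw : nat) :
  ((size p).-1.*2 + ly < lw)%N ->
  negdeg (vpow int ly * (vpow int (- lw%:Z) * at_laurent p (vq int))).
Proof.
move=> bd i; rewrite !coefMvpow => nz.
have [[j ej]|nj] := EM (exists j : nat, i - ly%:Z - - lw%:Z = 2 * j%:Z); last first.
  by move: nz; rewrite coef_at_laurent0 ?eqxx // => j e; apply: nj; exists j.
move: nz; rewrite ej coef_at_laurent intz => pj.
have : (j < size p)%N by rewrite ltnNge; apply: contra pj => /(nth_default 0) ->.
by lia.
Qed.

Lemma lsgn_vpow i : lsgn (vpow int i) = (-1) ^+ `|i|%N * vpow int i.
Proof.
apply/malgP => j; have -> : (-1) ^+ `|i|%N = ((-1) ^+ `|i|%N)%:~R :> Zv.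
  by rewrite rmorphXn /= rmorphN1.
rewrite coef_lsgn coefMintr coef_vpow; have [<-|_] := eqVneq i j.
  by rewrite signz signr_odd.
by rewrite !mulr0.
Qed.

(** If v -> -v multiplies the basis elements and a combination of them by
    signs, then it multiplies the coordinates by signs. *)
Lemma sign_coords (K : choiceType) (len : K -> nat) (c : K -> {malg Zv[K]})
    (n : nat) (e : {malg Zv[K]}) :
  (forall k, (c k)@_k = vpow int (- (len k)%:Z)) ->
  (forall k j, (c k)@_j != 0 -> j != k -> (len j < len k)%N) ->
  (forall k, mapc lsgn (c k) = (-1) ^+ len k *: c k) ->
  mapc lsgn (lincomb c e) = (-1) ^+ n *: lincomb c e ->
  forall k, parity (odd (n + len k)) e@_k.
Proof.
move=> cd ct cs; rewrite (semilin_lincomb c lsgnD lsgnM lsgn0 lsgn1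
  (mapcD lsgnD lsgn0) (mapcZ lsgn0 lsgnM)) -lincombZ.
pose e' := lincomb (fun k => (-1) ^+ len k *: basis k) (mapc lsgn e).
have -> : lincomb (fun k => mapc lsgn (c k)) (mapc lsgn e) = lincomb c e'.
  rewrite /e' lincomb_comp; apply: eq_lincomb (@spannedT _ _) _ => k _.
  by rewrite lincombZ lincomb_basis cs.
move/(lincomb_inj cd ct) => E k; apply: parity_lsgn.
have ce : e'@_k = (-1) ^+ len k * lsgn e@_k.
  rewrite /e'; transitivity ((-1) ^+ len k * (mapc lsgn e)@_k); last first.
    by congr (_ * _); exact: (coef_mapc lsgn0).
  elim/basis_ind: (mapc lsgn e) => [|a j m IH].
    by rewrite lincomb0 [LHS]mcoeff0 [X in _ * X]mcoeff0 mulr0.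
  rewrite lincomb_lin lincomb_basis 2!coef_lin IH [X in a * X]mcoeffZ mulrDr.
  have -> : (-1) ^+ len j * (basis j)@_k = (-1) ^+ len k * (basis j)@_k :> Zv.
    by rewrite coef_basis; have [->|_] := eqVneq j k; rewrite ?mulr0.
  by rewrite mulrCA.
have : (-1) ^+ len k * lsgn e@_k = (-1) ^+ n * e@_k.
  by rewrite -ce E [LHS]mcoeffZ.
move/(congr1 ( *%R ((-1) ^+ len k))); rewrite !mulrA -!exprD addnn.
rewrite -signr_odd odd_double expr0 mul1r => ->.
by rewrite signr_odd addnC.
Qed.

Section KL.
Variables (W : groupType) (S : W -> Prop).
Hypothesis cox : coxeter_system S.
Variable K : kl_theory S.
Local Notation H := {malg Zv[W]}.
Local Notation ell := (ell S).
Local Notation q := (vq int).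
Local Notation c := (kl_c K).
Local Notation mul := (kl_mul K).
Local Notation bar := (kl_bar K).

Definition LP (y w : W) : Zv := at_laurent (kl_P K y w) q.

Lemma qK : vpow int (- 2) * q = 1.
Proof. exact: vpowNK. Qed.

Lemma kl_hecke : hecke_on S (@basis W) q mul.
Proof. exact: (hecke_malg cox (kl_mulP K)). Qed.

Lemma kl_bar_on : hecke_bar_on (@basis W) mul bar.
Proof. exact: (hecke_bar_malg (kl_barP K)). Qed.

Lemma kl_coef y w : (c w)@_y = vpow int (- (ell w)%:Z) * LP y w.
Proof. exact: kl_cE. Qed.

Lemma bruhat_irr w : ~ bruhat_lt S w w.
Proof. by case. Qed.

Lemma LPww w : LP w w = 1.
Proof. by rewrite /LP kl_P_nlt ?eqxx ?at_laurent1 //; apply: bruhat_irr. Qed.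

Lemma LP_nlt y w : ~ bruhat_lt S y w -> y != w -> LP y w = 0.
Proof. by move=> nlt ne; rewrite /LP kl_P_nlt // (negbTE ne) at_laurent0. Qed.

Lemma LP_supp y w : LP y w != 0 -> bruhat_le S y w.
Proof.
move=> nz; have [->|ne] := eqVneq y w; first exact: rt_refl.
by apply: contrapT => nle; rewrite LP_nlt ?eqxx // in nz => -[].
Qed.

Lemma kl_diag w : (c w)@_w = vpow int (- (ell w)%:Z).
Proof. by rewrite kl_coef LPww mulr1. Qed.

Lemma kl_supp w y : (c w)@_y != 0 -> bruhat_le S y w.
Proof.
move=> nz; apply: LP_supp; apply: contraNneq nz.
by rewrite kl_coef => ->; rewrite mulr0.
Qed.

Lemma kl_tri w y : (c w)@_y != 0 -> y != w -> (ell y < ell w)%N.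
Proof.
move=> /kl_supp/bruhat_le_ell [->|//]; by rewrite eqxx.
Qed.

Lemma kl_neg w y : y != w -> negdeg (vpow int (ell y) * (c w)@_y).
Proof.
move=> ne; have [lt|nlt] := EM (bruhat_lt S y w).
  by rewrite kl_coef; apply: negdeg_kl; apply: kl_P_deg.
by rewrite kl_coef LP_nlt // !mulr0; apply: negdeg0.
Qed.

Lemma kl_barZ (a : Zv) (x : H) : bar (a *: x) = lbar a *: bar x.
Proof. have Z := hecke_barZ kl_hecke kl_bar_on a x; exact_no_check Z. Qed.

Lemma kl_barM x y : bar (mul x y) = mul (bar x) (bar y).
Proof. exact: (heckebM kl_bar_on). Qed.

Lemma kl_unique (m : H) w : bar m = m -> m@_w = vpow int (- (ell w)%:Z) ->
  (forall y, y != w -> negdeg (vpow int (ell y) * m@_y)) -> m = c w.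
Proof.
apply: (bar_invariant_unique kl_diag kl_tri (heckebD kl_bar_on) kl_barZ
  (kl_bar_c K) kl_neg).
Qed.

Lemma kl_closed J w y : factor S J -> inW S J w -> (c w)@_y != 0 -> inW S J y.
Proof.
move=> fJ Jw /kl_supp le; exact: (bruhat_factor cox fJ le Jw).
Qed.

Lemma kl_spanned J w : factor S J -> inW S J w -> spanned (inW S J) (c w).
Proof. by move=> fJ Jw y; apply: kl_closed. Qed.

Lemma kl_coords_spanned J e : factor S J ->
  spanned (inW S J) (lincomb c e) -> spanned (inW S J) e.
Proof.
move=> fJ; apply: (spanned_coords kl_diag kl_tri) => w y.
exact: kl_closed.
Qed.

Lemma kl_mul_spanned J x y : factor S J -> spanned (inW S J) x ->
  spanned (inW S J) y -> spanned (inW S J) (mul x y).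
Proof.
move=> fJ /spanned_lspan sx /spanned_lspan sy; apply: lspan_spanned.
exact (spanned_mul cox kl_hecke fJ sx sy).
Qed.

Lemma mul_coef J x y w : factor S J ->
  spanned (inW S J) x -> spanned (inW S (compl S J)) y ->
  (mul x y)@_w = x@_(pr S J w) * y@_(pr S (compl S J) w).
Proof.
move=> fJ /spanned_lspan sx /spanned_lspan sy.
have Z := coef_mul_compl cox fJ kl_hecke (co := fun m w => m@_w).
have L1 (a : Zv) (m1 m2 : H) w' := coef_lin a m1 m2 w'.
have L2 (w1 w2 : W) := coef_basis w1 w2.
have Z' := Z L1 L2 x y sx sy w.
exact Z'.
Qed.

(** A product of two basis elements from complementary factors satisfies the
    conditions that characterize a basis element. *)
Lemma kl_c_mul J w1 w2 : factor S J -> inW S J w1 -> inW S (compl S J) w2 ->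
  c (w1 * w2)%g = mul (c w1) (c w2).
Proof.
move=> fJ J1 J2; have fJ' := factor_compl fJ; apply/esym/kl_unique.
- by rewrite kl_barM !kl_bar_c.
- rewrite (mul_coef _ fJ (kl_spanned fJ J1) (kl_spanned fJ' J2)).
  rewrite (prM cox fJ) (prM cox fJ') J1 J2 (inW_compl1 cox fJ J1).
  rewrite (inW_compl2 cox fJ J2) mulg1 mul1g !kl_diag -vpowD.
  rewrite (ell_split cox fJ (w1 * w2)%g) (prM cox fJ) (prM cox fJ') J1 J2.
  rewrite (inW_compl1 cox fJ J1) (inW_compl2 cox fJ J2) mulg1 mul1g.
  by congr vpow; lia.
move=> y ne; rewrite (mul_coef _ fJ (kl_spanned fJ J1) (kl_spanned fJ' J2)).
set y1 := pr S J y; set y2 := pr S (compl S J) y.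
have -> : vpow int (ell y) = vpow int (ell y1) * vpow int (ell y2).
  by rewrite (ell_split cox fJ y) -vpowD; congr vpow; lia.
rewrite mulrACA; have [e1|ne1] := eqVneq y1 w1.
  rewrite e1 kl_diag vpowKN mul1r; apply: kl_neg; apply: contra_neq ne => e2.
  by rewrite -e1 -e2 pr_split.
have [->|ne2] := eqVneq y2 w2.
  by rewrite kl_diag vpowKN mulr1; apply: kl_neg.
by apply: negdegM; apply: kl_neg.
Qed.

Lemma kl_c_split J w : factor S J ->
  c w = mul (c (pr S J w)) (c (pr S (compl S J) w)).
Proof.
move=> fJ; have fJ' := factor_compl fJ.
by rewrite -(kl_c_mul fJ (inWpr cox w fJ) (inWpr cox w fJ')) (pr_split cox fJ).
Qed.

Lemma LP_split J y w : factor S J ->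
  LP y w = LP (pr S J y) (pr S J w)
         * LP (pr S (compl S J) y) (pr S (compl S J) w).
Proof.
move=> fJ; have fJ' := factor_compl fJ.
apply: (vpow_cancel (i := - (ell w)%:Z)); rewrite -kl_coef (kl_c_split w fJ).
rewrite (mul_coef _ fJ (kl_spanned fJ (inWpr cox w fJ))
  (kl_spanned fJ' (inWpr cox w fJ'))).
rewrite !kl_coef mulrACA -vpowD (ell_split cox fJ w).
by congr (vpow _ _ * _); lia.
Qed.

(** Coordinates in the Kazhdan-Lusztig basis multiply as coefficients do. *)
Lemma coords_split J x y e e1 e2 : factor S J ->
  spanned (inW S J) x -> spanned (inW S (compl S J)) y ->
  lincomb c e = mul x y -> lincomb c e1 = x -> lincomb c e2 = y ->
  forall z, e@_z = e1@_(pr S J z) * e2@_(pr S (compl S J) z).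
Proof.
move=> fJ sx sy E E1 E2 z; have fJ' := factor_compl fJ.
have s1 : spanned (inW S J) e1 by apply: kl_coords_spanned; rewrite ?E1.
have s2 : spanned (inW S (compl S J)) e2 by apply: kl_coords_spanned; rewrite ?E2.
rewrite -(mul_coef _ fJ s1 s2); congr mcoeff.
apply: (lincomb_inj kl_diag kl_tri); rewrite E -E1 -E2.
have Z := lin_mul_compl cox fJ kl_hecke (L := lincomb c) (c := c).
have L1 (a : Zv) (m1 m2 : H) := lincomb_lin c a m1 m2.
have L2 (w : W) := lincomb_basis c w.
have L3 (w w' : W) (J1 : inW S J w) (J2 : inW S (compl S J) w') := kl_c_mul fJ J1 J2.
have Z' := Z L1 L2 L3 e1 e2 (spanned_lspan s1) (spanned_lspan s2).
exact: esym Z'.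
Qed.

Lemma kl_mulACA J x x' y y' : factor S J ->
  spanned (inW S J) y -> spanned (inW S (compl S J)) x' ->
  mul (mul x x') (mul y y') = mul (mul x y) (mul x' y').
Proof.
move=> fJ /spanned_lspan sy /spanned_lspan sx'.
exact: (mulACA_compl cox fJ kl_hecke x y' sy sx').
Qed.

Lemma kl_mul_split J x y : factor S J ->
  mul (c x) (c y) = mul (mul (c (pr S J x)) (c (pr S J y)))
    (mul (c (pr S (compl S J) x)) (c (pr S (compl S J) y))).
Proof.
move=> fJ; rewrite (kl_c_split x fJ) (kl_c_split y fJ).
have fJ' := factor_compl fJ.
apply: (kl_mulACA (J := J)) => //; apply: kl_spanned => //; exact: inWpr.
Qed.

Lemma kl_h_split J x y z : factor S J ->
  (kl_h K x y)@_z = (kl_h K (pr S J x) (pr S J y))@_(pr S J z)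
    * (kl_h K (pr S (compl S J) x) (pr S (compl S J) y))@_(pr S (compl S J) z).
Proof.
move=> fJ; have fJ' := factor_compl fJ.
apply: (coords_split fJ (x := mul (c (pr S J x)) (c (pr S J y)))
  (y := mul (c (pr S (compl S J) x)) (c (pr S (compl S J) y)))).
- by apply: kl_mul_spanned => //; apply: kl_spanned => //; apply: inWpr.
- by apply: kl_mul_spanned => //; apply: kl_spanned => //; apply: inWpr.
- by rewrite -kl_mul_split // kl_hE.
- by rewrite kl_hE.
- by rewrite kl_hE.
Qed.

Definition kl_mul3 (x y z : W) : H := mul (mul (c x) (c y)) (c z).

Lemma kl_mul3_spanned J x y z : factor S J -> inW S J x -> inW S J y ->
  inW S J z -> spanned (inW S J) (kl_mul3 x y z).
Proof.
move=> fJ Jx Jy Jz; apply: kl_mul_spanned => //; last exact: kl_spanned.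
by apply: kl_mul_spanned => //; apply: kl_spanned.
Qed.

Lemma kl_mul3_split J x y z : factor S J ->
  kl_mul3 x y z = mul (kl_mul3 (pr S J x) (pr S J y) (pr S J z))
    (kl_mul3 (pr S (compl S J) x) (pr S (compl S J) y) (pr S (compl S J) z)).
Proof.
move=> fJ; have fJ' := factor_compl fJ.
rewrite /kl_mul3 (kl_mul_split x y fJ) (kl_c_split z fJ).
apply: (kl_mulACA (J := J)) => //; first by apply: kl_spanned => //; apply: inWpr.
by apply: kl_mul_spanned => //; apply: kl_spanned => //; apply: inWpr.
Qed.

Lemma mul3_coords_split J x y z e e1 e2 : factor S J ->
  lincomb c e = kl_mul3 x y z ->
  lincomb c e1 = kl_mul3 (pr S J x) (pr S J y) (pr S J z) ->
  lincomb c e2 = kl_mul3 (pr S (compl S J) x) (pr S (compl S J) y)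
                         (pr S (compl S J) z) ->
  forall w, e@_w = e1@_(pr S J w) * e2@_(pr S (compl S J) w).
Proof.
move=> fJ E E1 E2; have fJ' := factor_compl fJ.
apply: (coords_split fJ _ _ _ E1 E2).
- by apply: kl_mul3_spanned => //; apply: inWpr.
- by apply: kl_mul3_spanned => //; apply: inWpr.
- by rewrite E; apply: kl_mul3_split.
Qed.

(** ** Symmetry and parity of structure constants *)

Lemma kl_coords_bar e : bar (lincomb c e) = lincomb c e ->
  forall z, lbar e@_z = e@_z.
Proof.
exact: (coords_bar kl_diag kl_tri (heckebD kl_bar_on) kl_barZ (kl_bar_c K)).
Qed.

Lemma kl_h_bar x y z : lbar (kl_h K x y)@_z = (kl_h K x y)@_z.
Proof. by apply: kl_coords_bar; rewrite -kl_hE kl_barM !kl_bar_c. Qed.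

Lemma mul3_coords_bar x y z e : lincomb c e = kl_mul3 x y z ->
  forall w, lbar e@_w = e@_w.
Proof. by move=> E; apply: kl_coords_bar; rewrite E /kl_mul3 !kl_barM !kl_bar_c. Qed.

Lemma lsgn_q : lsgn q = q.
Proof. by rewrite [LHS]lsgn_vpow expr2 mulrNN !mul1r. Qed.

Lemma kl_sign w : mapc lsgn (c w) = (-1) ^+ ell w *: c w.
Proof.
apply/malgP => y; rewrite [LHS](coef_mapc lsgn0) [RHS]mcoeffZ.
rewrite kl_coef lsgnM lsgn_vpow [lsgn (LP _ _)]lsgn_at_laurent mulrA.
by rewrite abszN.
Qed.

Lemma sign_mul x y : mapc lsgn (mul x y) = mul (mapc lsgn x) (mapc lsgn y).
Proof.
have hk' : hecke_on S (@basis W) (lsgn q) mul by rewrite lsgn_q; apply: kl_hecke.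
have L1 (a : Zv) (m1 m2 : H) : mapc lsgn (a *: m1 + m2) =
    lsgn a *: mapc lsgn m1 + mapc lsgn m2.
  by rewrite (mapcD lsgnD lsgn0) (mapcZ lsgn0 lsgnM).
have L2 (w : W) := mapc_basis lsgn0 lsgn1 w.
have Z := mapc_mul cox (@basis_gen W) lsgnD lsgn1 lsgnN kl_hecke hk'
  (phi := mapc lsgn) L1 L2 x y.
exact Z.
Qed.

Lemma kl_mulZZ (a b : Zv) (x y : H) : mul (a *: x) (b *: y) = (a * b) *: mul x y.
Proof. have Z := heckeZZ kl_hecke a b x y; exact_no_check Z. Qed.

Lemma kl_h_parity x y z :
  parity (odd (ell x + ell y + ell z)) (kl_h K x y)@_z.
Proof.
apply: (sign_coords kl_diag kl_tri kl_sign).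
by rewrite -kl_hE sign_mul !kl_sign kl_mulZZ -exprD.
Qed.

Lemma mul3_parity x y z e : lincomb c e = kl_mul3 x y z ->
  forall w, parity (odd (ell x + ell y + ell z + ell w)) e@_w.
Proof.
move=> E; apply: (sign_coords kl_diag kl_tri kl_sign).
by rewrite E /kl_mul3 2!sign_mul !kl_sign !kl_mulZZ -!exprD.
Qed.

End KL.

(** ** Restriction to a factor *)

Section RestrictHecke.
Variables (W : groupType) (S J : W -> Prop).
Hypotheses (cox : coxeter_system S) (fJ : factor S J).
Local Notation G := (gen_group J).
Local Notation SG := (@gen_group_gens W J).
Local Notation ext := (extend (val : G -> W)).
Local Notation res := (restrict (val : G -> W)).

Lemma in_image_val w : inW S J w <-> in_image (val : G -> W) w.
Proof.
split=> [/(lift_pr cox fJ)//|[g <-]]; exact: (val_pr cox fJ).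
Qed.

Lemma ext_spanned (x : {malg Zv[G]}) : spanned (inW S J) (ext x).
Proof. by move=> w /(spanned_extend) /in_image_val. Qed.

Lemma ext_res (x : {malg Zv[W]}) : spanned (inW S J) x -> ext (res x) = x.
Proof.
move=> sx; apply: (extend_restrict val_inj) => w /sx; by move/in_image_val.
Qed.

Lemma ext_inj : injective ext.
Proof. exact: (extend_inj val_inj). Qed.

Lemma ext_basis (g : G) : ext (basis g) = basis (val g).
Proof. exact: extend_basis. Qed.

Lemma extD (x y : {malg Zv[G]}) : ext (x + y) = ext x + ext y.
Proof. exact: extendD. Qed.

Lemma extZ (a : Zv) (x : {malg Zv[G]}) : ext (a *: x) = a *: ext x.
Proof. exact: extendZ. Qed.

Variables (u u' : Zv) (mul : {malg Zv[W]} -> {malg Zv[W]} -> {malg Zv[W]}).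
Hypothesis uK : u' * u = 1.
Hypothesis hecke : is_hecke_algebra S u mul.

Definition mulG (x y : {malg Zv[G]}) := res (mul (ext x) (ext y)).

Lemma ext_mulG x y : ext (mulG x y) = mul (ext x) (ext y).
Proof.
apply: ext_res; apply: lspan_spanned.
have hk := hecke_malg cox hecke.
exact (spanned_mul cox hk fJ (spanned_lspan (@ext_spanned x))
  (spanned_lspan (@ext_spanned y))).
Qed.

Lemma mulG_scalel (a : Zv) x y : mulG (a *: x) y = a *: mulG x y.
Proof.
apply: ext_inj; apply: etrans (ext_mulG (a *: x) y) _.
apply: etrans (congr1 (mul^~ (ext y)) (extZ a x)) _.
have Z := hecke_mulZl hecke a (ext x) (ext y); apply: etrans Z _.
exact: etrans (congr1 ( *:%R a) (esym (ext_mulG x y))) (esym (extZ a (mulG x y))).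
Qed.

Lemma mulG_scaler (a : Zv) x y : mulG x (a *: y) = a *: mulG x y.
Proof.
apply: ext_inj; apply: etrans (ext_mulG x (a *: y)) _.
apply: etrans (congr1 (mul (ext x)) (extZ a y)) _.
have Z := hecke_mulZr hecke a (ext x) (ext y); apply: etrans Z _.
exact: etrans (congr1 ( *:%R a) (esym (ext_mulG x y))) (esym (extZ a (mulG x y))).
Qed.

Lemma hecke_restrict : is_hecke_algebra SG u mulG.
Proof.
split.
- move=> x y z; apply: ext_inj.
  apply: etrans (ext_mulG x (mulG y z)) _; apply/esym.
  apply: etrans (ext_mulG (mulG x y) z) _.
  have -> := ext_mulG x y; have -> := ext_mulG y z.
  exact/esym/(hecke_mulA hecke).
- move=> x; apply: ext_inj; apply: etrans (ext_mulG _ _) _.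
  by rewrite ext_basis (hecke_mul1l hecke).
- move=> x; apply: ext_inj; apply: etrans (ext_mulG _ _) _.
  by rewrite ext_basis (hecke_mul1r hecke).
- move=> x y z; apply: ext_inj; apply: etrans (ext_mulG _ _) _.
  rewrite extD; apply: etrans (hecke_mulDl hecke _ _ _) _; apply/esym.
  apply: etrans (extD _ _) _.
  by have -> := ext_mulG x z; have -> := ext_mulG y z.
- move=> x y z; apply: ext_inj; apply: etrans (ext_mulG _ _) _.
  rewrite extD; apply: etrans (hecke_mulDr hecke _ _ _) _; apply/esym.
  apply: etrans (extD _ _) _.
  by have -> := ext_mulG x y; have -> := ext_mulG x z.
- by move=> a x y; have Z := mulG_scalel a x y; exact_no_check Z.
- by move=> a x y; have Z := mulG_scaler a x y; exact_no_check Z.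
- move=> s w Js /(bruhat_lt_gen cox fJ) lt; apply: ext_inj.
  apply: etrans (ext_mulG _ _) _; rewrite 3!ext_basis.
  exact: (hecke_up hecke (factorS fJ Js) lt).
move=> s w Js /(bruhat_lt_gen cox fJ) lt; apply: ext_inj.
apply: etrans (ext_mulG _ _) _; have -> := ext_basis s; have E := ext_basis w.
rewrite [X in mul _ X]E.
apply: etrans (hecke_down hecke (factorS fJ Js) lt) _; apply/esym.
apply: etrans (extD _ _) _; apply: (congr2 (fun a b => a + b)).
  by apply: etrans (extZ _ _) _; have -> := ext_basis (s * w)%g.
by apply: etrans (extZ _ _) _; rewrite E.
Qed.

Variable bar : {malg Zv[W]} -> {malg Zv[W]}.
Hypothesis hbar : is_hecke_bar mul bar.

Definition barG (x : {malg Zv[G]}) := res (bar (ext x)).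

Lemma ext_barG x : ext (barG x) = bar (ext x).
Proof.
apply: ext_res; apply: lspan_spanned.
have hk := hecke_malg cox hecke; have hb := hecke_bar_malg hbar.
exact (spanned_bar cox uK hk hb fJ (spanned_lspan (@ext_spanned x))).
Qed.

Lemma barG_v n : barG (vpow int n *: basis 1%g) = vpow int (- n) *: basis 1%g.
Proof.
have E m : ext (vpow int m *: basis 1%g) = vpow int m *: basis 1%g.
  exact: etrans (extZ (vpow int m) (basis 1%g)) (congr1 ( *:%R _) (ext_basis 1%g)).
apply: ext_inj; apply: etrans (ext_barG (vpow int n *: basis 1%g)) _.
have Z := hecke_bar_v hbar n.
exact: etrans (congr1 bar (E n)) (etrans Z (esym (E (- n)))).
Qed.

Lemma hecke_bar_restrict : is_hecke_bar mulG barG.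
Proof.
split.
- move=> x y; apply: ext_inj; apply: etrans (ext_barG _) _.
  have -> := extD x y; apply: etrans (hecke_barD hbar _ _) _; apply/esym.
  apply: etrans (extD _ _) _.
  by have -> := ext_barG x; have -> := ext_barG y.
- move=> x y; apply: ext_inj; apply: etrans (ext_barG _) _.
  have -> := ext_mulG x y; apply: etrans (hecke_barM hbar _ _) _; apply/esym.
  apply: etrans (ext_mulG _ _) _.
  by have -> := ext_barG x; have -> := ext_barG y.
- move=> x; apply: ext_inj; apply: etrans (ext_barG _) _.
  by have -> := ext_barG x; apply: (hecke_barK hbar).
- move=> n; have Z := barG_v n; exact_no_check Z.
move=> w; split; apply: ext_inj; apply: etrans (ext_mulG _ _) _.
  have -> := ext_barG (basis w); have -> := ext_basis w.
  have -> := ext_basis w^-1%g; have -> := ext_basis 1%g.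
  by case: (hecke_bar_t hbar (val w)).
have -> := ext_barG (basis w); have -> := ext_basis w.
have -> := ext_basis w^-1%g; have -> := ext_basis 1%g.
by case: (hecke_bar_t hbar (val w)).
Qed.

End RestrictHecke.

Section RestrictKL.
Variables (W : groupType) (S J : W -> Prop).
Hypotheses (cox : coxeter_system S) (fJ : factor S J).
Variable K : kl_theory S.
Local Notation G := (gen_group J).
Local Notation SG := (@gen_group_gens W J).
Local Notation ext := (extend (val : G -> W)).
Local Notation res := (restrict (val : G -> W)).

Definition cG (g : G) := res (kl_c K (val g)).

Lemma ext_cG g : ext (cG g) = kl_c K (val g).
Proof.
exact: (ext_res cox fJ (kl_spanned cox fJ (val_pr cox fJ g))).
Qed.

Lemma ext_lincomb_cG (e : {malg Zv[W]}) : spanned (inW S J) e ->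
  ext (lincomb cG (res e)) = lincomb (kl_c K) e.
Proof.
move=> se; rewrite extend_lincomb -{2}(ext_res cox fJ se) lincomb_extend.
by apply: eq_lincomb (@spannedT _ _) _ => g _; apply: ext_cG.
Qed.

(** The hypotheses of the theorem concern the group generated by a component;
    through this restriction they speak of the P_{y,w} and h_{x,y;z} of W. *)
Definition kl_restrict : kl_theory SG.
Proof.
apply: (@KLTheory G SG (mulG (J := J) (kl_mul K)) _ (barG (J := J) (kl_bar K)) _
  (fun y w => kl_P K (val y) (val w)) cG _ _ _ _
  (fun x y => res (kl_h K (val x) (val y)))).
- exact: (hecke_restrict cox fJ (kl_mulP K)).
- exact: (hecke_bar_restrict cox fJ qK (kl_mulP K) (kl_barP K)).
- move=> y w; rewrite (coef_restrict val_inj) (ell_gen cox fJ); exact: kl_cE.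
- move=> w; apply: (@ext_inj _ J).
  rewrite (ext_barG cox fJ qK (kl_mulP K) (kl_barP K)) ext_cG.
  exact: kl_bar_c.
- move=> y w nlt; rewrite kl_P_nlt; first by rewrite val_eqE.
  by move/(bruhat_lt_gen cox fJ).
- move=> y w /(bruhat_lt_gen cox fJ) lt; rewrite /kl_degree_bound !(ell_gen cox fJ).
  exact: kl_P_deg.
move=> x y; apply: (@ext_inj _ J).
rewrite (ext_mulG cox fJ (kl_mulP K)) !ext_cG ext_lincomb_cG; first exact: kl_hE.
have sp g := kl_spanned cox (K := K) fJ (val_pr cox fJ g).
have s1 : spanned (inW S J) (kl_mul K (kl_c K (val x)) (kl_c K (val y))).
  exact: (kl_mul_spanned cox fJ (sp x) (sp y)).
by rewrite kl_hE in s1; exact: (kl_coords_spanned cox fJ s1).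
Defined.

End RestrictKL.

(** * Twisted involutions *)

Section TwistedInvolutions.
Variables (W : groupType) (S : W -> Prop) (star : W -> W).
Hypotheses (cox : coxeter_system S) (st : preserving_involution S star).
Hypothesis exch : forall s w r, S s -> S r -> ell S (s * w * r)%g = ell S w ->
  ell S (s * w)%g = ell S (w * r)%g -> (s * w = w * r)%g.
Local Notation ell := (ell S).
Local Notation I := (twisted_invol star).
Implicit Types w y z : I.

Definition tcomm (s w : W) : bool := (s * w == w * star s)%g.
Definition tup (s w : W) : bool := (ell w < ell (s * w)%g)%N.

Lemma ltimesE s (w : W) : ltimes star s w =
  if tcomm s w then (s * w)%g else (s * w * star s)%g.
Proof. by []. Qed.

Lemma invol_star w : star (val w) = (val w)^-1%g.
Proof. exact/eqP/(valP w). Qed.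

Lemma ltimes_invol s w : S s ->
  star (ltimes star s (val w)) == (ltimes star s (val w))^-1%g.
Proof.
move=> Ss; have Ss' : S (star s) by apply/(star_S st).
rewrite /ltimes; case: ((s * val w)%g =P (val w * star s)%g) => [e|_]; apply/eqP.
  by rewrite (starM st) invol_star e invgM (genVg cox Ss').
rewrite !(starM st) (starK st) invol_star !invgM (genVg cox Ss) (genVg cox Ss').
by rewrite mulgA.
Qed.

Definition ltI (s : W) (w : I) : I := insubd w (ltimes star s (val w)).

Lemma val_ltI s w : S s -> val (ltI s w) = ltimes star s (val w).
Proof. by move=> Ss; apply: insubdK; apply: ltimes_invol. Qed.

Lemma ell_ws s w : S s -> ell (val w * star s)%g = ell (s * val w)%g.
Proof.
move=> Ss; have Ss' : S (star s) by apply/(star_S st).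
rewrite -(ellV cox (val w * _)%g) invgM (genVg cox Ss') -invol_star -(starM st).
exact: ell_star.
Qed.

(** If s w s^* had the length of w, then sw = ws^* by the exchange condition. *)
Lemma ell_sws s w : S s -> ~~ tcomm s (val w) ->
  ell (s * val w * star s)%g =
  if tup s (val w) then (ell (val w)).+2 else (ell (val w)).-2.
Proof.
move=> Ss nc; have Ss' : S (star s) by apply/(star_S st).
have ne : ell (s * val w * star s)%g <> ell (val w).
  move=> e; case/negP: nc; apply/eqP; apply: exch => //.
  by rewrite ell_ws.
have := ell_sl cox (val w) Ss; have := ell_sr cox (s * val w)%g Ss'.
by rewrite /tup; case: ltnP; lia.
Qed.

Lemma comm_ltI s w : S s -> tcomm s (val (ltI s w)) = tcomm s (val w).
Proof.
move=> Ss; have Ss' : S (star s) by apply/(star_S st).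
rewrite val_ltI // /ltimes /tcomm.
case: ((s * val w)%g =P (val w * star s)%g) => [e|/eqP ne].
  by rewrite (genKg cox Ss) e (gengK cox Ss') eqxx.
by rewrite (gengK cox Ss') mulgA (genKg cox Ss) eq_sym; apply: negbTE.
Qed.

Lemma up_ltI s w : S s -> tup s (val (ltI s w)) = ~~ tup s (val w).
Proof.
move=> Ss; have Ss' : S (star s) by apply/(star_S st).
have sl := ell_sl cox (val w) Ss; rewrite val_ltI // /ltimes.
case: ((s * val w)%g =P (val w * star s)%g) => [e|/eqP nc].
  by rewrite /tup (genKg cox Ss); lia.
rewrite {1}/tup (ell_sws Ss nc) mulgA (genKg cox Ss) ell_ws //.
have := ell_sr cox (s * val w)%g Ss'; rewrite (ell_sws Ss nc) /tup.
by case: ltnP; lia.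
Qed.

Lemma ltIK s w : S s -> ltI s (ltI s w) = w.
Proof.
move=> Ss; have Ss' : S (star s) by apply/(star_S st).
apply: val_inj; rewrite val_ltI // ltimesE comm_ltI // val_ltI // ltimesE.
case: (tcomm s _); first by rewrite (genKg cox Ss).
by rewrite mulgA (genKg cox Ss) (gengK cox Ss').
Qed.

Lemma ell_ltI s w : S s -> ~~ tup s (val w) -> (ell (val (ltI s w)) < ell (val w))%N.
Proof.
move=> Ss nu; have := ell_sl cox (val w) Ss; have := nu; rewrite /tup => nu'.
rewrite val_ltI // /ltimes.
case: ((s * val w)%g =P (val w * star s)%g) => [_|/eqP nc]; first by lia.
by rewrite ell_sws // (negbTE nu); lia.
Qed.

Section Factor.
Variable J : W -> Prop.
Hypotheses (fJ : factor S J) (sJ : star_set star J = J).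
Local Notation p := (pr S J).
Local Notation p' := (pr S (compl S J)).

Lemma star_in s : J s -> J (star s).
Proof. by rewrite -{1}sJ. Qed.

Lemma star_compl : star_set star (compl S J) = compl S J.
Proof.
apply/funext => s; apply/propext; rewrite /star_set /compl -[J (star s)]/(star_set star J s) sJ.
by split=> -[/(star_S st) ? ?]; split=> //; apply/(star_S st).
Qed.

Lemma pr_invol w : star (p (val w)) == (p (val w))^-1%g.
Proof. by rewrite -(pr_star cox st _ fJ) sJ invol_star (prV cox fJ). Qed.

Definition prI (w : I) : I := insubd w (p (val w)).

Lemma val_prI w : val (prI w) = p (val w).
Proof. by apply: insubdK; apply: pr_invol. Qed.

Lemma comm_pr s (w : W) : J s -> tcomm s w = tcomm s (p w).
Proof.
move=> Js; have Js' := star_in Js; rewrite /tcomm.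
have -> : (s * w = s * p w * p' w)%g by rewrite -mulgA (pr_split cox fJ).
have -> : (w * star s = p w * star s * p' w)%g.
  rewrite -(pr_in cox fJ Js') -mulgA (pr_comm cox fJ) mulgA.
  by rewrite (pr_split cox fJ).
by rewrite (inj_eq (@mulIg _ _)).
Qed.

Lemma pr_ltimes s (w : W) : J s -> p (ltimes star s w) = ltimes star s (p w).
Proof.
move=> Js; have Js' := star_in Js; rewrite !ltimesE -comm_pr //.
by case: (tcomm s w); rewrite !(prM cox fJ) (pr_in cox fJ Js) ?(pr_in cox fJ Js').
Qed.

Lemma pr_compl_ltimes s (w : W) : J s -> p' (ltimes star s w) = p' w.
Proof.
move=> Js; have Js' := star_in Js; have fJ' := factor_compl fJ.
rewrite ltimesE; case: (tcomm s w); rewrite !(prM cox fJ') (pr_compl_in cox fJ Js).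
  by rewrite mul1g.
by rewrite (pr_compl_in cox fJ Js') mul1g mulg1.
Qed.

Lemma up_pr s (w : W) : J s -> tup s w = tup s (p w).
Proof.
move=> Js; rewrite /tup (ell_split cox fJ w) (ell_split cox fJ (s * w)%g).
rewrite (prM cox fJ) (prM cox (factor_compl fJ)) (pr_compl_in cox fJ Js) mul1g.
by rewrite (pr_in cox fJ Js) ltn_add2r.
Qed.

Lemma inW_ltI s w : J s -> inW S J (val w) -> inW S J (val (ltI s w)).
Proof.
move=> Js Jw; rewrite val_ltI; last exact: (factorS fJ Js).
by rewrite /inW pr_ltimes // Jw.
Qed.

(** A descent s of w is an ascent of s |>< w, which is shorter than w. *)
Lemma tw_ind (P : I -> Prop) : (forall w, val w = 1%g -> P w) ->
  (forall s w, J s -> inW S J (val w) -> tup s (val w) -> P w -> P (ltI s w)) ->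
  forall w, inW S J (val w) -> P w.
Proof.
move=> P1 PS w; have [n] := ubnP (ell (val w)); elim: n w => // n IH w ln Jw.
have desc u : inW S J u -> u = 1%g \/ exists2 s, J s & (ell (s * u)%g < ell u)%N.
  move: u; apply: (pr_ind cox fJ) => [|s u Js _ lt _]; first by left.
  by right; exists s => //; rewrite (genKg cox (factorS fJ Js)).
have [/P1//|[s Js lt]] := desc _ Jw; have Ss := factorS fJ Js.
have nu : ~~ tup s (val w) by rewrite /tup -leqNgt ltnW.
rewrite -(ltIK w Ss); apply: PS => //; first exact: inW_ltI.
  by rewrite up_ltI.
apply: IH; last exact: inW_ltI.
by apply: leq_trans (ell_ltI Ss nu) _.
Qed.

End Factor.
End TwistedInvolutions.

(** * The module spanned by the twisted involutions *)

Section Semilinear.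
Variables (V V' : lmodType Zv) (rho : Zv -> Zv) (f : V -> V').
Hypothesis rho1 : rho 1 = 1.
Hypothesis f_lin : forall (a : Zv) (x y : V), f (a *: x + y) = rho a *: f x + f y.

Lemma slin0 : f 0 = 0.
Proof.
have := f_lin 1 0 0; rewrite scaler0 addr0 rho1 scale1r => e.
by apply: (@addrI _ (f 0)); rewrite -e addr0.
Qed.

Lemma slinZ (a : Zv) x : f (a *: x) = rho a *: f x.
Proof. by rewrite -[_ *: x]addr0 f_lin slin0 addr0. Qed.

End Semilinear.

Section TwistedModule.
Variables (W : groupType) (S : W -> Prop) (star : W -> W).
Hypotheses (cox : coxeter_system S) (st : preserving_involution S star).
Hypothesis exch : forall s w r, S s -> S r -> ell S (s * w * r)%g = ell S w ->
  ell S (s * w)%g = ell S (w * r)%g -> (s * w = w * r)%g.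
Local Notation I := (twisted_invol star).
Local Notation q := (vq int).
Local Notation tcomm := (tcomm star).
Local Notation tup := (tup S).

(** The coefficients of [a (ltI s w)] and [a w] in T_s a_w: the first flag says
    whether sw = ws^*, the second whether sw > w. *)
Definition tw_new (comm up : bool) : Zv :=
  if up then (if comm then q + 1 else 1)
  else (if comm then q ^+ 2 - q else q ^+ 2).
Definition tw_old (comm up : bool) : Zv :=
  if up then (if comm then q else 0)
  else (if comm then q ^+ 2 - q - 1 else q ^+ 2 - 1).

Variables (V : lmodType Zv) (t : W -> V) (u' : Zv) (mul : V -> V -> V).
Hypothesis uK : u' * q ^+ 2 = 1.
Hypothesis hecke : hecke_on S t (q ^+ 2) mul.
Variables (M : lmodType Zv) (a : I -> M).
Hypothesis a_gen : forall m, lspan a (fun=> True) m.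

Record tmodule_on (act : V -> M -> M) : Prop := TModuleOn {
  tmA : forall x y m, act (mul x y) m = act x (act y m);
  tm1 : forall m, act (t 1%g) m = m;
  tm_linl : forall (c : Zv) x y m, act (c *: x + y) m = c *: act x m + act y m;
  tm_linr : forall (c : Zv) x m n, act x (c *: m + n) = c *: act x m + act x n;
  tm_T : forall s w, S s -> act (t s) (a w)
    = tw_new (tcomm s (val w)) (tup s (val w)) *: a (ltI s w)
      + tw_old (tcomm s (val w)) (tup s (val w)) *: a w }.

Variable act : V -> M -> M.
Hypothesis tm : tmodule_on act.

Lemma act0l m : act 0 m = 0.
Proof. exact: (slin0 (rho := id) erefl (fun c x y => tm_linl tm c x y m)). Qed.

Lemma act0r x : act x 0 = 0.
Proof. exact: (slin0 (rho := id) erefl (fun c m n => tm_linr tm c x m n)). Qed.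

Definition inI (J : W -> Prop) (w : I) := inW S J (val w).

Lemma act_span J h m : factor S J -> star_set star J = J ->
  lspan t (inW S J) h -> lspan a (inI J) m -> lspan a (inI J) (act h m).
Proof.
move=> fJ sJ sh; move: h sh m; apply: (hecke_ind cox hecke fJ).
- by move=> m _; rewrite act0l; apply: lspan0.
- move=> c x y IHx IHy m sm; rewrite (tm_linl tm).
  by apply: lspanD; [apply: lspanZ; apply: IHx | apply: IHy].
- by move=> x y IHx IHy m sm; rewrite (tmA tm); apply: IHx; apply: IHy.
- by move=> m; rewrite (tm1 tm).
move=> s Js m; elim=> [|c w {}m Jw _ IH]; first by rewrite act0r; apply: lspan0.
rewrite (tm_linr tm) (tm_T tm) ?(factorS fJ Js) //; last exact: (factorS fJ Js).
apply: lspanD => //; apply: lspanZ; apply: lspanD; apply: lspanZ.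
  by apply: lspan_basis; apply: (inW_ltI cox st fJ sJ).
exact: lspan_basis.
Qed.

(** It suffices to compare the actions of the T_s, where only the coefficients
    [tw_new] and [tw_old] matter. *)
Lemma act_semilin (rho : Zv -> Zv) (phi : V -> V) (psi : M -> M) :
  rho 1 = 1 ->
  (forall (c : Zv) x y, phi (c *: x + y) = rho c *: phi x + phi y) ->
  (forall (c : Zv) m n, psi (c *: m + n) = rho c *: psi m + psi n) ->
  (forall x y, phi (mul x y) = mul (phi x) (phi y)) ->
  (forall w, phi (t w) = t w) -> (forall w, psi (a w) = a w) ->
  (forall b1 b2, rho (tw_new b1 b2) = tw_new b1 b2) ->
  (forall b1 b2, rho (tw_old b1 b2) = tw_old b1 b2) ->
  (forall h, lspan t (fun=> True) h) ->
  forall h m, psi (act h m) = act (phi h) (psi m).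
Proof.
move=> r1 pL sL pM pt sa rn ro gen.
have p0 := slin0 r1 pL; have s0 := slin0 r1 sL.
apply: (hecke_ind_all cox gen hecke).
- by move=> m; rewrite act0l s0 p0 act0l.
- by move=> c x y IHx IHy m; rewrite (tm_linl tm) sL pL (tm_linl tm) IHx IHy.
- by move=> x y IHx IHy m; rewrite pM !(tmA tm) IHx IHy.
- by move=> m; rewrite pt !(tm1 tm).
move=> s Ss m; rewrite pt; elim: (a_gen m) => [|c w {}m _ _ IH].
  by rewrite act0r s0 act0r.
rewrite (tm_linr tm) !sL (tm_linr tm) IH sa; congr (_ *: _ + _).
by rewrite (tm_T tm) // sL (slinZ r1 sL) !sa rn ro.
Qed.

(** ** Gluing along complementary factors *)

Section Merge.
Variable J : W -> Prop.
Hypotheses (fJ : factor S J) (sJ : star_set star J = J).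
Local Notation J' := (compl S J).
Let fJ' := factor_compl fJ.
Let sJ' := star_compl st sJ.
Implicit Types w y z : I.

Lemma merge_invol y z : star (pr S J (val y) * pr S J' (val z))%g ==
  (pr S J (val y) * pr S J' (val z))^-1%g.
Proof.
rewrite (starM st) invgM (eqP (pr_invol cox st fJ sJ y)).
rewrite (eqP (pr_invol cox st fJ' sJ' z)) -!(prV cox fJ) -!(prV cox fJ').
by rewrite (pr_comm cox fJ).
Qed.

Definition merge y z : I := insubd y (pr S J (val y) * pr S J' (val z))%g.

Lemma val_merge y z : val (merge y z) = (pr S J (val y) * pr S J' (val z))%g.
Proof. by apply: insubdK; apply: merge_invol. Qed.

Lemma pr_merge1 y z : pr S J (val (merge y z)) = pr S J (val y).
Proof.
by rewrite val_merge (prM cox fJ) (prK cox fJ) (pr_pr_compl cox fJ) mulg1.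
Qed.

Lemma pr_merge2 y z : pr S J' (val (merge y z)) = pr S J' (val z).
Proof.
by rewrite val_merge (prM cox fJ') (prK cox fJ') (pr_compl_pr cox fJ) mul1g.
Qed.

Lemma merge_eq w y z : pr S J (val y) = pr S J (val w) ->
  pr S J' (val z) = pr S J' (val w) -> merge y z = w.
Proof.
by move=> e1 e2; apply: val_inj; rewrite val_merge e1 e2 (pr_split cox fJ).
Qed.

Lemma merge_ltI1 s y z : J s -> merge (ltI s y) z = ltI s (merge y z).
Proof.
move=> Js; have Ss := factorS fJ Js; apply: merge_eq; rewrite !(val_ltI cox st) //.
  by rewrite !(pr_ltimes cox fJ sJ) // pr_merge1.
by rewrite (pr_compl_ltimes cox fJ sJ) // pr_merge2.
Qed.

Lemma merge_ltI2 s y z : J' s -> merge y (ltI s z) = ltI s (merge y z).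
Proof.
move=> Js; have Ss := factorS fJ' Js; apply: merge_eq; rewrite !(val_ltI cox st) //.
  have := pr_compl_ltimes cox fJ' sJ' (val (merge y z)) Js.
  by rewrite (compl_compl fJ) => ->; rewrite pr_merge1.
by rewrite !(pr_ltimes cox fJ' sJ') // pr_merge2.
Qed.

(** [B] identifies the module with the tensor product of the modules of the two
    factors. *)
Variable B : M -> M -> M.
Hypothesis B_linl : forall (c : Zv) m1 m n, B (c *: m1 + m) n = c *: B m1 n + B m n.
Hypothesis B_linr : forall (c : Zv) m n1 n, B m (c *: n1 + n) = c *: B m n1 + B m n.
Hypothesis B_a : forall y z, B (a y) (a z) = a (merge y z).

Lemma B0l n : B 0 n = 0.
Proof. by have := B_linl (-1) 0 0 n; rewrite scaler0 addr0 scaleN1r addNr. Qed.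

Lemma B0r m : B m 0 = 0.
Proof. by have := B_linr (-1) m 0 0; rewrite scaler0 addr0 scaleN1r addNr. Qed.

(** Whether s commutes with the twisted involution or raises its length is
    decided by the component in the factor of s. *)
Lemma B_T1 s m n : J s -> B (act (t s) m) n = act (t s) (B m n).
Proof.
move=> Js; have Ss := factorS fJ Js.
elim: (a_gen m) => [|c y {}m _ _ IH]; first by rewrite act0r B0l act0r.
rewrite (tm_linr tm) !B_linl (tm_linr tm) IH; congr (_ *: _ + _).
clear IH; elim: (a_gen n) => [|d z {}n _ _ IHn]; first by rewrite !B0r act0r.
rewrite !B_linr (tm_linr tm) IHn; congr (_ *: _ + _).
rewrite (tm_T tm) // B_linl -[_ *: a y]addr0 B_linl B0l addr0 !B_a (tm_T tm) //.
rewrite merge_ltI1 // (comm_pr cox fJ sJ (val y)) // (up_pr cox fJ (val y)) //.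
rewrite (comm_pr cox fJ sJ (val (merge y z))) // (up_pr cox fJ (val (merge y z))) //.
by rewrite pr_merge1.
Qed.

Lemma B_T2 s m n : J' s -> B m (act (t s) n) = act (t s) (B m n).
Proof.
move=> Js; have Ss := factorS fJ' Js.
elim: (a_gen n) => [|c z {}n _ _ IH]; first by rewrite act0r B0r act0r.
rewrite (tm_linr tm) !B_linr (tm_linr tm) IH; congr (_ *: _ + _).
clear IH; elim: (a_gen m) => [|d y {}m _ _ IHn]; first by rewrite !B0l act0r.
rewrite !B_linl (tm_linr tm) IHn; congr (_ *: _ + _).
rewrite (tm_T tm) // B_linr -[_ *: a z]addr0 B_linr B0r addr0 !B_a (tm_T tm) //.
rewrite merge_ltI2 // (comm_pr cox fJ' sJ' (val z)) // (up_pr cox fJ' (val z)) //.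
rewrite (comm_pr cox fJ' sJ' (val (merge y z))) // (up_pr cox fJ' (val (merge y z))) //.
by rewrite pr_merge2.
Qed.

Lemma B_act1 h m n : lspan t (inW S J) h -> B (act h m) n = act h (B m n).
Proof.
move=> sh; move: h sh m n; apply: (hecke_ind cox hecke fJ).
- by move=> m n; rewrite !act0l B0l.
- by move=> c x y IHx IHy m n; rewrite !(tm_linl tm) B_linl IHx IHy.
- by move=> x y IHx IHy m n; rewrite !(tmA tm) IHx IHy.
- by move=> m n; rewrite !(tm1 tm).
by move=> s Js m n; apply: B_T1.
Qed.

Lemma B_act2 h m n : lspan t (inW S J') h -> B m (act h n) = act h (B m n).
Proof.
move=> sh; move: h sh m n; apply: (hecke_ind cox hecke fJ').
- by move=> m n; rewrite !act0l B0r.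
- by move=> c x y IHx IHy m n; rewrite !(tm_linl tm) B_linr IHx IHy.
- by move=> x y IHx IHy m n; rewrite !(tmA tm) IHx IHy.
- by move=> m n; rewrite !(tm1 tm).
by move=> s Js m n; apply: B_T2.
Qed.

Lemma act_merge h h' m n : lspan t (inW S J) h -> lspan t (inW S J') h' ->
  act (mul h h') (B m n) = B (act h m) (act h' n).
Proof. by move=> sh sh'; rewrite (tmA tm) -B_act2 // -B_act1. Qed.

Lemma bilinI_ind (P : M -> M -> Prop) :
  (forall n, P 0 n) -> (forall m, P m 0) ->
  (forall (c : Zv) m1 m n, P m1 n -> P m n -> P (c *: m1 + m) n) ->
  (forall (c : Zv) m n1 n, P m n1 -> P m n -> P m (c *: n1 + n)) ->
  (forall y z, inI J y -> inI J' z -> P (a y) (a z)) ->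
  forall m n, lspan a (inI J) m -> lspan a (inI J') n -> P m n.
Proof.
move=> P0l P0r Pl Pr Pt m n sm sn; elim: sm => [|c y {}m Jy _ IHm]; first exact: P0l.
apply: Pl IHm; elim: sn => [|d z {}n Jz _ IHn]; first exact: P0r.
by apply: Pr IHn; apply: Pt.
Qed.

Lemma coef_merge (co : M -> I -> Zv) :
  (forall (c : Zv) m n w, co (c *: m + n) w = c * co m w + co n w) ->
  (forall w w', co (a w) w' = (w == w')%:R) ->
  forall m n, lspan a (inI J) m -> lspan a (inI J') n ->
  forall w, co (B m n) w = co m (prI S J w) * co n (prI S J' w).
Proof.
move=> coL coa.
have co0 w : co 0 w = 0.
  by have := coL (-1) 0 0 w; rewrite scaler0 addr0 mulN1r addNr.
apply: bilinI_ind.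
- by move=> n w; rewrite B0l !co0 mul0r.
- by move=> m w; rewrite B0r !co0 mulr0.
- by move=> c m1 m n e1 e2 w; rewrite B_linl !coL e1 e2 mulrDl mulrA.
- by move=> c m n1 n e1 e2 w; rewrite B_linr !coL e1 e2 mulrDr mulrCA.
move=> y z Jy Jz w; rewrite B_a !coa -natrM mulnb.
congr ((nat_of_bool _)%:R); apply/eqP/andP => [<-|[/eqP ey /eqP ez]].
  split; apply/eqP; apply: val_inj.
    by rewrite (val_prI cox st fJ sJ) pr_merge1 Jy.
  by rewrite (val_prI cox st fJ' sJ') pr_merge2 Jz.
apply: merge_eq; first by rewrite ey (val_prI cox st fJ sJ) (prK cox fJ).
by rewrite ez (val_prI cox st fJ' sJ') (prK cox fJ').
Qed.

Lemma lin_merge (L : M -> M) (A : I -> M) :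
  (forall (c : Zv) m n, L (c *: m + n) = c *: L m + L n) ->
  (forall w, L (a w) = A w) ->
  (forall y z, inI J y -> inI J' z -> A (merge y z) = B (A y) (A z)) ->
  forall m n, lspan a (inI J) m -> lspan a (inI J') n ->
  L (B m n) = B (L m) (L n).
Proof.
move=> LL La AM; have L0 : L 0 = 0 := slin0 (rho := id) erefl LL.
apply: bilinI_ind.
- by move=> n; rewrite B0l !L0 B0l.
- by move=> m; rewrite B0r !L0 B0r.
- by move=> c m1 m n e1 e2; rewrite B_linl !LL e1 e2 B_linl.
- by move=> c m n1 n e1 e2; rewrite B_linr !LL e1 e2 B_linr.
by move=> y z Jy Jz; rewrite B_a !La AM.
Qed.

Section Bar.
Variables (hbar : V -> V) (bar : M -> M).
Hypothesis hb : hecke_bar_on t mul hbar.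
Hypothesis bar_lin : forall (c : Zv) m n, bar (c *: m + n) = lbar c *: bar m + bar n.
Hypothesis bar_act : forall x m, bar (act x m) = act (hbar x) (bar m).
Hypothesis bar1 : forall e : I, val e = 1%g -> bar (a e) = a e.
Hypothesis q1_free : forall m : M, (q + 1) *: m = 0 -> m = 0.

Lemma new_up_inj c (m n : M) :
  lbar (tw_new c true) *: m = lbar (tw_new c true) *: n -> m = n.
Proof.
rewrite /tw_new; case: c; last by rewrite lbar1 !scale1r.
rewrite lbarD lbar1 lbar_vpow => e; apply/eqP; rewrite -subr_eq0; apply/eqP.
apply: q1_free; have -> : q + 1 = q * (vpow int (- 2) + 1).
  by rewrite mulrDr mulr1 vpowKN addrC.
by rewrite -scalerA scalerBr e subrr scaler0.
Qed.

(** Since q + 1 is not a zero divisor, T_s a_w determines [a (ltI s w)]: two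
    semilinear maps that intertwine the generators agree if they agree at a_1. *)
Lemma agree_from1 (D : W -> Prop) (F G : M -> M) :
  factor S D -> star_set star D = D ->
  (forall (c : Zv) m n, F (c *: m + n) = lbar c *: F m + F n) ->
  (forall (c : Zv) m n, G (c *: m + n) = lbar c *: G m + G n) ->
  (forall s m, D s -> F (act (t s) m) = act (hbar (t s)) (F m)) ->
  (forall s m, D s -> G (act (t s) m) = act (hbar (t s)) (G m)) ->
  (forall e, val e = 1%g -> F (a e) = G (a e)) ->
  forall w, inI D w -> F (a w) = G (a w).
Proof.
move=> fD sD FL GL FT GT FG1; apply: (tw_ind cox st exch fD sD) => // s w Ds Dw up IH.
have := congr1 (act (hbar (t s))) IH; rewrite -FT // -GT //.
rewrite (tm_T tm) ?(factorS fD Ds) //; last exact: (factorS fD Ds).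
rewrite up FL GL (slinZ lbar1 FL) (slinZ lbar1 GL) IH => /addIr.
exact: new_up_inj.
Qed.

(** Both sides intertwine the generators of either factor, so they agree because
    they agree at 1. *)
Lemma bar_merge y z : inI J y -> inI J' z ->
  bar (B (a y) (a z)) = B (bar (a y)) (bar (a z)).
Proof.
move=> Jy Jz.
have sb D s : factor S D -> D s -> lspan t (inW S D) (hbar (t s)).
  move=> fD Ds; apply: (spanned_bar cox uK hecke hb fD).
  by apply: lspan_basis; apply: inW_in.
apply: (agree_from1 (F := fun n => bar (B (a y) n))
  (G := fun n => B (bar (a y)) (bar n)) fJ' sJ') => //.
- by move=> c m n; rewrite B_linr bar_lin.
- by move=> c m n; rewrite bar_lin B_linr.
- by move=> s m Js; rewrite B_T2 // bar_act.
- by move=> s m Js; rewrite bar_act B_act2 //; apply: sb.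
move=> e e1; rewrite (bar1 e1).
apply: (agree_from1 (F := fun m => bar (B m (a e)))
  (G := fun m => B (bar m) (a e)) fJ sJ) => //.
- by move=> c m n; rewrite B_linl bar_lin.
- by move=> c m n; rewrite bar_lin B_linl.
- by move=> s m Js; rewrite B_T1 // bar_act.
- by move=> s m Js; rewrite bar_act B_act1 //; apply: sb.
move=> e' e1'; rewrite (bar1 e1') B_a bar1 // val_merge e1 e1'.
by rewrite (pr1 cox fJ) (pr1 cox fJ') mulg1.
Qed.

Lemma bar_merge_span m n : lspan a (inI J) m -> lspan a (inI J') n ->
  bar (B m n) = B (bar m) (bar n).
Proof.
have b0 : bar 0 = 0 := slin0 lbar1 bar_lin.
move: m n; apply: bilinI_ind.
- by move=> n; rewrite B0l b0 B0l.
- by move=> m; rewrite B0r b0 B0r.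
- by move=> c m1 m n e1 e2; rewrite B_linl !bar_lin e1 e2 B_linl.
- by move=> c m n1 n e1 e2; rewrite B_linr !bar_lin e1 e2 B_linr.
exact: bar_merge.
Qed.

End Bar.
End Merge.
End TwistedModule.

(** * The twisted Kazhdan-Lusztig basis *)

Lemma lsq_lmon (a i : int) : lsq (lmon a i) = lmon a (2 * i).
Proof. by rewrite [LHS]lsubU intr_vpow. Qed.

Lemma lbar_lmon (a i : int) : lbar (lmon a i) = lmon a (- i).
Proof. by rewrite [LHS]lsubU intr_vpow. Qed.

Lemma lsq_lbar f : lsq (lbar f) = lbar (lsq f).
Proof.
elim/laurent_ind: f => [|f g IHf IHg|a i].
- by rewrite lbar0 lsq0 lbar0.
- by rewrite lbarD !lsqD lbarD IHf IHg.
by rewrite lbar_lmon !lsq_lmon lbar_lmon mulrN.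
Qed.

Lemma lsgn_at_laurent_fix p (x : Zv) :
  lsgn x = x -> lsgn (at_laurent p x) = at_laurent p x.
Proof.
move=> fx; elim/poly_ind: p => [|p c IH]; first by rewrite at_laurent0 lsgn0.
rewrite at_laurentD at_laurentM at_laurentX at_laurentC.
by rewrite lsgnD lsgnM IH fx lsgn_int.
Qed.

Lemma q_neq1 : vq int != 1.
Proof.
apply/eqP => /malgP /(_ 0); rewrite coef_1 [LHS]coef_vpow.
by [].
Qed.

(** Multiplication by q + 1 pushes the top coefficient up by two. *)
Lemma q1_free (f : Zv) : (vq int + 1) * f = 0 -> f = 0.
Proof.
move=> E; have [d [[//]|[fd top]]] := has_degree_exists f.
have := congr1 (mcoeff (d + 2)) E; rewrite mcoeff0 mulrDl mul1r mcoeffD.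
rewrite [X in X + _]coefMvpow addrK.
have -> : f@_(d + 2) = 0.
  by apply/eqP; apply: contraT => /top; lia.
by rewrite addr0 => e; rewrite e eqxx in fd.
Qed.

Lemma q1_free_malg (K : choiceType) (m : {malg Zv[K]}) :
  (vq int + 1) *: m = 0 -> m = 0.
Proof.
move=> E; apply/malgP => k; rewrite mcoeff0; apply: q1_free.
by have := congr1 (mcoeff k) E; rewrite [LHS]mcoeffZ mcoeff0.
Qed.

Section TwistedKL.
Variables (W : groupType) (S : W -> Prop) (star : W -> W).
Hypotheses (cox : coxeter_system S) (st : preserving_involution S star).
Variables (K : kl_theory S) (Tw : twisted_theory star K).
Local Notation ell := (ell S).
Local Notation I := (twisted_invol star).
Local Notation H := {malg Zv[W]}.
Local Notation M := {malg Zv[I]}.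
Local Notation q := (vq int).
Local Notation c := (kl_c K).
Local Notation C := (tw_C Tw).
Local Notation A := (tw_A Tw).
Local Notation act := (tw_act Tw).
Local Notation bar := (tw_bar Tw).
Local Notation hbar := (tw_hbar Tw).
Local Notation mul := (tw_mul Tw).

Lemma q2K : vpow int (- 4) * q ^+ 2 = 1.
Proof. by rewrite expr2 -vpowD; apply: vpowNK. Qed.

Lemma exch s w r : S s -> S r -> ell (s * w * r)%g = ell w ->
  ell (s * w)%g = ell (w * r)%g -> (s * w = w * r)%g.
Proof.
apply: (exchange cox (kl_hecke cox K) _ q_neq1).
exact: (@basis_free W).
Qed.

Lemma tw_hecke : hecke_on S (@basis W) (q ^+ 2) mul.
Proof. exact: (hecke_malg cox (tw_mulP Tw)). Qed.

Lemma tw_hbar_on : hecke_bar_on (@basis W) mul hbar.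
Proof. exact: (hecke_bar_malg (tw_hbarP Tw)). Qed.

Lemma tw_lin_l (b : Zv) (x y : H) (m : M) :
  act (b *: x + y) m = b *: act x m + act y m.
Proof.
apply: etrans (tw_actDl (tw_actP Tw) _ _ _) _; congr (_ + _).
have Z := tw_actZl (tw_actP Tw) b x m; exact_no_check Z.
Qed.

Lemma tw_lin_r (b : Zv) (x : H) (m n : M) :
  act x (b *: m + n) = b *: act x m + act x n.
Proof.
apply: etrans (tw_actDr (tw_actP Tw) _ _ _) _; congr (_ + _).
have Z := tw_actZr (tw_actP Tw) b x m; exact_no_check Z.
Qed.

Lemma tw_act_gen s (w : I) : S s -> act (basis s) (basis w) =
  tw_new (tcomm star s (val w)) (tup S s (val w)) *: basis (ltI s w)
  + tw_old (tcomm star s (val w)) (tup S s (val w)) *: basis w.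
Proof.
move=> Ss; have Ss' : S (star s) by apply/(star_S st).
have vl := val_ltI cox st w Ss; have tP := tw_actP Tw.
have sl := ell_sl cox (val w) Ss.
have [cm|nc] := boolP (tcomm star s (val w)).
  have e : val (ltI s w) = (s * val w)%g by rewrite vl ltimesE cm.
  have [up|dn] := boolP (tup S s (val w)).
    have Z := tw_act_up_comm tP Ss vl e; apply: etrans (Z _) _; last by [].
    by rewrite e; apply: bruhat_gen.
  have Z := tw_act_down_comm tP Ss vl e; apply: etrans (Z _) _; last by [].
  rewrite e -{2}[val w](genKg cox Ss); apply: bruhat_gen => //.
  by rewrite (genKg cox Ss); move: dn; rewrite /tup; lia.
have e : val (ltI s w) = (s * val w * star s)%g by rewrite vl ltimesE (negbTE nc).
have el := ell_sws cox st exch Ss nc.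
have [up|dn] := boolP (tup S s (val w)).
  have Z := tw_act_up tP Ss vl e; apply: etrans (Z _) _; last first.
    by rewrite scale1r scale0r addr0.
  rewrite e; split; last by move=> e2; move: el; rewrite -e2 up; lia.
  apply: (rt_trans _ _ _ (s * val w)%g); first by case: (bruhat_gen Ss up).
  by apply: bruhat_genr => //; rewrite el up; move: up sl; rewrite /tup; lia.
have Z := tw_act_down tP Ss vl e; apply: etrans (Z _) _; last by [].
rewrite (negbTE dn) in el; rewrite e; move: dn; rewrite /tup -leqNgt => dn.
have lt : (ell (s * val w * star s)%g < ell (s * val w)%g)%N.
  by have := ell_sr cox (s * val w)%g Ss'; lia.
have lt2 : (ell (s * val w)%g < ell (val w))%N by lia.
split; last by move=> e2; move: el; rewrite e2; lia.
apply: (rt_trans _ _ _ (s * val w)%g).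
  rewrite -{2}[(s * val w)%g](gengK cox Ss'); apply: bruhat_genr => //.
  by rewrite (gengK cox Ss').
rewrite -{2}[val w](genKg cox Ss).
suff : bruhat_lt S (s * val w)%g (s * (s * val w))%g by case.
by apply: bruhat_gen => //; rewrite (genKg cox Ss).
Qed.

Lemma tw_module : tmodule_on S (@basis W) mul (@basis I) act.
Proof.
split.
- exact: (tw_actM (tw_actP Tw)).
- exact: (tw_act1 (tw_actP Tw)).
- by move=> b x y m; have Z := tw_lin_l b x y m; exact_no_check Z.
- by move=> b x m n; have Z := tw_lin_r b x m n; exact_no_check Z.
by move=> s w Ss; have Z := tw_act_gen w Ss; exact_no_check Z.
Qed.

(** ** The elements C_w *)

(** By definition C_w is c_w with v replaced by v^2, so the properties of the C_w
    follow from those of the c_w. *)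
Lemma tw_CE2 w : C w = mapc lsq (c w).
Proof.
apply/malgP => y; rewrite (coef_mapc lsq0) kl_coef lsqM lsq_vpow.
rewrite [lsq (LP _ _ _)]lsq_at_laurent; apply: etrans (tw_CE Tw y w) _.
by congr (vpow int _ * _); lia.
Qed.

Lemma lsq_q : lsq q = q ^+ 2.
Proof. by rewrite [LHS]lsq_vpow expr2 -vpowD. Qed.

Lemma lsq_lin (b : Zv) (x y : H) :
  mapc lsq (b *: x + y) = lsq b *: mapc lsq x + mapc lsq y.
Proof. by rewrite (mapcD lsqD lsq0) (mapcZ lsq0 lsqM). Qed.

Lemma lsq_mul x y : mapc lsq (kl_mul K x y) = mul (mapc lsq x) (mapc lsq y).
Proof.
have h2 : hecke_on S (@basis W) (lsq q) mul by rewrite lsq_q; apply: tw_hecke.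
have L2 (w : W) := mapc_basis lsq0 lsq1 w.
have Z := mapc_mul cox (@basis_gen W) lsqD lsq1 lsqN (kl_hecke cox K) h2
  (phi := mapc lsq) lsq_lin L2 x y.
exact Z.
Qed.

Lemma lsq_bar x : mapc lsq (kl_bar K x) = hbar (mapc lsq x).
Proof.
have h2 : hecke_on S (@basis W) (lsq q) mul by rewrite lsq_q; apply: tw_hecke.
have L2 (w : W) := mapc_basis lsq0 lsq1 w.
have Z := mapc_bar cox (@basis_gen W) lsqD lsqM lsq1 lsqN qK (kl_hecke cox K) h2
  (phi := mapc lsq) lsq_lin L2 (kl_bar_on K) tw_hbar_on lsq_lbar x.
exact Z.
Qed.

Lemma tw_bar_C w : hbar (C w) = C w.
Proof. by rewrite tw_CE2 -lsq_bar kl_bar_c. Qed.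

Lemma tw_C_split J w : factor S J ->
  C w = mul (C (pr S J w)) (C (pr S (compl S J) w)).
Proof. by move=> fJ; rewrite !tw_CE2 {1}(kl_c_split cox K w fJ) lsq_mul. Qed.

Lemma tw_C_spanned J w : factor S J -> inW S J w -> spanned (inW S J) (C w).
Proof.
move=> fJ Jw y; rewrite tw_CE2 (coef_mapc lsq0) => nz.
apply: (kl_closed cox (K := K) fJ Jw); apply: contraNneq nz => ->.
by rewrite lsq0.
Qed.

Lemma tw_C_sign w : mapc lsgn (C w) = C w.
Proof.
apply/malgP => y; rewrite (coef_mapc lsgn0) (tw_CE Tw y w) lsgnM.
rewrite lsgn_at_laurent_fix; last by rewrite expr2 lsgnM lsgn_q.
by rewrite lsgn_vpow abszN -signr_odd absz_nat odd_double expr0 mul1r.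
Qed.

(** ** The elements A_w *)

Definition LPs (y w : I) : Zv := at_laurent (tw_P Tw y w) q.

Lemma tw_coef y w : (A w)@_y = vpow int (- (ell (val w))%:Z) * LPs y w.
Proof. exact: tw_AE. Qed.

Lemma LPsww w : LPs w w = 1.
Proof. by rewrite /LPs tw_P_nlt ?eqxx ?at_laurent1 //; apply: bruhat_irr. Qed.

Lemma LPs_nlt y w : ~ bruhat_lt S (val y) (val w) -> y != w -> LPs y w = 0.
Proof. by move=> nlt ne; rewrite /LPs tw_P_nlt // (negbTE ne) at_laurent0. Qed.

Lemma tw_diag w : (A w)@_w = vpow int (- (ell (val w))%:Z).
Proof. by rewrite tw_coef LPsww mulr1. Qed.

Lemma tw_supp w y : (A w)@_y != 0 -> bruhat_le S (val y) (val w).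
Proof.
move=> nz; have [->|ne] := eqVneq y w; first exact: rt_refl.
apply: contrapT => nle; case/eqP: nz.
by rewrite tw_coef LPs_nlt ?mulr0 // => -[].
Qed.

Lemma tw_tri w y : (A w)@_y != 0 -> y != w -> (ell (val y) < ell (val w))%N.
Proof.
move=> /tw_supp/bruhat_le_ell [/val_inj ->|//]; by rewrite eqxx.
Qed.

Lemma tw_neg w y : y != w -> negdeg (vpow int (ell (val y)) * (A w)@_y).
Proof.
move=> ne; have [lt|nlt] := EM (bruhat_lt S (val y) (val w)).
  by rewrite tw_coef; apply: negdeg_kl; apply: tw_P_deg.
by rewrite tw_coef LPs_nlt // !mulr0; apply: negdeg0.
Qed.

Lemma tw_closed J w y : factor S J -> inI S J w -> (A w)@_y != 0 -> inI S J y.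
Proof. move=> fJ Jw /tw_supp le; exact: (bruhat_factor cox fJ le Jw). Qed.

Lemma tw_A_spanned J w : factor S J -> inI S J w -> spanned (@inI _ S star J) (A w).
Proof. by move=> fJ Jw y; apply: tw_closed. Qed.

Lemma tw_bar_lin (b : Zv) (m n : M) : bar (b *: m + n) = lbar b *: bar m + bar n.
Proof.
rewrite (tw_barD (tw_barP Tw)); congr (_ + _).
have act1 (d : Zv) (m' : M) : act (d *: basis 1%g) m' = d *: m'.
  have Z := tw_actZl (tw_actP Tw) d (basis 1%g) m'; apply: etrans Z _.
  by congr (_ *: _); apply: (tw_act1 (tw_actP Tw)).
rewrite -act1 (tw_barM (tw_barP Tw)) -act1; congr (act _ _).
have Z := hecke_barZ tw_hecke tw_hbar_on b (basis 1%g); apply: etrans Z _.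
by congr (_ *: _); apply: (hecke_bar1 tw_hbar_on).
Qed.

Lemma tw_bar0 : bar 0 = 0.
Proof.
by apply: (@addrI _ (bar 0)); rewrite -(tw_barD (tw_barP Tw)) !addr0.
Qed.

Lemma tw_barZ (b : Zv) (m : M) : bar (b *: m) = lbar b *: bar m.
Proof. by rewrite -[b *: m]addr0 tw_bar_lin tw_bar0 addr0. Qed.

Lemma tw_unique (m : M) w : bar m = m ->
  m@_w = vpow int (- (ell (val w))%:Z) ->
  (forall y, y != w -> negdeg (vpow int (ell (val y)) * m@_y)) -> m = A w.
Proof.
exact: (bar_invariant_unique (len := fun y : I => ell (val y)) tw_diag tw_tri
  (tw_barD (tw_barP Tw)) tw_barZ (tw_bar_A Tw) tw_neg).
Qed.

Lemma tw_coords_bar e : bar (lincomb A e) = lincomb A e ->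
  forall z, lbar e@_z = e@_z.
Proof.
exact: (coords_bar (len := fun y : I => ell (val y)) tw_diag tw_tri
  (tw_barD (tw_barP Tw)) tw_barZ (tw_bar_A Tw)).
Qed.

Lemma hsigma_bar x y z : lbar (tw_hsigma Tw x y)@_z = (tw_hsigma Tw x y)@_z.
Proof.
apply: tw_coords_bar; rewrite -tw_hsigmaE (tw_barM (tw_barP Tw)).
by rewrite tw_bar_C tw_bar_A.
Qed.

Lemma tw_A_sign w : mapc lsgn (A w) = (-1) ^+ ell (val w) *: A w.
Proof.
apply/malgP => y; rewrite [LHS](coef_mapc lsgn0) [RHS]mcoeffZ.
rewrite tw_coef lsgnM lsgn_vpow [lsgn (LPs _ _)]lsgn_at_laurent mulrA.
by rewrite abszN.
Qed.

Lemma lsgn_tw_new b1 b2 : lsgn (tw_new b1 b2) = tw_new b1 b2.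
Proof.
rewrite /tw_new; case: b2; case: b1;
  by rewrite ?expr2 ?lsgnD ?lsgnN ?lsgnM ?lsgn1 ?lsgn_q.
Qed.

Lemma lsgn_tw_old b1 b2 : lsgn (tw_old b1 b2) = tw_old b1 b2.
Proof.
rewrite /tw_old; case: b2; case: b1;
  by rewrite ?expr2 ?lsgnD ?lsgnN ?lsgnM ?lsgn1 ?lsgn0 ?lsgn_q ?lsgnM ?lsgn_q.
Qed.

Lemma sign_act h m : mapc lsgn (act h m) = act (mapc lsgn h) (mapc lsgn m).
Proof.
have hk' : hecke_on S (@basis W) (lsgn (q ^+ 2)) mul.
  by rewrite expr2 lsgnM lsgn_q -expr2; apply: tw_hecke.
have L1 (X : choiceType) (b : Zv) (m1 m2 : {malg Zv[X]}) :
    mapc lsgn (b *: m1 + m2) = lsgn b *: mapc lsgn m1 + mapc lsgn m2.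
  by rewrite (mapcD lsgnD lsgn0) (mapcZ lsgn0 lsgnM).
have L2 (X : choiceType) (k : X) := mapc_basis lsgn0 lsgn1 k.
have Z1 := mapc_mul cox (@basis_gen W) lsgnD lsgn1 lsgnN tw_hecke hk'
  (phi := mapc lsgn) (L1 W) (L2 W).
have Z := act_semilin cox tw_hecke (@basis_gen I) tw_module
  (phi := mapc lsgn) (psi := mapc lsgn) lsgn1 (L1 W) (L1 I) Z1 (L2 W) (L2 I)
  lsgn_tw_new lsgn_tw_old (@basis_gen W) h m.
exact Z.
Qed.

Lemma tw_actZ (b : Zv) x m : act x (b *: m) = b *: act x m.
Proof. have Z := tw_actZr (tw_actP Tw) b x m; exact_no_check Z. Qed.

Lemma hsigma_parity x y z :
  parity (odd (ell (val y) + ell (val z))) (tw_hsigma Tw x y)@_z.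
Proof.
apply: (sign_coords (len := fun y : I => ell (val y)) tw_diag tw_tri tw_A_sign).
by rewrite -tw_hsigmaE sign_act tw_C_sign tw_A_sign tw_actZ.
Qed.

Lemma htilde_bar x y z : lbar (tw_htilde Tw x y)@_z = (tw_htilde Tw x y)@_z.
Proof. apply: (mul3_coords_bar cox); exact/esym/(tw_htildeE Tw). Qed.

Lemma htilde_parity x y z :
  parity (odd (ell (val y) + ell z)) (tw_htilde Tw x y)@_z.
Proof.
have := mul3_parity cox (esym (tw_htildeE Tw x y)) (w := z).
rewrite (ellV cox) (ell_star cox st) => pz.
suff -> : odd (ell (val y) + ell z) =
  odd (ell x + ell (val y) + ell x + ell z) by [].
by lia.
Qed.

End TwistedKL.

(** ** Products over complementary factors *)

Lemma lincomb_linr (K : choiceType) (V : lmodType Zv) (f g : K -> V) (b : Zv) m :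
  lincomb (fun k => b *: f k + g k) m = b *: lincomb f m + lincomb g m.
Proof.
rewrite /lincomb scaler_sumr -big_split; apply: eq_bigr => k _ /=.
by rewrite scalerDr !scalerA mulrC.
Qed.

HB.lock Definition bilin (K1 K2 : choiceType) (V : lmodType Zv)
    (B : K1 -> K2 -> V) (m : {malg Zv[K1]}) (n : {malg Zv[K2]}) : V :=
  lincomb (fun y => lincomb (B y) n) m.

Section Bilin.
Variables (K1 K2 : choiceType) (V : lmodType Zv) (B : K1 -> K2 -> V).

Lemma bilin_linl (b : Zv) m1 m n :
  bilin B (b *: m1 + m) n = b *: bilin B m1 n + bilin B m n.
Proof. rewrite bilin.unlock; exact: lincomb_lin. Qed.

Lemma bilin_linr (b : Zv) m n1 n :
  bilin B m (b *: n1 + n) = b *: bilin B m n1 + bilin B m n.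
Proof.
rewrite bilin.unlock -lincomb_linr; congr (lincomb _ m).
by apply/funext => y; apply: lincomb_lin.
Qed.

Lemma bilin_basis y z : bilin B (basis y) (basis z) = B y z.
Proof. by rewrite bilin.unlock !lincomb_basis. Qed.
End Bilin.

Section Split.
Variables (W : groupType) (S : W -> Prop) (star : W -> W).
Hypotheses (cox : coxeter_system S) (st : preserving_involution S star).
Variables (K : kl_theory S) (Tw : twisted_theory star K).
Local Notation ell := (ell S).
Local Notation I := (twisted_invol star).
Local Notation H := {malg Zv[W]}.
Local Notation M := {malg Zv[I]}.
Local Notation q := (vq int).
Local Notation C := (tw_C Tw).
Local Notation A := (tw_A Tw).
Local Notation act := (tw_act Tw).
Local Notation bar := (tw_bar Tw).
Local Notation mul := (tw_mul Tw).
Variable J : W -> Prop.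
Hypotheses (fJ : factor S J) (sJ : star_set star J = J).
Local Notation J' := (compl S J).
Let fJ' := factor_compl fJ.
Let sJ' := star_compl st sJ.
Local Notation merge := (@merge W S star J).

Definition glue : M -> M -> M := bilin (fun y z => basis (merge y z)).

Lemma glue_linl (b : Zv) (m1 m n : M) :
  glue (b *: m1 + m) n = b *: glue m1 n + glue m n.
Proof. exact: bilin_linl. Qed.

Lemma glue_linr (b : Zv) (m n1 n : M) :
  glue m (b *: n1 + n) = b *: glue m n1 + glue m n.
Proof. exact: bilin_linr. Qed.

Lemma glue_basis y z : glue (basis y) (basis z) = basis (merge y z).
Proof. exact: bilin_basis. Qed.

Lemma glue_coef (m n : M) w : spanned (@inI _ S star J) m ->
  spanned (@inI _ S star J') n ->
  (glue m n)@_w = m@_(prI S J w) * n@_(prI S J' w).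
Proof.
move=> /spanned_lspan sm /spanned_lspan sn.
have L1 (a : Zv) (m1 m2 : M) w' := coef_lin a m1 m2 w'.
have L2 (w1 w2 : I) := coef_basis w1 w2.
have Z := coef_merge cox st fJ sJ glue_linl glue_linr glue_basis
  (co := fun m w => m@_w) L1 L2 sm sn w.
exact Z.
Qed.

Lemma glue_bar (m n : M) : spanned (@inI _ S star J) m ->
  spanned (@inI _ S star J') n -> bar (glue m n) = glue (bar m) (bar n).
Proof.
move=> /spanned_lspan sm /spanned_lspan sn.
have Z := bar_merge_span cox st (exch cox K) q2K (tw_hecke cox Tw) (@basis_gen I)
  (tw_module cox st Tw) fJ sJ glue_linl glue_linr glue_basis
  (tw_hbar_on Tw) (tw_bar_lin cox Tw) (tw_barM (tw_barP Tw))
  (tw_bar1 (tw_barP Tw)) (@q1_free_malg I) sm sn.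
exact Z.
Qed.

Lemma glue_act (h h' : H) (m n : M) : spanned (inW S J) h ->
  spanned (inW S J') h' -> act (mul h h') (glue m n) = glue (act h m) (act h' n).
Proof.
move=> /spanned_lspan sh /spanned_lspan sh'.
have Z := act_merge cox st (tw_hecke cox Tw) (@basis_gen I)
  (tw_module cox st Tw) fJ sJ glue_linl glue_linr glue_basis m n sh sh'.
exact Z.
Qed.

Lemma prI_inI w : inI S J (prI S J w : I).
Proof. by rewrite /inI (val_prI cox st fJ sJ); apply: inWpr. Qed.

Lemma prI'_inI w : inI S J' (prI S J' w : I).
Proof. by rewrite /inI (val_prI cox st fJ' sJ'); apply: inWpr. Qed.

Lemma merge_prI w : merge (prI S J w) (prI S J' w) = w.
Proof.
apply: merge_eq; rewrite // ?(val_prI cox st fJ sJ) ?(val_prI cox st fJ' sJ').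
  exact: inWpr.
exact: inWpr.
Qed.

Lemma prI_merge1 y z : inI S J y -> prI S J (merge y z) = y.
Proof.
move=> Jy; apply: val_inj; rewrite (val_prI cox st fJ sJ).
by rewrite (pr_merge1 cox st fJ sJ).
Qed.

Lemma prI_merge2 y z : inI S J' z -> prI S J' (merge y z) = z.
Proof.
move=> Jz; apply: val_inj; rewrite (val_prI cox st fJ' sJ').
by rewrite (pr_merge2 cox st fJ sJ).
Qed.

Lemma ell_prI w : ell (val w) = (ell (val (prI S J w : I)) + ell (val (prI S J' w : I)))%N.
Proof.
rewrite (val_prI cox st fJ sJ) (val_prI cox st fJ' sJ').
exact: (ell_split cox fJ).
Qed.

Let spanA D w (fD : factor S D) (Dw : inI S D w) :
  spanned (@inI _ S star D) (A w) := tw_A_spanned cox fD Dw.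

(** The same argument as for [kl_c_mul]. *)
Lemma tw_A_merge y z : inI S J y -> inI S J' z ->
  A (merge y z) = glue (A y) (A z).
Proof.
move=> Jy Jz; have sy := spanA fJ Jy.
have sz := spanA fJ' Jz.
apply/esym/tw_unique => //.
- rewrite glue_bar; [|exact sy|exact sz].
  by rewrite !tw_bar_A.
- rewrite (glue_coef _ sy sz) prI_merge1 // prI_merge2 // !tw_diag -vpowD.
  by rewrite (ell_prI (merge y z)) prI_merge1 // prI_merge2 // PoszD opprD.
move=> w ne; rewrite (glue_coef _ sy sz).
set y1 := prI S J w; set y2 := prI S J' w.
have -> : vpow int (ell (val w)) = vpow int (ell (val y1)) * vpow int (ell (val y2)).
  by rewrite (ell_prI w) -vpowD PoszD.
rewrite mulrACA; have [e1|ne1] := eqVneq y1 y.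
  rewrite e1 tw_diag vpowKN mul1r; apply: tw_neg; apply: contra_neq ne => e2.
  by rewrite -e1 -e2 merge_prI.
have [->|ne2] := eqVneq y2 z.
  by rewrite tw_diag vpowKN mulr1; apply: tw_neg.
by apply: negdegM; apply: tw_neg.
Qed.

Lemma LPs_split y w :
  LPs Tw y w = LPs Tw (prI S J y) (prI S J w) * LPs Tw (prI S J' y) (prI S J' w).
Proof.
apply: (vpow_cancel (i := - (ell (val w))%:Z)); rewrite -tw_coef.
rewrite -{1}(merge_prI w) (tw_A_merge (prI_inI w) (prI'_inI w)).
rewrite (glue_coef _ (spanA fJ (prI_inI w))
  (spanA fJ' (prI'_inI w))).
by rewrite !tw_coef mulrACA -vpowD (ell_prI w) PoszD opprD.
Qed.

Lemma tw_act_spanned D x m : factor S D -> star_set star D = D ->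
  spanned (inW S D) x -> spanned (@inI _ S star D) m ->
  spanned (@inI _ S star D) (act x m).
Proof.
move=> fD sD /spanned_lspan sx /spanned_lspan sm; apply: lspan_spanned.
exact (act_span cox st (tw_hecke cox Tw) (tw_module cox st Tw) fD sD sx sm).
Qed.

Lemma hsigma_spanned D x y : factor S D -> star_set star D = D ->
  inW S D x -> inI S D y -> spanned (@inI _ S star D) (tw_hsigma Tw x y).
Proof.
move=> fD sD Dx Dy.
have cl w w' := @tw_closed _ _ _ cox _ Tw D w w' fD.
have tri := tw_tri (Tw := Tw).
apply: (spanned_coords (len := fun y : I => ell (val y)) (tw_diag Tw) tri cl).
rewrite -tw_hsigmaE; apply: tw_act_spanned => //.
  exact: (tw_C_spanned cox fD Dx).
exact: (spanA fD Dy).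
Qed.

Lemma hsigma_split x y z : (tw_hsigma Tw x y)@_z =
  (tw_hsigma Tw (pr S J x) (prI S J y))@_(prI S J z) *
  (tw_hsigma Tw (pr S J' x) (prI S J' y))@_(prI S J' z).
Proof.
have s1 := hsigma_spanned fJ sJ (inWpr cox x fJ) (prI_inI y).
have s2 := hsigma_spanned fJ' sJ' (inWpr cox x fJ') (prI'_inI y).
rewrite -(glue_coef z s1 s2); congr (mcoeff z).
have tri := tw_tri (Tw := Tw).
apply: (lincomb_inj (len := fun y : I => ell (val y)) (tw_diag Tw) tri).
rewrite -[LHS]tw_hsigmaE -{1}(merge_prI y) (tw_A_merge (prI_inI y) (prI'_inI y)).
rewrite (tw_C_split cox Tw x fJ).
rewrite (glue_act _ _ (tw_C_spanned cox fJ (inWpr cox x fJ))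
  (tw_C_spanned cox fJ' (inWpr cox x fJ'))).
rewrite [X in glue X _]tw_hsigmaE [X in glue _ X]tw_hsigmaE.
have L1 (a : Zv) (m1 m2 : M) := lincomb_lin A a m1 m2.
have L2 (w : I) := lincomb_basis A w.
have Z := lin_merge glue_linl glue_linr glue_basis
  (L := lincomb A) (A := A) L1 L2 tw_A_merge (spanned_lspan s1) (spanned_lspan s2).
exact: esym Z.
Qed.

Lemma htilde_split x y z : (tw_htilde Tw x y)@_z =
  (tw_htilde Tw (pr S J x) (prI S J y))@_(pr S J z) *
  (tw_htilde Tw (pr S J' x) (prI S J' y))@_(pr S J' z).
Proof.
have e (D : W -> Prop) (fD : factor S D) (sD : star_set star D = D) :
    (star (pr S D x))^-1%g = pr S D (star x)^-1%g.
  by rewrite (prV cox fD) -{2}sD (pr_star cox st x fD).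
apply: (mul3_coords_split cox fJ (esym (tw_htildeE Tw x y))).
  rewrite -(val_prI cox st fJ sJ) -e //; exact: esym (tw_htildeE Tw _ _).
rewrite -(val_prI cox st fJ' sJ') -e //; exact: esym (tw_htildeE Tw _ _).
Qed.

End Split.

(** ** Restriction to a stable factor *)

Lemma additive_scale2 (V V' : lmodType Zv) (f : V -> V') :
  {morph f : x y / x + y} -> (forall (a : Zv) x, f (a *: x) = a *: f x) ->
  forall (a b : Zv) x y, f (a *: x + b *: y) = a *: f x + b *: f y.
Proof. by move=> fD fZ a b x y; rewrite fD !fZ. Qed.

Section RestrictTwisted.
Variables (W : groupType) (S J : W -> Prop) (star : W -> W).
Hypotheses (cox : coxeter_system S) (fJ : factor S J).
Hypotheses (st : preserving_involution S star) (sJ : star_set star J = J).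
Local Notation G := (gen_group J).
Local Notation SG := (@gen_group_gens W J).
Local Notation I := (twisted_invol star).
Local Notation q := (vq int).

Definition starG (g : G) : G := insubd g (star (val g)).

Lemma val_starG g : val (starG g) = star (val g).
Proof.
apply: insubdK; apply/(gen_predP cox _ fJ).
by rewrite -{1}sJ (pr_star cox st _ fJ) (val_pr cox fJ).
Qed.

Lemma preserving_starG : preserving_involution SG starG.
Proof.
split.
- move=> x y; apply: val_inj; rewrite val_starG 2!gvalM !val_starG.
  exact: (starM st).
- by move=> x; apply: val_inj; rewrite !val_starG (starK st).
move=> s; rewrite /gen_group_gens val_starG.
have -> : J (star (val s)) = J (val s) := congr1 (fun D => D (val s)) sJ.
by [].
Qed.

Local Notation IG := (twisted_invol starG).

Lemma iG_invol (g : IG) : star (val (val g)) == (val (val g))^-1%g.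
Proof. by rewrite -val_starG (eqP (valP g)) gvalV. Qed.

Definition iG (g : IG) : I := Sub (val (val g)) (iG_invol g).

Lemma val_iG g : val (iG g) = val (val g).
Proof. by rewrite SubK. Qed.

Lemma iG_inj : injective iG.
Proof. by move=> x y /(congr1 val); rewrite !val_iG => /val_inj/val_inj. Qed.

Lemma inI_iG (w : I) : inI S J w <-> in_image iG w.
Proof.
split=> [Jw|[g <-]]; last by rewrite /inI val_iG; apply: (val_pr cox fJ).
have [g eg] := lift_pr cox fJ Jw.
have ge : starG g == g^-1%g.
  by rewrite -(inj_eq val_inj) val_starG gvalV eg; apply: (valP w).
by exists (Sub g ge); apply: val_inj; rewrite val_iG SubK.
Qed.

Lemma val_ltimes (s g : G) : val (ltimes starG s g) = ltimes star (val s) (val g).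
Proof.
by rewrite /ltimes -val_starG -!gvalM (inj_eq val_inj); case: (_ == _).
Qed.

Local Notation ext := (extend (val : G -> W)).
Local Notation res := (restrict (val : G -> W)).
Local Notation extI := (extend iG).
Local Notation resI := (restrict iG).
Implicit Types m n : {malg Zv[IG]}.

Lemma extI_spanned m : spanned (@inI _ S star J) (extI m).
Proof. by move=> w /(spanned_extend) /inI_iG. Qed.

Lemma extI_res (m : {malg Zv[I]}) :
  spanned (@inI _ S star J) m -> extI (resI m) = m.
Proof.
move=> sx; apply: (extend_restrict iG_inj) => w /sx; by move/inI_iG.
Qed.

Lemma extI_inj : injective extI.
Proof. exact: (extend_inj iG_inj). Qed.

Lemma extI_basis g : extI (basis g) = basis (iG g).
Proof. exact: extend_basis. Qed.

Lemma extID m n : extI (m + n) = extI m + extI n.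
Proof. exact: extendD. Qed.

Lemma extIZ (a : Zv) m : extI (a *: m) = a *: extI m.
Proof. exact: extendZ. Qed.

Lemma extI_lin (a b : Zv) (x y : IG) :
  extI (a *: basis x + b *: basis y) = a *: basis (iG x) + b *: basis (iG y).
Proof.
have Z := additive_scale2 extID extIZ a b (basis x) (basis y).
have Z' := congr2 (fun u v : {malg Zv[I]} => a *: u + b *: v)
  (extI_basis x) (extI_basis y).
exact_no_check (etrans Z Z').
Qed.

Variables (K : kl_theory S) (Tw : twisted_theory star K).
Local Notation KG := (kl_restrict cox fJ K).
Local Notation mul2 := (mulG (J := J) (tw_mul Tw)).

Definition actG (x : {malg Zv[G]}) m := resI (tw_act Tw (ext x) (extI m)).

Lemma ext_actG x m : extI (actG x m) = tw_act Tw (ext x) (extI m).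
Proof.
apply: extI_res; apply: (tw_act_spanned cox st fJ sJ).
  exact: (@ext_spanned _ _ _ cox fJ x).
exact: (@extI_spanned m).
Qed.

Definition barI m := resI (tw_bar Tw (extI m)).

(** The bar-invariant A_w with w in the factor span the same submodule as the
    a_w with w in the factor. *)
Lemma tw_bar_spanned (m : {malg Zv[I]}) : spanned (@inI _ S star J) m ->
  spanned (@inI _ S star J) (tw_bar Tw m).
Proof.
move=> sm; have cl w w' := @tw_closed _ _ _ cox _ Tw J w w' fJ.
have tri := tw_tri (Tw := Tw).
have [e se ->] := triangular_span (len := fun y : I => ell S (val y))
  (tw_diag Tw) tri cl sm.
elim/spanned_ind: se => [|a k {}e Dk _ IH].
  by rewrite lincomb0 (tw_bar0 Tw); apply: spanned0.
rewrite lincomb_lin lincomb_basis (tw_bar_lin cox) tw_bar_A.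
apply: spannedD; last exact: IH.
apply: spannedZ; exact: (tw_A_spanned cox fJ Dk).
Qed.

Lemma ext_barI m : extI (barI m) = tw_bar Tw (extI m).
Proof. by apply: extI_res; apply: tw_bar_spanned; apply: (@extI_spanned m). Qed.

Lemma actG_Zl (b : Zv) x m : actG (b *: x) m = b *: actG x m.
Proof.
apply: extI_inj; apply: etrans (ext_actG _ m) _.
apply: etrans (congr1 ((tw_act Tw)^~ (extI m)) (extZ b x)) _.
have Z := tw_actZl (tw_actP Tw) b (ext x) (extI m); apply: etrans Z _.
exact: etrans (congr1 ( *:%R b) (esym (ext_actG x m))) (esym (extIZ b (actG x m))).
Qed.

Lemma actG_Zr (b : Zv) x m : actG x (b *: m) = b *: actG x m.
Proof.
apply: extI_inj; apply: etrans (ext_actG x _) _.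
apply: etrans (congr1 (tw_act Tw (ext x)) (extIZ b m)) _.
have Z := tw_actZr (tw_actP Tw) b (ext x) (extI m); apply: etrans Z _.
exact: etrans (congr1 ( *:%R b) (esym (ext_actG x m))) (esym (extIZ b (actG x m))).
Qed.

Lemma ext_actG_basis (s : G) (w : IG) :
  extI (actG (basis s) (basis w)) = tw_act Tw (basis (val s)) (basis (iG w)).
Proof. by apply: etrans (ext_actG _ _) _; rewrite extI_basis ext_basis. Qed.

Lemma val_iG_ltimes (s : G) (w w' : IG) : val w' = ltimes starG s (val w) ->
  val (iG w') = ltimes star (val s) (val (iG w)).
Proof. by move=> e; rewrite !val_iG e val_ltimes. Qed.

Lemma bruhat_lt_iG (w w' : IG) : bruhat_lt SG (val w) (val w') ->
  bruhat_lt S (val (iG w)) (val (iG w')).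
Proof. by move/(bruhat_lt_gen cox fJ); rewrite !val_iG. Qed.

Lemma twisted_module_restrict : @is_twisted_module G SG starG mul2 actG.
Proof.
split.
- move=> x y m; apply: extI_inj; apply: etrans (ext_actG _ _) _.
  have -> := ext_mulG cox fJ (tw_mulP Tw) x y.
  apply: etrans (tw_actM (tw_actP Tw) _ _ _) _; apply/esym.
  by apply: etrans (ext_actG _ _) _; have -> := ext_actG y m.
- move=> m; apply: extI_inj; apply: etrans (ext_actG _ _) _.
  by rewrite ext_basis; apply: (tw_act1 (tw_actP Tw)).
- move=> x y m; apply: extI_inj; apply: etrans (ext_actG _ _) _.
  have -> := extD x y; apply: etrans (tw_actDl (tw_actP Tw) _ _ _) _; apply/esym.
  apply: etrans (extID _ _) _.
  by have -> := ext_actG x m; have -> := ext_actG y m.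
- move=> x m n; apply: extI_inj; apply: etrans (ext_actG _ _) _.
  have -> := extID m n; apply: etrans (tw_actDr (tw_actP Tw) _ _ _) _; apply/esym.
  apply: etrans (extID _ _) _.
  by have -> := ext_actG x m; have -> := ext_actG x n.
- by move=> b x m; have Z := actG_Zl b x m; exact_no_check Z.
- by move=> b x m; have Z := actG_Zr b x m; exact_no_check Z.
- move=> s w w' Js lt e /(bruhat_lt_iG) up; apply: extI_inj.
  apply: etrans (ext_actG_basis s w) _; rewrite extI_basis.
  apply: (tw_act_up (tw_actP Tw) (factorS fJ Js) (val_iG_ltimes lt) _ up).
  by rewrite !val_iG e 2!gvalM val_starG.
- move=> s w w' Js lt e /(bruhat_lt_iG) up; apply: extI_inj.
  apply: etrans (ext_actG_basis s w) _; apply/esym; apply: etrans (extI_lin _ _ _ _) _.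
  apply/esym/(tw_act_up_comm (tw_actP Tw) (factorS fJ Js) (val_iG_ltimes lt) _ up).
  by rewrite !val_iG e gvalM.
- move=> s w w' Js lt e /(bruhat_lt_iG) up; apply: extI_inj.
  apply: etrans (ext_actG_basis s w) _; apply/esym; apply: etrans (extI_lin _ _ _ _) _.
  apply/esym/(tw_act_down_comm (tw_actP Tw) (factorS fJ Js) (val_iG_ltimes lt) _ up).
  by rewrite !val_iG e gvalM.
move=> s w w' Js lt e /(bruhat_lt_iG) up; apply: extI_inj.
apply: etrans (ext_actG_basis s w) _; apply/esym; apply: etrans (extI_lin _ _ _ _) _.
apply/esym/(tw_act_down (tw_actP Tw) (factorS fJ Js) (val_iG_ltimes lt) _ up).
by rewrite !val_iG e 2!gvalM val_starG.
Qed.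

Lemma twisted_bar_restrict :
  is_twisted_bar actG (barG (J := J) (tw_hbar Tw)) barI.
Proof.
split.
- move=> m n; apply: extI_inj; apply: etrans (ext_barI _) _.
  have -> := extID m n; apply: etrans (tw_barD (tw_barP Tw) _ _) _; apply/esym.
  apply: etrans (extID _ _) _.
  by have -> := ext_barI m; have -> := ext_barI n.
- move=> m; apply: extI_inj; apply: etrans (ext_barI _) _.
  by have -> := ext_barI m; apply: (tw_barK (tw_barP Tw)).
- move=> e e1; apply: extI_inj; apply: etrans (ext_barI _) _.
  have -> := extI_basis e; apply: (tw_bar1 (tw_barP Tw)).
  by rewrite val_iG e1 gval1.
move=> x m; apply: extI_inj; apply: etrans (ext_barI _) _.
have -> := ext_actG x m; apply: etrans (tw_barM (tw_barP Tw) _ _) _; apply/esym.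
apply: etrans (ext_actG _ _) _; have -> := ext_barI m.
by have -> := ext_barG cox fJ q2K (tw_mulP Tw) (tw_hbarP Tw) x.
Qed.

Definition CG (g : G) := res (tw_C Tw (val g)).
Definition AG (g : IG) := resI (tw_A Tw (iG g)).

Lemma ext_CG g : ext (CG g) = tw_C Tw (val g).
Proof. exact: (ext_res cox fJ (tw_C_spanned cox fJ (val_pr cox fJ g))). Qed.

Lemma inI_val g : inI S J (iG g).
Proof. by apply/inI_iG; exists g. Qed.

Lemma ext_AG g : extI (AG g) = tw_A Tw (iG g).
Proof. exact: (extI_res (tw_A_spanned cox fJ (inI_val g))). Qed.

Lemma ext_lincomb_AG (e : {malg Zv[I]}) : spanned (@inI _ S star J) e ->
  extI (lincomb AG (resI e)) = lincomb (tw_A Tw) e.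
Proof.
move=> se; rewrite extend_lincomb -{2}(extI_res se) lincomb_extend.
by apply: eq_lincomb (@spannedT _ _) _ => g _; apply: ext_AG.
Qed.

Lemma star_inW x : inW S J x -> inW S J (star x)^-1%g.
Proof.
by move=> Jx; rewrite /inW (prV cox fJ) -{1}sJ (pr_star cox st _ fJ) Jx.
Qed.

(** The counterpart of [kl_restrict] for the twisted theory of a stable factor. *)
Definition twisted_restrict : twisted_theory starG KG.
Proof.
apply: (@TwistedTheory G SG starG KG mul2 _ (barG (J := J) (tw_hbar Tw)) _
  CG _ actG twisted_module_restrict barI twisted_bar_restrict
  (fun y w => tw_P Tw (iG y) (iG w)) AG _ _ _ _
  (fun x y => res (tw_htilde Tw (val x) (iG y))) _
  (fun x y => resI (tw_hsigma Tw (val x) (iG y))) _).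
- exact: (hecke_restrict cox fJ (tw_mulP Tw)).
- exact: (hecke_bar_restrict cox fJ q2K (tw_mulP Tw) (tw_hbarP Tw)).
- by move=> y w; rewrite (coef_restrict val_inj) (ell_gen cox fJ); apply: tw_CE.
- by move=> y w; rewrite (coef_restrict iG_inj) (ell_gen cox fJ) -val_iG; apply: tw_AE.
- by move=> w; apply: extI_inj; rewrite ext_barI ext_AG tw_bar_A.
- move=> y w nlt; rewrite tw_P_nlt; first by rewrite (inj_eq iG_inj).
  by rewrite !val_iG => /(bruhat_lt_gen cox fJ).
- move=> y w lt; rewrite /kl_degree_bound !(ell_gen cox fJ) -!val_iG.
  by apply: tw_P_deg; apply: bruhat_lt_iG.
- move=> x y; apply: (@ext_inj _ J).
  rewrite !(ext_mulG cox fJ (kl_mulP K)) !(ext_cG cox fJ).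
  rewrite (ext_lincomb_cG cox fJ).
    by rewrite -tw_htildeE gvalV val_starG val_iG.
  apply: (kl_coords_spanned cox (K := K) fJ); rewrite -tw_htildeE.
  apply: (kl_mul3_spanned cox fJ); [exact: (val_pr cox fJ) | exact: inI_val |].
  exact: star_inW (val_pr cox fJ x).
move=> x y; apply: extI_inj; rewrite ext_actG ext_CG ext_AG ext_lincomb_AG.
  exact: tw_hsigmaE.
exact: (hsigma_spanned cox st fJ sJ (val_pr cox fJ x) (inI_val y)).
Defined.

End RestrictTwisted.

(** * Two exchanged factors *)

Lemma lsq_even f i : (lsq f)@_i != 0 -> exists j : int, i = 2 * j.
Proof.
elim/laurent_ind: f => [|f g IHf IHg|a k].
- by rewrite lsq0 mcoeff0 eqxx.
- rewrite lsqD mcoeffD; have [->|/IHf //] := eqVneq ((lsq f)@_i) 0.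
  by rewrite add0r => /IHg.
rewrite lsq_lmon coef_lmon; have [->|_] := eqVneq i (2 * k); first by exists k.
by rewrite ?mulr0 ?mulr0n eqxx.
Qed.

Lemma negdeg_lsq f : negdeg f -> negdeg (lsq f).
Proof.
move=> nf i nz; have [j e] := lsq_even nz; move: nz; rewrite e coef_lsq => /nf.
by lia.
Qed.

Lemma inW_sub (W : groupType) (S D E : W -> Prop) w : coxeter_system S ->
  factor S D -> factor S E -> (forall s, D s -> E s) -> inW S D w -> inW S E w.
Proof.
move=> cox fD fE DE Dw; rewrite /inW -Dw (pr_pr cox w fE fD).
by congr (pr S _ w); apply/funext => s; apply/propext; split=> [[]|/[dup] /DE].
Qed.

Section Delta.
Variables (W : groupType) (S : W -> Prop) (star : W -> W).
Hypotheses (cox : coxeter_system S) (st : preserving_involution S star).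
Variable J : W -> Prop.
Hypotheses (fJ : factor S J) (dj : forall s, J s -> ~ J (star s)).
Local Notation I := (twisted_invol star).
Local Notation ell := (ell S).
Local Notation Js := (star_set star J).
Local Notation p := (pr S J).
Local Notation p' := (pr S (compl S J)).
Local Notation ps := (pr S Js).
Let fJ' := factor_compl fJ.
Let fJs : factor S Js := factor_star st fJ.

Lemma swap_compl s : Js s -> compl S J s.
Proof. by move=> Js_s; split; [exact: (factorS fJs Js_s) | move=> /dj]. Qed.

Lemma inW_swap w : inW S Js w -> inW S (compl S J) w.
Proof. exact: (inW_sub cox fJs fJ' swap_compl). Qed.

Lemma star_swap w : inW S J w -> inW S Js (star w).
Proof. by move=> Jw; rewrite /inW (pr_star cox st w fJ) Jw. Qed.

Lemma swap_star w : inW S Js w -> inW S J (star w).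
Proof.
by move=> Jw; apply: (can_inj (starK st)); rewrite -(pr_star cox st _ fJ) (starK st).
Qed.

Lemma inWV (D : W -> Prop) w : factor S D -> inW S D w -> inW S D w^-1%g.
Proof. by move=> fD Dw; rewrite /inW (prV cox fD) Dw. Qed.

Lemma delta_invol x :
  star (p x * (star (p x))^-1)%g == (p x * (star (p x))^-1)^-1%g.
Proof. by rewrite (starM st) (starV st) (starK st) invgM invgK. Qed.

(** The value of [delta] depends on the component of x in [J] only; as x runs
    through that factor, its values are the twisted involutions of the product
    of the two exchanged factors ([delta_ind]). *)
Definition delta (x : W) : I := Sub (p x * (star (p x))^-1)%g (delta_invol x).

Lemma val_delta x : val (delta x) = (p x * (star (p x))^-1)%g.
Proof. by rewrite SubK. Qed.

Lemma inW'_starV x : inW S (compl S J) (star (p x))^-1%g.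
Proof. exact/inW_swap/inWV/star_swap/inWpr. Qed.

Lemma p_delta x : p (val (delta x)) = p x.
Proof.
rewrite val_delta (prM cox fJ) (prK cox fJ).
by rewrite (inW_compl2 cox fJ (inW'_starV x)) mulg1.
Qed.

Lemma p'_delta x : p' (val (delta x)) = (star (p x))^-1%g.
Proof.
rewrite val_delta (prM cox fJ') (pr_compl_pr cox fJ) mul1g.
exact: inW'_starV.
Qed.

Lemma delta_inj x y : inW S J x -> inW S J y -> delta x = delta y -> x = y.
Proof.
by move=> Jx Jy /(congr1 (fun w : I => p (val w))); rewrite !p_delta Jx Jy.
Qed.

Lemma ell_delta x : inW S J x -> ell (val (delta x)) = (ell x).*2.
Proof.
move=> Jx; rewrite (ell_split cox fJ) p_delta p'_delta Jx.
by rewrite (ell_star_inv cox st) addnn.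
Qed.

Lemma gen_neq s w : S s -> (s * w)%g <> w.
Proof.
move=> Ss e; apply: (cox_neq1 cox Ss); apply: (@mulIg _ w); rewrite e.
by rewrite mul1g.
Qed.

Lemma p_out s : Js s -> p s = 1%g.
Proof. by move=> Jss; apply: (inW_compl2 cox fJ); apply: inW_swap; apply: inW_in. Qed.

(** In the component in J, s (delta x) and (delta x) s^* are s x and x. *)
Lemma delta_comm1 s x : J s -> tcomm star s (val (delta x)) = false.
Proof.
move=> Js_; apply/negbTE/negP => /eqP /(congr1 p).
rewrite (prM cox fJ s) [in RHS](prM cox fJ) (pr_in cox fJ Js_) p_delta (@p_out (star s)) ?mulg1; last first.
  by rewrite /star_set (starK st).
exact: gen_neq (factorS fJ Js_).
Qed.

Lemma delta_ltI1 s x : J s -> inW S J x -> ltI s (delta x) = delta (s * x)%g.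
Proof.
move=> Js_ Jx; have Ss := factorS fJ Js_; apply: val_inj.
rewrite (val_ltI cox st _ Ss) ltimesE delta_comm1 // !val_delta.
rewrite Jx (prM cox fJ) (pr_in cox fJ Js_) Jx (starM st) invgM.
have Ss' : S (star s) by apply/(star_S st).
by rewrite (genVg cox Ss') !mulgA.
Qed.

Lemma delta_up1 s x : J s -> inW S J x ->
  tup S s (val (delta x)) = (ell x < ell (s * x)%g)%N.
Proof. by move=> Js_ Jx; rewrite (up_pr cox fJ _ Js_) p_delta Jx. Qed.

Lemma delta_comm2 r x : J r -> inW S J x ->
  tcomm star (star r) (val (delta x)) = false.
Proof.
move=> Jr Jx; have Sr := factorS fJ Jr.
apply/negbTE/negP => /eqP /(congr1 p); rewrite (starK st).
rewrite (prM cox fJ (star r)) [in RHS](prM cox fJ) (pr_in cox fJ Jr) p_delta Jx (@p_out (star r)); last first.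
  by rewrite /star_set (starK st).
rewrite mul1g => e; apply: (@gen_neq r (x^-1)%g Sr).
by apply: invg_inj; rewrite invgM invgK (genVg cox Sr) -e.
Qed.

(** A generator r^* of the other factor acts by right multiplication by r,
    because r and r^* commute. *)
Lemma delta_ltI2 r x : J r -> inW S J x -> ltI (star r) (delta x) = delta (x * r)%g.
Proof.
move=> Jr Jx; have Sr := factorS fJ Jr; have Ss : S (star r) by apply/(star_S st).
have Jr' := inW_in cox fJ Jr.
apply: val_inj; rewrite (val_ltI cox st _ Ss) ltimesE delta_comm2 // !val_delta.
rewrite (starK st) Jx (prM cox fJ) Jr' Jx (starM st) invgM (genVg cox Ss).
have C u w : inW S J u -> inW S Js w -> (w * u = u * w)%g.
  move=> <- /inW_swap <-; by rewrite (pr_comm cox fJ).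
have Jsr := star_swap Jr'.
have Jsx := inWV fJs (star_swap Jx).
rewrite mulgA (C x (star r)) // -!mulgA; congr (_ * _)%g.
by rewrite (C r (star x)^-1%g) // !mulgA (C r (star r)).
Qed.

Lemma delta_up2 r x : J r -> inW S J x ->
  tup S (star r) (val (delta x)) = (ell x < ell (x * r)%g)%N.
Proof.
move=> Jr Jx; have Sr := factorS fJ Jr.
have Jr' : compl S J (star r) by apply: swap_compl; rewrite /star_set (starK st).
rewrite (up_pr cox fJ' _ Jr') p'_delta Jx /tup.
rewrite -{1}(ell_star_inv cox st x); congr (_ < _)%N.
have -> : (star r * (star x)^-1 = (star (x * r))^-1)%g.
  have Ss : S (star r) by apply/(star_S st).
  by rewrite (starM st) invgM (genVg cox Ss).
by rewrite (ell_star_inv cox st) /inW.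
Qed.

(** For a twisted involution w = x x' with components x and x' one has
    x^* x'^* = x'^-1 x^-1, hence x' = (x^* )^-1. *)
Lemma delta_ind (w : I) : inW S (fun s => J s \/ Js s) (val w) ->
  w = delta (p (val w)).
Proof.
move=> JJw; apply: val_inj; rewrite val_delta (prK cox fJ).
have e := prU_compl cox fJ fJs (fun s Js_ => @dj s Js_) JJw.
rewrite -{1}[val w](pr_split cox fJ); congr (_ * _)%g.
rewrite -(pr_star cox st _ fJ) (invol_star w) (prV cox fJs) invgK -e.
rewrite -{2}[val w](pr_split cox fJ) (prM cox fJs) e.
suff -> : ps (p (val w)) = 1%g by rewrite mul1g.
have Jw : inW S J (p (val w)) := inWpr cox _ fJ.
apply: (inW_compl2 cox fJs); apply: (inW_sub cox fJ (factor_compl fJs)) Jw.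
by move=> s Js_; split; [exact: (factorS fJ Js_) | apply: dj].
Qed.

(** ** The map from the Hecke algebra of the factor to the twisted module *)

Variables (V : lmodType Zv) (t : W -> V) (u' : Zv) (mul : V -> V -> V).
Hypothesis uK : u' * vq int ^+ 2 = 1.
Hypothesis hecke : hecke_on S t (vq int ^+ 2) mul.
Variables (M : lmodType Zv) (a : I -> M) (act : V -> M -> M).
Hypothesis tm : tmodule_on S t mul a act.
Variables (theta : V -> M) (anti : V -> V).
Hypothesis theta_lin : forall (c : Zv) x y,
  theta (c *: x + y) = c *: theta x + theta y.
Hypothesis theta_t : forall x, theta (t x) = a (delta x).
Hypothesis anti_lin : forall (c : Zv) x y, anti (c *: x + y) = c *: anti x + anti y.
Hypothesis anti_t : forall w, anti (t w) = t (star w)^-1%g.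
Hypothesis t_gen : forall x, lspan t (fun=> True) x.
Local Notation spanJ := (lspan t (inW S J)).

Lemma theta0 : theta 0 = 0.
Proof. exact: (slin0 (rho := id) erefl theta_lin). Qed.

Lemma thetaZ (c : Zv) x : theta (c *: x) = c *: theta x.
Proof. exact: (slinZ (rho := id) erefl theta_lin). Qed.

(** As s w = w s^* never holds for w = [delta x], the rules for T_s a_w are those
    for t_s t_x. *)
Lemma theta_T1 s h : J s -> spanJ h -> theta (mul (t s) h) = act (t s) (theta h).
Proof.
move=> Js_ sh; have Ss := factorS fJ Js_.
elim: sh => [|c x {}h Jx _ IH].
  by rewrite (hecke_mul0r hecke) theta0 (act0r tm).
rewrite (heckeDr hecke) (heckeZr hecke) !theta_lin IH (tm_linr tm).
congr (_ *: _ + _); rewrite theta_t (tm_T tm _ Ss) delta_comm1 // delta_ltI1 //.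
rewrite delta_up1 // /tw_new /tw_old; case: ltnP => [lt|ge].
  by rewrite (t_up hecke Ss lt) theta_t scale1r scale0r addr0.
have lt : (ell (s * x)%g < ell x)%N by have := ell_sl cox x Ss; lia.
by rewrite (t_down hecke Ss lt) theta_lin thetaZ !theta_t.
Qed.

Lemma theta_T2 r h : J r -> spanJ h ->
  theta (mul h (t r)) = act (t (star r)) (theta h).
Proof.
move=> Jr sh; have Sr := factorS fJ Jr; have Ss : S (star r) by apply/(star_S st).
elim: sh => [|c x {}h Jx _ IH].
  by rewrite (hecke_mul0l hecke) theta0 (act0r tm).
rewrite (heckeDl hecke) (heckeZl hecke) !theta_lin IH (tm_linr tm).
congr (_ *: _ + _); rewrite theta_t (tm_T tm _ Ss) delta_comm2 // delta_ltI2 //.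
rewrite delta_up2 // /tw_new /tw_old; case: ltnP => [lt|ge].
  by rewrite (t_upr cox hecke Sr lt) theta_t scale1r scale0r addr0.
have lt : (ell (x * r)%g < ell x)%N by have := ell_sr cox x Sr; lia.
by rewrite (t_downr cox hecke Sr lt) theta_lin thetaZ !theta_t.
Qed.

Lemma theta_act1 x h : spanJ x -> spanJ h -> theta (mul x h) = act x (theta h).
Proof.
move=> sx; suff H : forall h, spanJ h ->
    spanJ (mul x h) /\ theta (mul x h) = act x (theta h) by case/H.
move: x sx {h}; apply: (hecke_ind cox hecke fJ).
- move=> h sh; rewrite (hecke_mul0l hecke) theta0 (act0l tm); split=> //.
  exact: lspan0.
- move=> c x y IHx IHy h sh; rewrite (heckeDl hecke) (heckeZl hecke) theta_lin.
  have [sx ->] := IHx _ sh; have [sy ->] := IHy _ sh; rewrite (tm_linl tm).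
  by split=> //; apply: lspanD => //; apply: lspanZ.
- move=> x y IHx IHy h sh; rewrite -(heckeA hecke) (tmA tm).
  by have [sy ey] := IHy _ sh; have [sx ->] := IHx _ sy; rewrite ey.
- by move=> h sh; rewrite (hecke1l hecke) (tm1 tm).
move=> s Js_ h sh; split; last exact: theta_T1.
apply: (spanned_mul cox hecke fJ) => //.
by apply: lspan_basis; apply: inW_in.
Qed.

Lemma theta_act2 x h : lspan t (inW S Js) x -> spanJ h ->
  spanJ (mul h (anti x)) /\ theta (mul h (anti x)) = act x (theta h).
Proof.
move=> sx; move: h.
have anti0 : anti 0 = 0 by apply: (slin0 (rho := id) erefl anti_lin).
move: x sx; apply: (hecke_ind cox hecke fJs).
- move=> h sh; rewrite anti0 (hecke_mul0r hecke) theta0 (act0l tm); split=> //.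
  exact: lspan0.
- move=> c x y IHx IHy h sh; rewrite anti_lin (heckeDr hecke) (heckeZr hecke) theta_lin.
  have [sx ->] := IHx _ sh; have [sy ->] := IHy _ sh; rewrite (tm_linl tm).
  by split=> //; apply: lspanD => //; apply: lspanZ.
- move=> x y IHx IHy h sh.
  rewrite (anti_mul cox t_gen st hecke anti_lin anti_t) (heckeA hecke) (tmA tm).
  by have [sy ey] := IHy _ sh; have [sx ->] := IHx _ sy; rewrite ey.
- by move=> h sh; rewrite anti_t (star1 st) invg1 (hecke1r hecke) (tm1 tm).
move=> s Jss h sh; have Sr := factorS fJ Jss.
rewrite anti_t (genVg cox Sr); split.
  apply: (spanned_mul cox hecke fJ) => //.
  by apply: lspan_basis; apply: inW_in.
by rewrite theta_T2 // (starK st).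
Qed.

Variables (hbar : V -> V) (bar : M -> M).
Hypothesis hb : hecke_bar_on t mul hbar.
Hypothesis bar_act : forall x m, bar (act x m) = act (hbar x) (bar m).
Hypothesis bar1 : forall e : I, val e = 1%g -> bar (a e) = a e.

(** On the factor, theta is the map h |-> h a_1. *)
Lemma theta_bar h : spanJ h -> bar (theta h) = theta (hbar h).
Proof.
move=> sh; have s1 : spanJ (t 1%g) by apply: lspan_basis; apply: (inW1 cox).
have sb := spanned_bar cox uK hecke hb fJ sh.
have e x : spanJ x -> theta x = act x (a (delta 1%g)).
  by move=> sx; rewrite -theta_t -theta_act1 // (hecke1r hecke).
rewrite (e h) // (e (hbar h)) // bar_act bar1 //.
by rewrite val_delta (pr1 cox fJ) (star1 st) invg1 mulg1.
Qed.

End Delta.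

Section SwapKL.
Variables (W : groupType) (S : W -> Prop) (star : W -> W).
Hypotheses (cox : coxeter_system S) (st : preserving_involution S star).
Variable K : kl_theory S.
Local Notation ell := (ell S).
Local Notation I := (twisted_invol star).
Local Notation H := {malg Zv[W]}.
Local Notation q := (vq int).
Local Notation c := (kl_c K).
Local Notation f := (fun w : W => (star w)^-1%g).

Lemma starV_inj : injective f.
Proof. exact: inv_inj (star_invK st). Qed.

(** The anti-automorphism of the Hecke algebra induced by w |-> (w^* )^-1. *)
Definition anti : H -> H := extend f.

Lemma anti_lin (b : Zv) (x y : H) : anti (b *: x + y) = b *: anti x + anti y.
Proof.
have Z : anti (b *: x) = b *: anti x := extendZ f b x.
exact: etrans (extendD f (b *: x) y) (congr1 (+%R^~ (anti y)) Z).
Qed.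

Lemma anti_basis w : anti (basis w) = basis (star w)^-1%g.
Proof. exact: extend_basis. Qed.

Lemma anti_coef (x : H) w : (anti x)@_w = x@_(star w)^-1%g.
Proof. by rewrite -{1}(star_invK st w); apply: (coef_extend starV_inj). Qed.

Lemma kl_anti_mul x y : anti (kl_mul K x y) = kl_mul K (anti y) (anti x).
Proof.
have Z := anti_mul cox (@basis_gen W) st (kl_hecke cox K) (anti := anti)
  anti_lin anti_basis x y.
exact Z.
Qed.

(** The anti-automorphism preserves the conditions that characterize c_w. *)
Lemma anti_c w : anti (c w) = c (star w)^-1%g.
Proof.
apply: (kl_unique cox).
- have Z := anti_bar cox (@basis_gen W) st qK (kl_hecke cox K) (anti := anti)
    anti_lin anti_basis (kl_bar_on K) (c w).
  by apply: etrans (esym Z) _; rewrite kl_bar_c.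
- by rewrite anti_coef (star_invK st) (ell_star_inv cox st) kl_diag.
move=> y ne; rewrite anti_coef -(ell_star_inv cox st y); apply: kl_neg.
by apply: contra_neq ne => <-; rewrite (star_invK st).
Qed.

Lemma LP_anti y w : LP K (star y)^-1%g (star w)^-1%g = LP K y w.
Proof.
apply: (vpow_cancel (i := - (ell w)%:Z)).
rewrite -{1}(ell_star_inv cox st w) -!kl_coef -anti_c anti_coef.
by rewrite (star_invK st).
Qed.

Variable Tw : twisted_theory star K.
Local Notation C := (tw_C Tw).
Local Notation A := (tw_A Tw).
Local Notation act := (tw_act Tw).
Local Notation M := {malg Zv[I]}.

Lemma anti_C w : anti (C w) = C (star w)^-1%g.
Proof.
apply/malgP => y; rewrite anti_coef !tw_CE2.
by rewrite 2!(coef_mapc lsq0) -anti_c anti_coef.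
Qed.

Variable J : W -> Prop.
Hypotheses (fJ : factor S J) (dj : forall s, J s -> ~ J (star s)).
Local Notation Js := (star_set star J).
Local Notation JJ := (fun s => J s \/ Js s).
Local Notation p := (pr S J).
Local Notation ps := (pr S Js).
Let fJ' := factor_compl fJ.
Let fJs : factor S Js := factor_star st fJ.
Local Notation delta := (delta st J).

Definition theta : H -> M := extend delta.

Lemma theta_lin (b : Zv) (x y : H) : theta (b *: x + y) = b *: theta x + theta y.
Proof.
have Z : theta (b *: x) = b *: theta x := extendZ delta b x.
exact: etrans (extendD delta (b *: x) y) (congr1 (+%R^~ (theta y)) Z).
Qed.

Lemma theta_basis w : theta (basis w) = basis (delta w).
Proof. exact: extend_basis. Qed.

Lemma theta_coef (x : H) y : spanned (inW S J) x -> inW S J y ->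
  (theta x)@_(delta y) = x@_y.
Proof.
move=> sx Jy; elim/spanned_ind: sx => [|b k {}x Jk _ IH].
  by rewrite /theta extend.unlock lincomb0 !mcoeff0.
rewrite theta_lin [LHS]mcoeffD [RHS]mcoeffD IH; congr (_ + _).
rewrite [LHS]mcoeffZ [RHS]mcoeffZ theta_basis !coef_basis; congr (_ * _%:R).
by congr nat_of_bool; apply/eqP/eqP => [/(delta_inj cox fJ dj Jk Jy)|->].
Qed.

Lemma theta_supp (x : H) w : spanned (inW S J) x -> (theta x)@_w != 0 ->
  exists2 y, inW S J y & w = delta y.
Proof.
move=> sx; rewrite /theta extend.unlock.
have sd : spanned (fun w => exists2 y, inW S J y & w = delta y)
    (lincomb (fun y => basis (delta y)) x).
  apply: (spanned_lincomb sx) => y Jy; apply: spanned_basis; by exists y.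
exact: sd.
Qed.

Lemma theta_actE (x1 x2 h : H) : spanned (inW S J) x1 -> spanned (inW S Js) x2 ->
  spanned (inW S J) h ->
  theta (tw_mul Tw x1 (tw_mul Tw h (anti x2))) = act (tw_mul Tw x1 x2) (theta h).
Proof.
move=> /spanned_lspan s1 /spanned_lspan s2 /spanned_lspan sh.
have hk := tw_hecke cox Tw; have tm := tw_module cox st Tw.
have [s3 e3] := theta_act2 cox fJ dj hk tm theta_lin theta_basis
  anti_lin anti_basis (@basis_gen W) s2 sh.
have e1 := theta_act1 cox fJ dj hk tm theta_lin theta_basis s1 s3.
apply: etrans e1 _; apply/esym; apply: etrans (tw_actM (tw_actP Tw) _ _ _) _.
have Z := congr1 (act x1) (esym e3); exact_no_check Z.
Qed.

(** The conditions that characterize A_w hold for theta (C_w): lengths double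
    under delta, and so do degrees under v -> v^2. *)
Lemma theta_C w : inW S J w -> theta (C w) = A (delta w).
Proof.
move=> Jw; have sC := tw_C_spanned cox (Tw := Tw) fJ Jw.
have coefC y : inW S J y -> vpow int (ell (val (delta y))) * (theta (C w))@_(delta y)
    = lsq (vpow int (ell y) * (c w)@_y).
  move=> Jy; rewrite (theta_coef sC Jy) (ell_delta cox st fJ dj Jy) tw_CE2.
  rewrite (coef_mapc lsq0) lsqM lsq_vpow; congr (vpow int _ * _); lia.
apply: (tw_unique cox).
- have Z := theta_bar cox fJ dj q2K (tw_hecke cox Tw) (tw_module cox st Tw)
    theta_lin theta_basis (tw_hbar_on Tw) (tw_barM (tw_barP Tw))
    (tw_bar1 (tw_barP Tw)) (spanned_lspan sC).
  by apply: etrans Z _; rewrite (tw_bar_C cox).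
- apply: (vpow_cancel (i := (ell (val (delta w)))%:Z)); rewrite (coefC _ Jw).
  by rewrite vpowKN kl_diag vpowKN lsq1.
move=> y ne; have [[z Jz ez]|nz] := EM (exists2 z, inW S J z & y = delta z).
  rewrite ez (coefC _ Jz); apply: negdeg_lsq; apply: kl_neg.
  by apply: contra_neq ne => <-.
suff -> : (theta (C w))@_y = 0 by rewrite mulr0; apply: negdeg0.
by apply/eqP; apply: contraT => /(theta_supp sC).
Qed.

Lemma delta_inI (w : I) : inW S JJ (val w) -> w = delta (p (val w)).
Proof. exact: (delta_ind cox st fJ dj). Qed.

Lemma LPs_swap (y w : I) : inW S JJ (val y) -> inW S JJ (val w) ->
  LPs Tw y w = lsq (LP K (p (val y)) (p (val w))).
Proof.
move=> Jy Jw; have Jy' := inWpr cox (val y) fJ; have Jw' := inWpr cox (val w) fJ.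
rewrite {1}(delta_inI Jy) {1}(delta_inI Jw).
apply: (vpow_cancel (i := - (ell (val (delta (p (val w)))))%:Z)).
rewrite -tw_coef -(theta_C Jw') (theta_coef (tw_C_spanned cox fJ Jw') Jy').
rewrite tw_CE2 (coef_mapc lsq0) kl_coef lsqM lsq_vpow.
rewrite (ell_delta cox st fJ dj Jw'); congr (vpow int _ * _); lia.
Qed.

Lemma LP_swap (y w : I) : inW S JJ (val y) -> inW S JJ (val w) ->
  LP K (val y) (val w) = LP K (p (val y)) (p (val w)) ^+ 2.
Proof.
move=> Jy Jw; rewrite (LP_split cox K _ _ fJ) expr2; congr (_ * _).
rewrite {1}(delta_inI Jy) {1}(delta_inI Jw) !(p'_delta cox st fJ dj).
by rewrite !(prK cox fJ) LP_anti.
Qed.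

(** The coordinates of c_{x1} c_y c_{(x2^* )^-1}, where x1 and x2 are the
    components of x.  This is the component of c_x c_{delta y} c_{(x^* )^-1} in
    the factor [J], and with v replaced by v^2 it also describes C_x A_{delta y}. *)
Definition swap_coords (x y : W) : H :=
  lincomb (fun u => kl_h K u (star (pr S (compl S J) x))^-1%g) (kl_h K (p x) y).

Lemma swap_coords_mul3 x y : lincomb c (swap_coords x y) =
  kl_mul3 K (p x) y (star (pr S (compl S J) x))^-1%g.
Proof.
set x2 := (_^-1)%g; rewrite /swap_coords /kl_mul3 kl_hE.
rewrite lincomb_comp.
elim/basis_ind: (kl_h K (p x) y) => [|b u m IH].
  by rewrite !lincomb0 (hecke_mul0l (kl_hecke cox K)).
have L (b' : Zv) (g h : H) : kl_mul K (b' *: g + h) (c x2) =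
    b' *: kl_mul K g (c x2) + kl_mul K h (c x2).
  have Z := heckeDl (kl_hecke cox K) (b' *: g) h (c x2).
  apply: etrans Z _; congr (_ + _).
  have Z' := heckeZl (kl_hecke cox K) b' g (c x2); exact_no_check Z'.
by rewrite !lincomb_lin L IH !lincomb_basis kl_hE.
Qed.

Lemma swap_p' x : inW S JJ x -> inW S Js (pr S (compl S J) x).
Proof. exact: (prU_compl cox fJ fJs (fun s Js_ => @dj s Js_)). Qed.

Lemma swap_coords_spanned x y : inW S JJ x -> inW S J y ->
  spanned (inW S J) (swap_coords x y).
Proof.
move=> Jx Jy; apply: (kl_coords_spanned cox (K := K) fJ).
rewrite swap_coords_mul3; apply: (kl_mul3_spanned cox fJ (inWpr cox x fJ) Jy).
exact/(inWV cox fJ)/(swap_star cox st fJ)/swap_p'.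
Qed.

(** The component x1 acts on theta (C_y) by left multiplication and x2 by right
    multiplication with C_{(x2^* )^-1}. *)
Lemma hsigma_swap x (y z : I) : inW S JJ x -> inW S JJ (val y) ->
  inW S JJ (val z) ->
  (tw_hsigma Tw x y)@_z = lsq (swap_coords x (p (val y)))@_(p (val z)).
Proof.
move=> Jx Jy Jz; have Jy' := inWpr cox (val y) fJ.
set k := swap_coords _ _; have sk : spanned (inW S J) k by apply: swap_coords_spanned.
have sk' : spanned (inW S J) (mapc lsq k).
  by move=> u; rewrite (coef_mapc lsq0) => nz; apply: sk; apply: contraNneq nz => ->;
     rewrite lsq0.
suff -> : tw_hsigma Tw x y = theta (mapc lsq k).
  rewrite {1}(delta_inI Jz) (theta_coef sk' (inWpr cox _ fJ)).
  exact: coef_mapc lsq0 _ _.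
have tri := tw_tri (Tw := Tw).
apply: (lincomb_inj (len := fun y : I => ell (val y)) (tw_diag Tw) tri).
rewrite -tw_hsigmaE {1}(delta_inI Jy) -(theta_C Jy') (tw_C_split cox Tw x fJ).
have sp1 := tw_C_spanned cox (Tw := Tw) fJ (inWpr cox x fJ).
have sp2 := tw_C_spanned cox (Tw := Tw) fJs (swap_p' Jx).
have sp3 := tw_C_spanned cox (Tw := Tw) fJ Jy'.
rewrite -(theta_actE sp1 sp2 sp3) anti_C !tw_CE2 -!(lsq_mul cox).
rewrite (heckeA (kl_hecke cox K)).
rewrite -[X in mapc lsq X]swap_coords_mul3 -/k.
have E : mapc lsq (lincomb c k) = lincomb C (mapc lsq k).
  apply: etrans (semilin_lincomb (F := mapc lsq) c lsqD lsqM lsq0 lsq1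
    (mapcD lsqD lsq0) (mapcZ lsq0 lsqM) k) _.
  by apply: eq_lincomb sk' _ => u _; rewrite tw_CE2.
apply: etrans (congr1 theta E) _.
apply: etrans (extend_lincomb delta C (mapc lsq k)) _.
apply/esym/(etrans (lincomb_extend delta A (mapc lsq k))).
by apply: eq_lincomb sk' _ => u Ju; apply/esym/theta_C.
Qed.

(** The component of c_x c_{delta y} c_{(x^* )^-1} in the second factor is the
    image of the one in the first factor under the anti-automorphism, so both
    have the same coordinates. *)
Lemma htilde_swap x (y z : I) : inW S JJ x -> inW S JJ (val y) ->
  inW S JJ (val z) ->
  (tw_htilde Tw x y)@_(val z) = (swap_coords x (p (val y)))@_(p (val z)) ^+ 2.
Proof.
move=> Jx Jy Jz; set k := swap_coords _ _.
set x2 := pr S (compl S J) x.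
have Jx2 : inW S Js x2 := swap_p' Jx.
have Jx2' : inW S J (star x2) := swap_star cox st fJ Jx2.
have Jx1' : inW S Js (star (p x)) := star_swap cox st fJ (inWpr cox x fJ).
have sx : star x = (star (p x) * star x2)%g by rewrite -(starM st) (pr_split cox fJ).
have e1 : p (star x)^-1%g = (star x2)^-1%g.
  rewrite (prV cox fJ) sx (prM cox fJ) Jx2' (inW_compl2 cox fJ) ?mul1g //.
  exact: (inW_swap cox st fJ dj).
have e2 : pr S (compl S J) (star x)^-1%g = (star (p x))^-1%g.
  rewrite (prV cox fJ') sx (prM cox fJ') (inW_compl1 cox fJ Jx2') mulg1.
  by rewrite (inW_swap cox st fJ dj Jx1').
have E1 : lincomb c k = kl_mul3 K (p x) (p (val y)) (p (star x)^-1%g).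
  by rewrite e1; apply: swap_coords_mul3.
have E2 : lincomb c (anti k) =
    kl_mul3 K x2 (pr S (compl S J) (val y)) (pr S (compl S J) (star x)^-1%g).
  rewrite e2 {1}(delta_inI Jy) (p'_delta cox st fJ dj).
  rewrite -(star_invK st x2) /kl_mul3 -!anti_c -(heckeA (kl_hecke cox K)).
  rewrite -!kl_anti_mul.
  rewrite (prK cox fJ) (anti_c x2).
  apply: etrans _ (congr1 anti (swap_coords_mul3 x (p (val y)))).
  apply: etrans (lincomb_extend _ c k) _.
  apply/esym/(etrans (extend_lincomb _ c k)).
  by apply: eq_lincomb (@spannedT _ _) _ => u _; apply: anti_c.
rewrite (mul3_coords_split cox fJ (esym (tw_htildeE Tw x y)) E1 E2) expr2.
congr (_ * _); rewrite anti_coef; congr (mcoeff _ k).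
rewrite {1}(delta_inI Jz) (p'_delta cox st fJ dj) (star_invK st).
exact: prK.
Qed.

End SwapKL.

(** * The properties as statements about pairs *)

Lemma half_ge0 (a : int) : (0 <= (2^-1 : rat) * a%:~R) = (0 <= a).
Proof. by rewrite pmulr_rge0 ?invr_gt0 // ler0z. Qed.

Lemma poly_pm_nonneg (p r : {poly int}) :
  poly_nonneg ((2^-1 : rat) *: map_poly intr (p + (1 : int) *: r)) /\
  poly_nonneg ((2^-1 : rat) *: map_poly intr (p + (-1 : int) *: r)) <->
  pair_nonneg (at_laurent p (vq int)) (at_laurent r (vq int)).
Proof.
have E (eps : int) : poly_nonneg ((2^-1 : rat) *: map_poly intr (p + eps *: r)) <->
    poly_nonneg (p + eps *: r).
  by split=> nn i; have := nn i; rewrite coefZ coef_map /= half_ge0.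
rewrite !E -!laurent_nonneg_at /pair_nonneg -at_laurentB -at_laurentD.
by rewrite scale1r scaleN1r.
Qed.

Section Properties.
Variables (W : groupType) (S : W -> Prop) (star : W -> W).
Variables (K : kl_theory S) (Tw : twisted_theory star K).
Local Notation ell := (ell S).
Local Notation I := (twisted_invol star).

Lemma P_pm_nonneg (y w : I) :
  poly_nonneg (P_pm Tw 1 y w) /\ poly_nonneg (P_pm Tw (-1) y w) <->
  pair_nonneg (LP K (val y) (val w)) (LPs Tw y w).
Proof. exact: poly_pm_nonneg. Qed.

Lemma P_pm_mono (y z w : I) :
  poly_nonneg (P_pm Tw 1 y w - P_pm Tw 1 z w) /\
  poly_nonneg (P_pm Tw (-1) y w - P_pm Tw (-1) z w) <->
  pair_nonneg (LP K (val y) (val w) - LP K (val z) (val w))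
    (LPs Tw y w - LPs Tw z w).
Proof.
rewrite -!at_laurentB -poly_pm_nonneg.
have E (eps : int) : P_pm Tw eps y w - P_pm Tw eps z w = (2^-1 : rat) *: map_poly intr
  (kl_P K (val y) (val w) - kl_P K (val z) (val w) +
    eps *: (tw_P Tw y w - tw_P Tw z w)).
  rewrite /P_pm -scalerBr -rmorphB; congr (_ *: map_poly _ _).
  by rewrite scalerBr; ring.
by rewrite !E.
Qed.

Lemma coef_laurent_rat f i : (laurent_rat f)@_i = (f@_i)%:~R.
Proof.
rewrite /laurent_rat raddf_sum /=.
have [fi|fi] := boolP (i \in msupp f).
  rewrite (big_fsetD1 _ fi) /= mcoeffUU big1_fset ?addr0 // => j.
  by rewrite in_fsetD1 => /andP[ne _] _; rewrite mcoeffU (negbTE ne).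
rewrite (mcoeff_outdom fi) big1_fset // => j fj _.
rewrite mcoeffU; case: eqP => [e|//]; by rewrite -e fj in fi.
Qed.

Lemma coef_h_pm eps x (y z : I) i : (h_pm Tw eps x y z)@_i =
  2^-1 * (((tw_htilde Tw x y)@_(val z) + (tw_hsigma Tw x y)@_z *~ eps)@_i)%:~R.
Proof. by rewrite /h_pm mcoeffZ coef_laurent_rat. Qed.

Lemma h_pm_nonneg x (y z : I) :
  laurent_nonneg (h_pm Tw 1 x y z) /\ laurent_nonneg (h_pm Tw (-1) x y z) <->
  pair_nonneg (tw_htilde Tw x y)@_(val z) (tw_hsigma Tw x y)@_z.
Proof.
have E eps : laurent_nonneg (h_pm Tw eps x y z) <->
    laurent_nonneg ((tw_htilde Tw x y)@_(val z) + (tw_hsigma Tw x y)@_z *~ eps).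
  by split=> nn i; have := nn i; rewrite coef_h_pm half_ge0.
by rewrite !E [X in _ + X]mulr1z [X in _ /\ laurent_nonneg (_ + X)]mulrN1z.
Qed.

Lemma int_form_h_pm eps x (y z : I) a :
  (tw_htilde Tw x y)@_(val z) + (tw_hsigma Tw x y)@_z *~ eps = a + a ->
  int_form (h_pm Tw eps x y z) a.
Proof.
move=> E i; rewrite coef_h_pm E mcoeffD intrD.
by field.
Qed.

Lemma h_pm_int_form eps x (y z : I) a : int_form (h_pm Tw eps x y z) a ->
  (tw_htilde Tw x y)@_(val z) + (tw_hsigma Tw x y)@_z *~ eps = a + a.
Proof.
move=> ia; apply/malgP => i; apply: (@intr_inj rat); have := ia i.
by rewrite coef_h_pm [(a + a)@_i]mcoeffD intrD => <-; field.
Qed.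

Lemma laurent_double (a f : Zv) : a + a = f -> forall i, f@_i = a@_i *+ 2.
Proof. by move=> <- i; rewrite mcoeffD mulr2n. Qed.

(** A version of [unimodal_symuni] that applies to integral and to rational
    coefficients. *)
Lemma symuni_of_unimodal (R : numDomainType) (e : bool) (g : laurent R) (a : Zv) :
  int_form g a -> (forall i, a@_(- i) = a@_i) -> parity e a ->
  (forall d, has_degree g d -> unimodal_in_q (vpow R d * g)) -> symuni e a.
Proof.
move=> ga sy pa um; have [d hd] := has_degree_exists g.
have [f gf uf] := unimodal_in_q_int (um d hd).
have fa : f = a.
  by apply/malgP => i; apply: (@intr_inj R); rewrite -ga -gf.
subst f; case: hd => [[g0 _]|[_ top]].
  suff -> : a = 0 by apply: symuni_0.
  by apply/malgP => i; apply: (@intr_inj R); rewrite -ga g0 !mcoeff0.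
apply: (unimodal_symuni (d := d)) => // i ai; apply: top.
by rewrite ga intr_eq0.
Qed.

Lemma h_pm_pair_symuni e x (y z : I) :
  let f := (tw_htilde Tw x y)@_(val z) in let g := (tw_hsigma Tw x y)@_z in
  lbar f = f -> lbar g = g -> parity e f -> parity e g ->
  (forall dp dm,
    has_degree (h_pm Tw 1 x y z) dp -> has_degree (h_pm Tw (-1) x y z) dm ->
    unimodal_in_q (vpow _ dp * h_pm Tw 1 x y z) /\
    unimodal_in_q (vpow _ dm * h_pm Tw (-1) x y z)) ->
  pair_symuni f g.
Proof.
move=> f g bf bg pf pg um.
have [dp hp] := has_degree_exists (h_pm Tw 1 x y z).
have [dm hm] := has_degree_exists (h_pm Tw (-1) x y z).
have half eps a : eps = 1 \/ eps = -1 -> a + a = f + g *~ eps ->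
    (forall i, a@_(- i) = a@_i) /\ parity e a.
  move=> e1 /laurent_double E.
  have ce i : (f + g *~ eps)@_i = f@_i + g@_i *~ eps.
    by rewrite mcoeffD; congr (_ + _); apply: raddfMz.
  have sy (k : Zv) : lbar k = k -> forall i, k@_(- i) = k@_i.
    by move=> bk i; rewrite -{1}bk coef_lbar opprK.
  split=> i.
    have : a@_(- i) *+ 2 = a@_i *+ 2 by rewrite -!E !ce (sy f bf) (sy g bg).
    by rewrite !mulr2n; lia.
  move=> ai; have [fi|/pf //] := eqVneq (f@_i) 0.
  have [gi|/pg //] := eqVneq (g@_i) 0.
  by have := E i; rewrite ce fi gi mul0rz addr0 mulr2n; move/eqP: ai; lia.
have [u1 _] := um _ _ hp hm; have [a ha _] := unimodal_in_q_int u1.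
have [_ u2] := um _ _ hp hm; have [b hb _] := unimodal_in_q_int u2.
have Ea := h_pm_int_form ha; have Eb := h_pm_int_form hb.
have [sa pa] := half 1 a (or_introl erefl) (esym Ea).
have [sb pb] := half (-1) b (or_intror erefl) (esym Eb).
exists e, a, b; split.
- exact: (symuni_of_unimodal ha sa pa (fun d hd => proj1 (um d dm hd hm))).
- exact: (symuni_of_unimodal hb sb pb (fun d hd => proj2 (um dp d hp hd))).
- apply/malgP => i; rewrite mcoeffD.
  have := congr1 (mcoeff i) Ea; have := congr1 (mcoeff i) Eb.
  rewrite mulrN1z mulr1z !mcoeffD mcoeffN -/f -/g; lia.
apply/malgP => i; rewrite mcoeffB.
have := congr1 (mcoeff i) Ea; have := congr1 (mcoeff i) Eb.
by rewrite mulrN1z mulr1z !mcoeffD mcoeffN -/f -/g; lia.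
Qed.

Lemma pair_symuni_h_pm x (y z : I) dp dm :
  pair_symuni (tw_htilde Tw x y)@_(val z) (tw_hsigma Tw x y)@_z ->
  has_degree (h_pm Tw 1 x y z) dp -> has_degree (h_pm Tw (-1) x y z) dm ->
  unimodal_in_q (vpow _ dp * h_pm Tw 1 x y z) /\
  unimodal_in_q (vpow _ dm * h_pm Tw (-1) x y z).
Proof.
move=> [e [a [b [sa sb Ef Eg]]]] hp hm; split.
  apply: (symuni_unimodal sa _ hp); apply: int_form_h_pm.
  by rewrite Ef Eg mulr1z; ring.
apply: (symuni_unimodal sb _ hm); apply: int_form_h_pm.
by rewrite Ef Eg mulrN1z; ring.
Qed.

End Properties.

(** * From the irreducible factors to the whole group *)

(** Positivity of structure constants in the sense of C or of D. *)
Definition coef_pos (X : property_name) (e : bool) (f : Zv) : Prop :=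
  if X is PropD then symuni e f else laurent_nonneg f.

Definition pair_pos (X : property_name) (f g : Zv) : Prop :=
  if X is PropD then pair_symuni f g else pair_nonneg f g.

Lemma coef_pos1 X : coef_pos X false 1.
Proof.
case: X => /=; try by move=> i; rewrite coef_1.
by rewrite -qint0; apply: (symuni_qint 0).
Qed.

Lemma coef_posM X e1 e2 f g :
  coef_pos X e1 f -> coef_pos X e2 g -> coef_pos X (e1 (+) e2) (f * g).
Proof. by case: X; [exact: nonnegM..| exact: symuniM]. Qed.

Lemma coef_pos0 X e : coef_pos X e 0.
Proof. by case: X; [move=> i; rewrite mcoeff0.. | exact: symuni_0]. Qed.

Lemma coef_pos_sum X e (I : Type) (r : seq I) (F : I -> Zv) :
  (forall i, coef_pos X e (F i)) -> coef_pos X e (\sum_(i <- r) F i).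
Proof.
move=> nF; apply: big_ind => //; first exact: coef_pos0.
by case: X {nF}; [exact: nonnegD.. | exact: symuniD].
Qed.

Lemma pair_pos1 X : pair_pos X 1 1.
Proof. by case: X; [exact: pair_nonneg1..| exact: pair_symuni1]. Qed.

Lemma pair_posM X f1 g1 f2 g2 :
  pair_pos X f1 g1 -> pair_pos X f2 g2 -> pair_pos X (f1 * f2) (g1 * g2).
Proof. by case: X; [exact: pair_nonnegM..| exact: pair_symuniM]. Qed.

Lemma pair_pos_sq X e f : coef_pos X e f -> pair_pos X (f ^+ 2) (lsq f).
Proof. by case: X; [exact: pair_nonneg_sq..| exact: pair_symuni_sq]. Qed.

Lemma factor0 (W : groupType) (S : W -> Prop) : factor S (fun=> False).
Proof. by split. Qed.

Section Local.
Variables (W : groupType) (S : W -> Prop) (cox : coxeter_system S).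
Variable K : kl_theory S.
Local Notation ell := (ell S).

Lemma inW0 w : inW S (fun=> False) w -> w = 1%g.
Proof. by move: w; apply: (pr_ind cox (factor0 S)). Qed.

Lemma bruhat_le1 y : bruhat_le S y 1%g -> y = 1%g.
Proof. by move/bruhat_le_ell => [//|]; rewrite ell1. Qed.

Lemma kl_c1 : kl_c K 1%g = basis 1%g.
Proof.
apply/malgP => y; rewrite kl_coef ell1 coef_basis.
have [<-|ne] := eqVneq 1%g y; first by rewrite LPww mulr1 vpow0.
have -> : LP K y 1%g = 0; last by rewrite mulr0.
apply: LP_nlt; last by rewrite eq_sym.
by case=> /bruhat_le1.
Qed.

Lemma kl_h1 : kl_h K 1%g 1%g = basis 1%g.
Proof.
apply: (lincomb_inj (kl_diag K) (@kl_tri _ _ K)).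
rewrite -kl_hE lincomb_basis {1}kl_c1; exact: (hecke1l (kl_hecke cox K)).
Qed.

(** The properties for the elements of one factor, with the polynomials turned
    into Laurent polynomials and unimodality replaced by [symuni]. *)
Definition local (X : property_name) (J : W -> Prop) : Prop :=
  match X with
  | PropA => forall y w, inW S J y -> inW S J w -> laurent_nonneg (LP K y w)
  | Defs.PropB => forall y z w, inW S J y -> inW S J z -> inW S J w ->
      bruhat_le S y z -> laurent_nonneg (LP K y w - LP K z w)
  | _ => forall x y z, inW S J x -> inW S J y -> inW S J z ->
      coef_pos X (odd (ell x + ell y + ell z)) (kl_h K x y)@_z
  end.

Lemma local0 X : local X (fun=> False).
Proof.
have h : forall x y z, inW S (fun=> False) x -> inW S (fun=> False) y ->
    inW S (fun=> False) z ->
    coef_pos X (odd (ell x + ell y + ell z)) (kl_h K x y)@_z.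
  move=> x y z /inW0 -> /inW0 -> /inW0 ->; rewrite kl_h1 coef_basis eqxx ell1.
  exact: coef_pos1.
case: X h => //= _.
  by move=> y w /inW0 -> /inW0 -> i; rewrite LPww coef_1.
by move=> y z w /inW0 -> /inW0 -> _ _ i; rewrite subrr mcoeff0.
Qed.

(** Compare P_{y,w} with P_{w,w} = 1. *)
Lemma local_BA J : local Defs.PropB J -> local PropA J.
Proof.
move=> B y w Jy Jw; have [le|nle] := EM (bruhat_le S y w).
  have := B _ _ _ Jy Jw Jw le; rewrite LPww => nn.
  by rewrite -[LP K y w](subrK 1); apply: nonnegD => // i; rewrite coef_1.
rewrite LP_nlt; first by move=> i; rewrite mcoeff0.
  by case=> /nle.
by apply: contra_not_neq nle => ->; apply: rt_refl.
Qed.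

Lemma local_restrict X J : factor S J -> property (gen_group_gens J) X -> local X J.
Proof.
move=> fJ; pose KG := kl_restrict cox fJ K.
have hG x y z : (kl_h KG x y)@_z = (kl_h K (val x) (val y))@_(val z).
  by apply: (coef_restrict val_inj).
case: X => /= pX.
- move=> y w /(lift_pr cox fJ)[y' <-] /(lift_pr cox fJ)[w' <-].
  by apply/laurent_nonneg_at; apply: (pX KG y' w').
- move=> y z w /(lift_pr cox fJ)[y' <-] /(lift_pr cox fJ)[z' <-].
  move=> /(lift_pr cox fJ)[w' <-] /(bruhat_le_gen cox fJ) le.
  by rewrite -at_laurentB; apply/laurent_nonneg_at; apply: (pX KG y' z' w').
- move=> x y z /(lift_pr cox fJ)[x' <-] /(lift_pr cox fJ)[y' <-].
  by move=> /(lift_pr cox fJ)[z' <-]; rewrite -hG; apply: pX.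
move=> x y z /(lift_pr cox fJ)[x' <-] /(lift_pr cox fJ)[y' <-].
move=> /(lift_pr cox fJ)[z' <-].
have bh := @kl_h_bar _ _ cox K (val x') (val y') (val z').
have ph := @kl_h_parity _ _ cox K (val x') (val y') (val z').
apply: (@symuni_of_unimodal int _ (kl_h KG x' y')@_z') => //.
- by move=> i; rewrite hG intz.
- by move=> i; rewrite -{1}bh coef_lbar opprK.
by move=> d hd; apply: pX.
Qed.

Lemma local_glue X J1 J2 : factor S J1 -> factor S J2 ->
  (forall s, J1 s -> ~ J2 s) -> local X J1 -> local X J2 ->
  local X (fun s => J1 s \/ J2 s).
Proof.
move=> f1 f2 dis; have f1' := factor_compl f1.
have in1 w : inW S J1 (pr S J1 w) := inWpr cox w f1.
have in2 w : inW S (fun s => J1 s \/ J2 s) w -> inW S J2 (pr S (compl S J1) w).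
  exact: prU_compl.
have h : (forall x y z, inW S J1 x -> inW S J1 y -> inW S J1 z ->
      coef_pos X (odd (ell x + ell y + ell z)) (kl_h K x y)@_z) ->
    (forall x y z, inW S J2 x -> inW S J2 y -> inW S J2 z ->
      coef_pos X (odd (ell x + ell y + ell z)) (kl_h K x y)@_z) ->
    forall x y z, inW S (fun s => J1 s \/ J2 s) x ->
      inW S (fun s => J1 s \/ J2 s) y -> inW S (fun s => J1 s \/ J2 s) z ->
      coef_pos X (odd (ell x + ell y + ell z)) (kl_h K x y)@_z.
  move=> h1 h2 x y z Jx Jy Jz; rewrite (kl_h_split cox K x y z f1).
  rewrite (ell_split cox f1 x) (ell_split cox f1 y) (ell_split cox f1 z).
  set a := (ell _ + ell _ + _ + _)%N.
  have -> : odd a = odd (ell (pr S J1 x) + ell (pr S J1 y) + ell (pr S J1 z)) (+)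
      odd (ell (pr S (compl S J1) x) + ell (pr S (compl S J1) y)
           + ell (pr S (compl S J1) z)) by rewrite /a; lia.
  by apply: coef_posM; [apply: h1 | apply: h2 => //; apply: in2].
case: X h => /= h l1 l2; try exact: h.
- move=> y w Jy Jw; rewrite (LP_split cox K _ _ f1).
  by apply: nonnegM; [apply: l1 | apply: l2; apply: in2].
have a1 := local_BA l1; have a2 := local_BA l2.
move=> y z w Jy Jz Jw le; rewrite (LP_split cox K y w f1) (LP_split cox K z w f1).
set y1 := LP _ _ _; set y2 := LP _ _ _; set z1 := LP _ _ _; set z2 := LP _ _ _.
have -> : y1 * y2 - z1 * z2 = (y1 - z1) * y2 + z1 * (y2 - z2) by ring.
apply: nonnegD; apply: nonnegM.
- by apply: l1 => //; apply: bruhat_pr.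
- by apply: a2; apply: in2.
- by apply: a1.
by apply: l2; try exact: in2; apply: bruhat_pr.
Qed.

Lemma local_property X :
  (forall ws : seq W, exists J, local X J /\ forall w, w \in ws -> inW S J w) ->
  match X with
  | PropA => forall y w, poly_nonneg (kl_P K y w)
  | Defs.PropB => forall y z w, bruhat_le S y z -> poly_nonneg (kl_P K y w - kl_P K z w)
  | PropC => forall x y z, laurent_nonneg (kl_h K x y)@_z
  | PropD => forall x y z d, has_degree (kl_h K x y)@_z d ->
      unimodal_in_q (vpow _ d * (kl_h K x y)@_z)
  end.
Proof.
case: X => L.
- move=> y w; have [J [l inJ]] := L [:: y; w].
  by apply/laurent_nonneg_at; apply: l; apply: inJ; rewrite !inE eqxx ?orbT.
- move=> y z w le; have [J [l inJ]] := L [:: y; z; w].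
  apply/laurent_nonneg_at; rewrite at_laurentB.
  by apply: l => //; apply: inJ; rewrite !inE eqxx ?orbT.
- move=> x y z; have [J [l inJ]] := L [:: x; y; z].
  by apply: l; apply: inJ; rewrite !inE eqxx ?orbT.
move=> x y z d; have [J [l inJ]] := L [:: x; y; z].
have s : symuni (odd (ell x + ell y + ell z)) (kl_h K x y)@_z.
  by apply: l; apply: inJ; rewrite !inE eqxx ?orbT.
by apply: (symuni_unimodal s) => i; rewrite intz.
Qed.

End Local.

Section LocalTwisted.
Variables (W : groupType) (S : W -> Prop) (star : W -> W).
Hypotheses (cox : coxeter_system S) (st : preserving_involution S star).
Variables (K : kl_theory S) (Tw : twisted_theory star K).
Local Notation ell := (ell S).
Local Notation I := (twisted_invol star).
Local Notation ht x y z := (tw_htilde Tw x y)@_(val z).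
Local Notation hs x y z := (tw_hsigma Tw x y)@_z.

Definition local' (X : property_name) (J : W -> Prop) : Prop :=
  match X with
  | PropA => forall y w : I, inI S J y -> inI S J w ->
      pair_nonneg (LP K (val y) (val w)) (LPs Tw y w)
  | Defs.PropB => forall y z w : I, inI S J y -> inI S J z -> inI S J w ->
      bruhat_le S (val y) (val z) ->
      pair_nonneg (LP K (val y) (val w) - LP K (val z) (val w))
        (LPs Tw y w - LPs Tw z w)
  | _ => forall x (y z : I), inW S J x -> inI S J y -> inI S J z ->
      pair_pos X (ht x y z) (hs x y z)
  end.

Lemma tw_C1 : tw_C Tw 1%g = basis 1%g.
Proof. by rewrite tw_CE2 (kl_c1 K) (mapc_basis lsq0 lsq1). Qed.

Lemma htilde1 (e : I) : val e = 1%g -> tw_htilde Tw 1%g e = basis 1%g.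
Proof.
move=> e1; apply: (lincomb_inj (kl_diag K) (@kl_tri _ _ K)).
rewrite -(tw_htildeE Tw) e1 (star1 st) invg1 lincomb_basis {1 2}kl_c1.
by rewrite !(hecke1l (kl_hecke cox K)).
Qed.

Lemma hsigma1 (e : I) : val e = 1%g -> tw_hsigma Tw 1%g e = basis e.
Proof.
move=> e1; have tri := tw_tri (Tw := Tw).
apply: (lincomb_inj (len := fun y : I => ell (val y)) (tw_diag Tw) tri).
rewrite -tw_hsigmaE lincomb_basis tw_C1; exact: (tw_act1 (tw_actP Tw)).
Qed.

Lemma inI0 (y w : I) : inI S (fun=> False) y -> inI S (fun=> False) w -> y = w.
Proof. by move=> /(inW0 cox) e1 /(inW0 cox) e2; apply: val_inj; rewrite e1 e2. Qed.

Lemma local'0 X : local' X (fun=> False).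
Proof.
have h : forall x (y z : I), inW S (fun=> False) x -> inI S (fun=> False) y ->
    inI S (fun=> False) z -> pair_pos X (ht x y z) (hs x y z).
  move=> x y z /(inW0 cox) -> y0 z0; rewrite (inI0 z0 y0).
  have y1 : val y = 1%g := inW0 cox y0.
  rewrite (htilde1 y1) (hsigma1 y1) !coef_basis y1 !eqxx; exact: pair_pos1.
case: X h => //= _.
  by move=> y w y0 w0; rewrite (inI0 y0 w0) LPww LPsww; apply: pair_nonneg1.
move=> y z w y0 z0 _ _; rewrite (inI0 y0 z0) !subrr.
by apply: pair_nonneg0 => i; rewrite mcoeff0.
Qed.

(** Compare with P_{w,w} = P^sigma_{w,w} = 1. *)
Lemma local'_BA J : local' Defs.PropB J -> local' PropA J.
Proof.
move=> B y w Jy Jw; have [le|nle] := EM (bruhat_le S (val y) (val w)).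
  have := B _ _ _ Jy Jw Jw le; rewrite LPww LPsww => nn.
  rewrite -[LP K _ _](subrK 1) -[LPs Tw y w](subrK 1).
  by apply: pair_nonnegD => //; apply: pair_nonneg1.
rewrite LP_nlt; [|by case=> /nle|]; last first.
  by apply: contra_not_neq nle => ->; apply: rt_refl.
rewrite LPs_nlt; [|by case=> /nle|]; last first.
  by apply: contra_not_neq nle => ->; apply: rt_refl.
by apply: pair_nonneg0 => i; rewrite mcoeff0.
Qed.

Lemma local'_restrict X J (fJ : factor S J) (sJ : star_set star J = J) :
  property'_star (gen_group_gens J) X (@starG W J star) -> local' X J.
Proof.
pose KG := kl_restrict cox fJ K; pose TwG := twisted_restrict cox fJ st sJ Tw.
pose i := @iG W S J star cox fJ st sJ.
have lift (w : I) : inI S J w -> exists g, i g = w by move/(inI_iG cox fJ st sJ).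
have vi g : val (i g) = val (val g) by apply: val_iG.
have htG x y z : (tw_htilde TwG x y)@_(val z) = ht (val x) (i y) (i z).
  by rewrite vi; apply: (coef_restrict val_inj).
have hsG x y z : (tw_hsigma TwG x y)@_z = hs (val x) (i y) (i z).
  by apply: (coef_restrict (@iG_inj _ _ _ _ cox fJ st sJ)).
have LPG y w : LP KG (val y) (val w) = LP K (val (i y)) (val (i w)).
  by rewrite !vi.
have LPsG y w : LPs TwG y w = LPs Tw (i y) (i w) by [].
case: X => /= pX.
- move=> y w /lift[y' <-] /lift[w' <-]; rewrite -LPG -LPsG.
  exact/P_pm_nonneg/(pX KG TwG).
- move=> y z w /lift[y' <-] /lift[z' <-] /lift[w' <-] le.
  rewrite -!LPG -!LPsG; apply/P_pm_mono/(pX KG TwG).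
  by apply/(bruhat_le_gen cox fJ); rewrite -!vi.
- move=> x y z /(lift_pr cox fJ)[x' <-] /lift[y' <-] /lift[z' <-].
  by rewrite -htG -hsG; apply/h_pm_nonneg/(pX KG TwG).
move=> x y z /(lift_pr cox fJ)[x' <-] /lift[y' <-] /lift[z' <-].
rewrite -htG -hsG; apply: (h_pm_pair_symuni
  (e := odd (ell (val (i y')) + ell (val (i z'))))).
- by rewrite htG; apply: htilde_bar.
- by rewrite hsG; apply: hsigma_bar.
- by rewrite htG; apply: htilde_parity.
- by rewrite hsG; apply: hsigma_parity.
exact: (pX KG TwG).
Qed.

(** By [LP_swap] and its companions, what is to be shown is [pair_pos_sq].  For B
    the difference of squares is f^2 - g^2 = d^2 + 2 d g with d = f - g. *)
Lemma local'_swap X J : factor S J -> (forall s, J s -> ~ J (star s)) ->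
  local K X J -> local' X (fun s => J s \/ star_set star J s).
Proof.
move=> fJ dj.
have h : (forall x y z, inW S J x -> inW S J y -> inW S J z ->
      coef_pos X (odd (ell x + ell y + ell z)) (kl_h K x y)@_z) ->
    forall x (y z : I), inW S (fun s => J s \/ star_set star J s) x ->
      inI S (fun s => J s \/ star_set star J s) y ->
      inI S (fun s => J s \/ star_set star J s) z ->
      pair_pos X (ht x y z) (hs x y z).
  move=> l x y z Jx Jy Jz; rewrite (htilde_swap cox st Tw fJ dj Jx Jy Jz).
  rewrite (hsigma_swap cox st Tw fJ dj Jx Jy Jz).
  set y1 := pr S J (val y); set z1 := pr S J (val z); set x1 := pr S J x.
  have Jx1 : inW S J x1 := inWpr cox x fJ.
  have Jy1 : inW S J y1 := inWpr cox _ fJ.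
  have Jz1 : inW S J z1 := inWpr cox _ fJ.
  pose x2 := (star (pr S (compl S J) x))^-1%g.
  have Jx2 : inW S J x2.
    exact/(inWV cox fJ)/(swap_star cox st fJ)/(swap_p' cox st fJ dj).
  apply: (pair_pos_sq (e := odd (ell x1 + ell y1 + ell x2 + ell z1))).
  have s1 : spanned (inW S J) (kl_h K x1 y1).
    apply: (kl_coords_spanned cox (K := K) fJ); rewrite -kl_hE.
    by apply: (kl_mul_spanned cox fJ); apply: kl_spanned.
  rewrite /swap_coords coef_lincomb; apply: coef_pos_sum => u.
  have [->|/s1 Ju] := eqVneq ((kl_h K x1 y1)@_u) 0.
    by rewrite mul0r; apply: coef_pos0.
  have -> : odd (ell x1 + ell y1 + ell x2 + ell z1) =
      odd (ell x1 + ell y1 + ell u) (+) odd (ell u + ell x2 + ell z1) by lia.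
  by apply: coef_posM; apply: l.
case: X h => /= h l; try exact: h.
- move=> y w Jy Jw; rewrite (LP_swap cox st K fJ dj Jy Jw).
  rewrite (LPs_swap cox st Tw fJ dj Jy Jw).
  by apply: pair_nonneg_sq; apply: l; apply: inWpr.
have a := local_BA l; move=> y z w Jy Jz Jw le.
rewrite (LP_swap cox st K fJ dj Jy Jw) (LPs_swap cox st Tw fJ dj Jy Jw).
rewrite (LP_swap cox st K fJ dj Jz Jw) (LPs_swap cox st Tw fJ dj Jz Jw).
set f := LP _ _ _; set g := LP _ _ _; pose d := f - g.
have nd : laurent_nonneg d.
  by apply: l; try exact: inWpr; apply: bruhat_pr.
have ng : laurent_nonneg g by apply: a; apply: inWpr.
have -> : f ^+ 2 - g ^+ 2 = d ^+ 2 + (d * g + d * g) by rewrite /d; ring.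
have -> : lsq f - lsq g = lsq d + 0 by rewrite /d lsqD lsqN addr0.
apply: pair_nonnegD; first exact: pair_nonneg_sq.
by apply: pair_nonneg0; apply: nonnegD; apply: nonnegM.
Qed.

Lemma local'_glue X J1 J2 : factor S J1 -> factor S J2 ->
  star_set star J1 = J1 -> star_set star J2 = J2 ->
  (forall s, J1 s -> ~ J2 s) -> local' X J1 -> local' X J2 ->
  local' X (fun s => J1 s \/ J2 s).
Proof.
move=> f1 f2 s1 s2 dis; have f1' := factor_compl f1; have s1' := star_compl st s1.
have in1 (w : I) : inI S J1 (prI S J1 w : I) := prI_inI cox st f1 s1 w.
have in2' w : inW S (fun s => J1 s \/ J2 s) w -> inW S J2 (pr S (compl S J1) w).
  exact: prU_compl.
have in2 (w : I) : inI S (fun s => J1 s \/ J2 s) w ->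
    inI S J2 (prI S (compl S J1) w : I).
  by move=> Jw; rewrite /inI (val_prI cox st f1' s1'); apply: in2'.
have v1 (w : I) := val_prI cox st f1 s1 w.
have v2 (w : I) := val_prI cox st f1' s1' w.
have h : (forall x (y z : I), inW S J1 x -> inI S J1 y -> inI S J1 z ->
      pair_pos X (ht x y z) (hs x y z)) ->
    (forall x (y z : I), inW S J2 x -> inI S J2 y -> inI S J2 z ->
      pair_pos X (ht x y z) (hs x y z)) ->
    forall x (y z : I), inW S (fun s => J1 s \/ J2 s) x ->
      inI S (fun s => J1 s \/ J2 s) y -> inI S (fun s => J1 s \/ J2 s) z ->
      pair_pos X (ht x y z) (hs x y z).
  move=> h1 h2 x y z Jx Jy Jz.
  rewrite (htilde_split cox st Tw f1 s1) (hsigma_split cox st Tw f1 s1).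
  rewrite -v1 -v2; apply: pair_posM; first by apply: h1 => //; apply: inWpr.
  by apply: h2; [apply: in2' | apply: in2 | apply: in2].
case: X h => /= h l1 l2; try exact: h.
- move=> y w Jy Jw; rewrite (LP_split cox K _ _ f1) (LPs_split cox st Tw f1 s1).
  by rewrite -!v1 -!v2; apply: pair_nonnegM; [apply: l1 | apply: l2; apply: in2].
have a1 := local'_BA l1; have a2 := local'_BA l2.
move=> y z w Jy Jz Jw le.
rewrite (LP_split cox K (val y) _ f1) (LP_split cox K (val z) _ f1).
rewrite (LPs_split cox st Tw f1 s1 y) (LPs_split cox st Tw f1 s1 z).
rewrite -!v1 -!v2.
set y1 := LP _ _ _; set y2 := LP _ _ _; set z1 := LP _ _ _; set z2 := LP _ _ _.
set y1' := LPs _ _ _; set y2' := LPs _ _ _; set z1' := LPs _ _ _.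
set z2' := LPs _ _ _.
have -> : y1 * y2 - z1 * z2 = (y1 - z1) * y2 + z1 * (y2 - z2) by ring.
have -> : y1' * y2' - z1' * z2' = (y1' - z1') * y2' + z1' * (y2' - z2') by ring.
apply: pair_nonnegD; apply: pair_nonnegM.
- by apply: l1 => //; rewrite !v1; apply: bruhat_pr.
- by apply: a2; apply: in2.
- by apply: a1.
by apply: l2; try exact: in2; rewrite !v2; apply: bruhat_pr.
Qed.

Lemma local'_property X :
  (forall ws : seq W, exists J, local' X J /\ forall w, w \in ws -> inW S J w) ->
  match X with
  | PropA => forall y w,
      poly_nonneg (P_pm Tw 1 y w) /\ poly_nonneg (P_pm Tw (-1) y w)
  | Defs.PropB => forall y z w, bruhat_le S (val y) (val z) ->
      poly_nonneg (P_pm Tw 1 y w - P_pm Tw 1 z w) /\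
      poly_nonneg (P_pm Tw (-1) y w - P_pm Tw (-1) z w)
  | PropC => forall x y z,
      laurent_nonneg (h_pm Tw 1 x y z) /\ laurent_nonneg (h_pm Tw (-1) x y z)
  | PropD => forall x y z dp dm,
      has_degree (h_pm Tw 1 x y z) dp -> has_degree (h_pm Tw (-1) x y z) dm ->
      unimodal_in_q (vpow _ dp * h_pm Tw 1 x y z) /\
      unimodal_in_q (vpow _ dm * h_pm Tw (-1) x y z)
  end.
Proof.
case: X => L.
- move=> y w; have [J [l inJ]] := L [:: val y; val w].
  by apply/P_pm_nonneg; apply: l; apply: inJ; rewrite !inE eqxx ?orbT.
- move=> y z w le; have [J [l inJ]] := L [:: val y; val z; val w].
  by apply/P_pm_mono; apply: l => //; apply: inJ; rewrite !inE eqxx ?orbT.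
- move=> x y z; have [J [l inJ]] := L [:: x; val y; val z].
  by apply/h_pm_nonneg; apply: l; apply: inJ; rewrite !inE eqxx ?orbT.
move=> x y z dp dm; have [J [l inJ]] := L [:: x; val y; val z].
apply: pair_symuni_h_pm.
by apply: l; apply: inJ; rewrite !inE eqxx ?orbT.
Qed.

End LocalTwisted.

Lemma preserving_id (W : groupType) (S : W -> Prop) : preserving_involution S id.
Proof. by split. Qed.

Theorem theorem1p8 (X : property_name) (W : groupType) (S : W -> Prop)
    (coxWS : coxeter_system S)
    (factors : forall J : W -> Prop, diagram_component S J ->
       property (gen_group_gens J) X /\ property' (gen_group_gens J) X) :
  property S X /\ property' S X.
Proof.
have dc s : S s -> diagram_component S (comp S s) by move=> Ss; exists s.
have lc (K : kl_theory S) s : S s -> local K X (comp S s).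
  move=> Ss; have [p _] := factors _ (dc s Ss).
  exact: (local_restrict coxWS K (factor_comp coxWS Ss) p).
split.
  suff H (K : kl_theory S) : forall ws : seq W,
      exists J, local K X J /\ forall w, w \in ws -> inW S J w.
    by case: X {factors lc} H => H K; apply: (local_property (H K)).
  move=> ws.
  have [||||J [_ _ l inJ]] := factor_induction coxWS (preserving_id S) (Phi := local K X) _ _ _ _ ws.
  - exact: local0.
  - by move=> s Ss _; apply: lc.
  - by move=> s Ss /(_ s (rt_refl _ _ _)) []; apply: rt_refl.
  - by move=> J1 J2 f1 f2 _ _; apply: (local_glue coxWS).
  by exists J.
move=> star st.
suff H (K : kl_theory S) (Tw : twisted_theory star K) : forall ws : seq W,
    exists J, local' Tw X J /\ forall w, w \in ws -> inW S J w.
  by case: X {factors lc} H => H K Tw; apply: (local'_property (H K Tw)).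
move=> ws.
have [||||J [_ _ l inJ]] := factor_induction coxWS st (Phi := local' Tw X) _ _ _ _ ws.
- exact: local'0.
- move=> s Ss cs; have fc := factor_comp coxWS Ss.
  have [_ p] := factors _ (dc s Ss).
  have Z := local'_restrict coxWS st Tw fc cs (p _ (preserving_starG coxWS fc st cs)).
  exact Z.
- move=> s Ss dj; apply: (local'_swap coxWS st) => //; last exact: lc.
  exact: factor_comp.
- by move=> J1 J2 f1 f2 s1 s2; apply: (local'_glue coxWS st).
by exists J.
Qed.
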